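(* Let $d\ge 1$, let $(T_{\underline{i}})_{\underline{i}\in\mathbb{Z}^d}$ be a $\mathbb{Z}^d$ action on a probability space $(\Omega,\mathcal{A},\mu)$, and let $f\in L^2(\mu)$ be such that $(f\circ T_{\underline{i}})_{\underline{i}\in\mathbb{Z}^d}$ is a multiple field of martingale differences. Then there exists a nonnegative random variable $\eta^2$ (possibly defined on another probability space) with $E\eta^2=\|f\|_2^2$ such that, as $n_j\to\infty$ for all $j=1,\dots,d$ (i.e. $\min\{n_1,\dots,n_d\}\to\infty$), the random variables $$\frac{1}{\sqrt{n_1\cdots n_d}}\sum_{i_1=1}^{n_1}\cdots\sum_{i_d=1}^{n_d} f\circ T_{(i_1,\dots,i_d)}$$ converge in distribution to the law with characteristic function $t\mapsto E\exp(-\eta^2t^2/2)$, and the random variables $$\frac{1}{n_1\cdots n_d}\sum_{i_1=1}^{n_1}\Big(\sum_{i_2=1}^{n_2}\cdots\sum_{i_d=1}^{n_d} f\circ T_{(i_1,\dots,i_d)}\Big)^2$$ converge in distribution to $\eta^2$.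
   Context: A $\mathbb{Z}^d$ action on $(\Omega,\mathcal{A},\mu)$ is a family $(T_{\underline{i}})_{\underline{i}\in\mathbb{Z}^d}$ of automorphisms (bimeasurable measure-preserving bijections) of $(\Omega,\mathcal{A},\mu)$ with $T_{\underline{i}}\circ T_{\underline{j}}=T_{\underline{i}+\underline{j}}$. No ergodicity is assumed. Let $\underline{e_q}\in\mathbb{Z}^d$ be the vector with $1$ at the $q$-th coordinate and $0$ elsewhere. A family $(\mathcal{F}_i^{(q)})_{i\in\mathbb{Z},\,1\le q\le d}$ of sub-$\sigma$-algebras of $\mathcal{A}$ is a multiple filtration if for all $1\le q\le d$ and $i\in\mathbb{Z}$: $\mathcal{F}_i^{(q)}\subset T_{-\underline{e_q}}\mathcal{F}_i^{(q)}=\mathcal{F}_{i+1}^{(q)}$, and $T_{\underline{e_{q'}}}\mathcal{F}_i^{(q)}=\mathcal{F}_i^{(q)}$ for all $1\le q'\le d$, $q'\ne q$. For $f\in L^1(\mu)$, $(f\circ T_{\underline{i}})_{\underline{i}}$ is a multiple field of martingale differences if there is a multiple filtration $(\mathcal{F}_i^{(q)})$ such that $f=E(f\mid\mathcal{F}_0^{(q)})-E(f\mid\mathcal{F}_{-1}^{(q)})$ for all $1\le q\le d$. *)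

(* Defs.v *)
From HB Require Import structures.
From mathcomp Require Import all_boot all_order all_algebra.
From mathcomp Require Import all_classical all_reals all_analysis.
From mathcomp Require Import complex.

Set Implicit Arguments.
Unset Strict Implicit.
Unset Printing Implicit Defensive.

Import Order.TTheory GRing.Theory Num.Theory.
Import numFieldNormedType.Exports.

Local Open Scope classical_set_scope.
Local Open Scope ring_scope.
Local Open Scope complex_scope.

Record automorphism (disp : measure_display) (Omega : measurableType disp)
    (R : realType) (P : probability Omega R) (S : Omega -> Omega) : Prop := {
  automorphism_bij : bijective S;
  automorphism_measurable : measurable_fun [set: Omega] S;
  automorphism_inv_measurable :
    forall A, measurable A -> measurable (S @` A);
  automorphism_preserving :
    forall A, measurable A -> P (S @^-1` A) = P A }.

Record Zd_action (disp : measure_display) (Omega : measurableType disp)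
    (R : realType) (P : probability Omega R) (d : nat)
    (T : 'rV[int]_d -> Omega -> Omega) : Prop := {
  Zd_action_automorphism : forall i, automorphism P (T i);
  Zd_actionD : forall i j, T i \o T j = T (i + j) }.

Definition sub_sigma_algebra_of (disp : measure_display)
    (Omega : measurableType disp) (G : set_system Omega) : Prop :=
  sigma_algebra [set: Omega] G /\ G `<=` @measurable disp Omega.

(* The family [S A], for [A] in [G]. *)
Definition transport (Omega : Type) (S : Omega -> Omega)
    (G : set_system Omega) : set_system Omega :=
  [set S @` A | A in G].

(* The coordinates are numbered from 0, and [delta_mx 0 q] is the [q]-th vector
   of the canonical basis. *)
Record multiple_filtration (disp : measure_display)
    (Omega : measurableType disp) (d : nat)
    (T : 'rV[int]_d -> Omega -> Omega)
    (F : 'I_d -> int -> set_system Omega) : Prop := {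
  multiple_filtration_sub : forall q i, sub_sigma_algebra_of (F q i);
  multiple_filtration_incr :
    forall q i, F q i `<=` transport (T (- delta_mx 0 q)) (F q i);
  multiple_filtration_shift :
    forall q i, transport (T (- delta_mx 0 q)) (F q i) = F q (i + 1);
  multiple_filtration_invariant :
    forall q i q', q' != q -> transport (T (delta_mx 0 q')) (F q i) = F q i }.

(* [g] is a version of the conditional expectation E(f | G). *)
Record is_cond_exp (disp : measure_display) (Omega : measurableType disp)
    (R : realType) (P : probability Omega R) (G : set_system Omega)
    (f g : Omega -> R) : Prop := {
  cond_exp_measurable : forall B : set R, measurable B -> G (g @^-1` B);
  cond_exp_integrable : P.-integrable [set: Omega] (EFin \o g);
  cond_exp_integral : forall A, G A ->
    (\int[P]_(x in A) (g x)%:E = \int[P]_(x in A) (f x)%:E)%E }.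

(* Conditional expectations are defined up to a null set: the identity
   f = E(f | F_0) - E(f | F_{-1}) is an almost sure one between versions. *)
Definition multiple_martingale_differences (disp : measure_display)
    (Omega : measurableType disp) (R : realType) (P : probability Omega R)
    (d : nat) (T : 'rV[int]_d -> Omega -> Omega) (f : Omega -> R) : Prop :=
  f \in Lfun P 1%:E /\
  exists F : 'I_d -> int -> set_system Omega,
    multiple_filtration T F /\
    forall q : 'I_d, exists g0 g1 : Omega -> R,
      [/\ is_cond_exp P (F q 0) f g0,
          is_cond_exp P (F q (- 1)) f g1 &
          {ae P, forall x, f x = g0 x - g1 x}].

Section block_sums.
Context (disp : measure_display) (Omega : measurableType disp) (R : realType).
Context (d : nat) (T : 'rV[int]_d -> Omega -> Omega) (f : Omega -> R).

(* A dependent function [k] in the product of the ['I_(n j)] encodes the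
   multi-index (k_1 + 1, ..., k_d + 1), which lies in
   {1, ..., n_1} x ... x {1, ..., n_d}. *)
Definition block (n : 'I_d -> nat) : finType :=
  {dffun forall j : 'I_d, 'I_(n j)}.

Definition block_index (n : 'I_d -> nat) (k : block n) : 'rV[int]_d :=
  \row_j (k j).+1%:Z.

Definition block_sum (n : 'I_d -> nat) (x : Omega) : R :=
  \sum_(k : block n) f (T (block_index k) x).

(* The sum over the coordinate [q] of the squares of the sums over all the
   other coordinates. *)
Definition block_sum_squares (q : 'I_d) (n : 'I_d -> nat) (x : Omega) : R :=
  \sum_(a < n q)
    (\sum_(k : block n | k q == a) f (T (block_index k) x)) ^+ 2.

Definition normalized_sum (n : 'I_d -> nat) (x : Omega) : R :=
  (Num.sqrt (\prod_(j < d) (n j)%:R))^-1 * block_sum n x.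

Definition normalized_sum_squares (q : 'I_d) (n : 'I_d -> nat) (x : Omega) : R :=
  (\prod_(j < d) (n j)%:R)^-1 * block_sum_squares q n x.

End block_sums.

(* min(n_1, ..., n_d) -> oo *)
Definition all_infty (d : nat) : set_system ('I_d -> nat) :=
  filter_from [set: nat] (fun N => [set n | forall j, (N <= n j)%N]).

#[global] Instance all_infty_filter (d : nat) : ProperFilter (@all_infty d).
Proof.
apply: filter_from_proper; last by move=> N _; exists (fun=> N).
apply: filter_fromT_filter; first by exists 0%N.
move=> M N; exists (maxn M N) => n /= Hn.
by split=> j; move: (Hn j); rewrite geq_max => /andP[].
Qed.

Definition cvg_in_distribution (I : Type) (F : set_system I)
    (disp : measure_display) (Omega : measurableType disp) (R : realType)
    (P : probability Omega R) (X : I -> Omega -> R)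
    (nu : probability R R) : Prop :=
  (forall i, measurable_fun [set: Omega] (X i)) /\
  forall phi : R -> R, continuous phi ->
    (exists M : R, forall y, `|phi y| <= M) ->
    (\int[P]_x (phi (X i x))%:E)%E @[i --> F] --> (\int[nu]_y (phi y)%:E)%E.

(* The characteristic function t |-> \int exp(i t y) dnu(y). *)
Definition charfun (R : realType) (nu : probability R R)
    (t : R) : R[i] :=
  (\int[nu]_y cos (t * y)) +i* (\int[nu]_y sin (t * y)).

(* Main.v *)
(* Fix t and replace f by t f.  Multiply the translates of f by signs that
   depend on one coordinate at a time, independent random signs for each
   direction.  Conditionally on the other directions, a sum with random signs in
   the direction q is a Rademacher sum, so that the expectation of cos (S + th)
   is close to cos th times the Laplace transform, at 1/2, of its bracket, the
   average of the squares of the slices.  By Jensen's inequality the Laplace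
   transform of an average over a long block is almost smaller than over a short
   one; hence, with random signs in all the directions, the expectation of
   cos (S + th) is almost decreasing in each n_q, and it converges jointly.

   The signs are then removed direction by direction.  When the Laplace
   transform of the bracket has a limit, the equality case of Jensen's inequality
   forces the brackets of consecutive blocks to be close to each other, so that
   they may be replaced by the bracket of the first block, which belongs to the
   past of the other blocks.  The martingale property in the direction q alone
   then gives the same limit without random signs in that direction.  What
   remains in the end is E cos (S + th) -> cos th * l(t), where l(t) is also the
   limit of the Laplace transform of the normalized sum of squares at t^2 / 2.

   The laws follow from these limits by polynomial approximation and tightness,
   and E eta^2 = ||f||_2^2 from the uniform integrability of the squares. *)

Require Import Defs.
From HB Require Import structures.
From mathcomp Require Import all_boot all_order all_algebra.
From mathcomp Require Import all_classical all_reals all_analysis.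
From mathcomp Require Import measurable_realfun complex ring lra.

Set Implicit Arguments.
Unset Strict Implicit.
Unset Printing Implicit Defensive.

Import Order.TTheory GRing.Theory Num.Theory.
Import numFieldNormedType.Exports.

Local Open Scope classical_set_scope.
Local Open Scope ring_scope.

(** * Expectations and square integrable functions *)

(** Nothing links the filtrations of two directions beyond invariance under each other's
    translations, so the martingale property can be used in one direction at a time only, and the
    variables it is used for are sums over the other directions, which change with n. Every estimate
    is therefore made uniform over all arrays that share a bound [s2] of the second moments and a
    truncation modulus [Kf]; suitable versions of both survive a summation along a direction.

    The random signs give an estimate valid for arbitrary square integrable variables. It can be
    read both ways, from the cosine to the Laplace transform of the bracket and back. The martingale
    estimate has in its error the gap between the Laplace transforms of the brackets of blocks of
    lengths m and (p + 1) m, and this gap vanishes only once convergence is known: hence the detour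
    through signs.

    The phase [th] keeps the analysis real: th = 0 gives the real part of the characteristic
    function and th = - pi / 2 its imaginary part. *)

Section expectation.
Context (disp : measure_display) (Omega : measurableType disp) (R : realType).
Variable P : probability Omega R.
Implicit Types (f g h : Omega -> R).

Definition mf (f : Omega -> R) := measurable_fun [set: Omega] f.
Definition integ (f : Omega -> R) := P.-integrable [set: Omega] (EFin \o f).
Definition mean (f : Omega -> R) : R := \int[P]_x f x.
Local Notation Ex := mean.
Definition L2 f := mf f /\ integ (fun x => f x ^+ 2).

Lemma mf_cst (c : R) : mf (fun=> c).
Proof. exact: measurable_cst. Qed.
Lemma mfD f g : mf f -> mf g -> mf (fun x => f x + g x).
Proof. exact: measurable_funD. Qed.
Lemma mfB f g : mf f -> mf g -> mf (fun x => f x - g x).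
Proof. exact: measurable_funB. Qed.
Lemma mfM f g : mf f -> mf g -> mf (fun x => f x * g x).
Proof. exact: measurable_funM. Qed.
Lemma mfX f n : mf f -> mf (fun x => f x ^+ n).
Proof. exact: measurable_funX. Qed.
Lemma mf_sum (I : Type) (s : seq I) (p : pred I) (F : I -> Omega -> R) :
  (forall i, mf (F i)) -> mf (fun x => \sum_(i <- s | p i) F i x).
Proof.
move=> mF; rewrite (_ : (fun _ => _) =
  (fun x => \sum_(i <- s) (if p i then F i x else 0))); last first.
  by apply/funext => x; rewrite big_mkcond.
by apply: measurable_sum => i; case: (p i); [exact: mF|exact: mf_cst].
Qed.
Lemma mf_comp (u : R -> R) f : continuous u -> mf f -> mf (fun x => u (f x)).
Proof.
move=> cu mf0; apply: (measurableT_comp (f := u)) => //.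
exact: continuous_measurable_fun.
Qed.

Lemma integ_mf f : integ f -> mf f.
Proof. by move=> /measurable_int /measurable_EFinP. Qed.
Lemma integD f g : integ f -> integ g -> integ (fun x => f x + g x).
Proof. by move=> fi gi; have := integrableD measurableT fi gi. Qed.
Lemma integZ (c : R) f : integ f -> integ (fun x => c * f x).
Proof. by move=> fi; have := integrableZl measurableT c fi. Qed.
Lemma integN f : integ f -> integ (fun x => - f x).
Proof. by move=> fi; have := integrableN fi. Qed.
Lemma integB f g : integ f -> integ g -> integ (fun x => f x - g x).
Proof. by move=> fi gi; apply: integD => //; exact: integN. Qed.
Lemma integ_cst (c : R) : integ (fun=> c).
Proof. exact: finite_measure_integrable_cst. Qed.
Lemma integ_le f h : mf f -> (forall x, `|f x| <= h x) -> integ h -> integ f.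
Proof.
move=> mf0 fh hi; apply: (le_integrable measurableT _ _ hi).
  exact/measurable_EFinP.
move=> x _ /=; rewrite lee_fin (le_trans (fh x))//.
exact: ler_norm.
Qed.
Lemma integ_bdd f (M : R) : mf f -> (forall x, `|f x| <= M) -> integ f.
Proof. by move=> mf0 fM; apply: integ_le fM (integ_cst M). Qed.
Lemma integ_abs f : integ f -> integ (fun x => `|f x|).
Proof.
move=> fi; apply: (integ_le (h := fun x => `|f x|)).
- by apply: mf_comp; [exact: norm_continuous|exact: integ_mf].
- by move=> x; rewrite normr_id.
- by have := integrable_norm fi.
Qed.
Lemma integ_sum (I : Type) (s : seq I) (p : pred I) (F : I -> Omega -> R) :
  (forall i, p i -> integ (F i)) -> integ (fun x => \sum_(i <- s | p i) F i x).
Proof.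
move=> Fi; elim: s => [|i s IH].
  by under eq_fun do rewrite big_nil; exact: integ_cst.
under eq_fun do rewrite big_cons; case: (boolP (p i)) => // pi.
by apply: integD => //; exact: Fi.
Qed.

Lemma eq_Ex f g : f =1 g -> Ex f = Ex g.
Proof. by move=> fg; congr mean; exact/funext. Qed.
Lemma ExD f g : integ f -> integ g -> Ex (fun x => f x + g x) = Ex f + Ex g.
Proof. by move=> fi gi; rewrite /mean RintegralD. Qed.
Lemma ExZ (c : R) f : integ f -> Ex (fun x => c * f x) = c * Ex f.
Proof. by move=> fi; rewrite /mean RintegralZl. Qed.
Lemma ExB f g : integ f -> integ g -> Ex (fun x => f x - g x) = Ex f - Ex g.
Proof. by move=> fi gi; rewrite /mean RintegralB. Qed.
Lemma Ex_cst (c : R) : Ex (fun=> c) = c.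
Proof. by rewrite /mean Rintegral_cst//= probability_setT mulr1. Qed.
Lemma Ex_sum (I : Type) (s : seq I) (p : pred I) (F : I -> Omega -> R) :
  (forall i, p i -> integ (F i)) ->
  Ex (fun x => \sum_(i <- s | p i) F i x) = \sum_(i <- s | p i) Ex (F i).
Proof.
move=> Fi; elim: s => [|i s IH].
  by under eq_Ex do rewrite big_nil; rewrite big_nil Ex_cst.
under eq_Ex do rewrite big_cons; rewrite big_cons; case: (boolP (p i)) => // pi.
by rewrite ExD ?IH//; [exact: Fi|exact: integ_sum].
Qed.
Lemma le_Ex f g : integ f -> integ g -> (forall x, f x <= g x) -> Ex f <= Ex g.
Proof. by move=> fi gi fg; apply: le_Rintegral => //. Qed.
Lemma Ex_ge0 f : (forall x, 0 <= f x) -> 0 <= Ex f.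
Proof. by move=> f0; apply: Rintegral_ge0. Qed.
Lemma abs_Ex f : integ f -> `|Ex f| <= Ex (fun x => `|f x|).
Proof. by move=> fi; apply: le_normr_Rintegral. Qed.
Lemma abs_Ex_le f h : mf f -> integ h -> (forall x, `|f x| <= h x) ->
  `|Ex f| <= Ex h.
Proof.
move=> mf0 hi fh; have fi := integ_le mf0 fh hi.
by apply: (le_trans (abs_Ex fi)); apply: le_Ex => //; exact: integ_abs.
Qed.
Lemma Ex_ae f g : mf f -> mf g -> {ae P, forall x, f x = g x} -> Ex f = Ex g.
Proof.
move=> mf0 mg fg; rewrite /mean /Rintegral; congr fine.
apply: ae_eq_integral => //; [exact/measurable_EFinP|exact/measurable_EFinP|].
by apply: filterS fg => x + _ /= => ->.
Qed.
Lemma integ_aeq f g : mf f -> {ae P, forall x, f x = g x} -> integ g -> integ f.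
Proof.
move=> mf0 fg gi; apply/integrableP; split; first exact/measurable_EFinP.
have /integrableP[mg] := gi; apply: le_lt_trans.
have mfE : measurable_fun setT (EFin \o f) by exact/measurable_EFinP.
have -> // : (\int[P]_x `|(EFin \o f) x| = \int[P]_x `|(EFin \o g) x|)%E.
apply: ae_eq_integral => //.
- exact: measurableT_comp.
- exact: measurableT_comp.
by apply: filterS fg => x + _ /= => ->.
Qed.

Lemma L2_mf f : L2 f -> mf f. Proof. by case. Qed.
Lemma L2_mul f g : L2 f -> L2 g -> integ (fun x => f x * g x).
Proof.
move=> [mf0 fi] [mg gi].
apply: (integ_le (h := fun x => f x ^+ 2 + g x ^+ 2)).
- exact: mfM.
- by move=> x; rewrite normrM -[f x ^+ 2]real_normK ?num_real//
    -[g x ^+ 2]real_normK ?num_real//; nra.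
- exact: integD.
Qed.
Lemma L2_cst (c : R) : L2 (fun=> c).
Proof. by split; [exact: mf_cst|exact: integ_cst]. Qed.
Lemma L2Z (c : R) f : L2 f -> L2 (fun x => c * f x).
Proof.
move=> [mf0 fi]; split; first by apply: mfM => //; exact: mf_cst.
by under eq_fun do rewrite exprMn; exact: integZ.
Qed.
Lemma L2D f g : L2 f -> L2 g -> L2 (fun x => f x + g x).
Proof.
move=> fL gL; split; first by apply: mfD; exact: L2_mf.
under eq_fun do rewrite sqrrD mulr2n.
apply: integD; last exact: gL.2.
by apply: integD; [exact: fL.2|]; apply: integD; exact: L2_mul.
Qed.
Lemma L2B f g : L2 f -> L2 g -> L2 (fun x => f x - g x).
Proof.
move=> fL gL; under eq_fun do rewrite -[X in _ + X]mulN1r.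
by apply: L2D => //; exact: L2Z.
Qed.
Lemma L2_sum (I : Type) (s : seq I) (p : pred I) (F : I -> Omega -> R) :
  (forall i, L2 (F i)) -> L2 (fun x => \sum_(i <- s | p i) F i x).
Proof.
move=> Fi; elim: s => [|i s IH].
  by under eq_fun do rewrite big_nil; exact: L2_cst.
under eq_fun do rewrite big_cons; case: (boolP (p i)) => // pi.
exact: L2D.
Qed.
Lemma L2_integ f : L2 f -> integ f.
Proof.
move=> fL; have := L2_mul fL (L2_cst 1).
by under eq_fun do rewrite mulr1.
Qed.
Lemma L2_le f g : mf f -> (forall x, `|f x| <= `|g x|) -> L2 g -> L2 f.
Proof.
move=> mf0 fg [mg gi]; split => //.
apply: (integ_le (h := fun x => g x ^+ 2)) => //; first exact: mfX.
by move=> x; rewrite ger0_norm ?sqr_ge0// -[f x ^+ 2]real_normK ?num_real//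
  -[g x ^+ 2]real_normK ?num_real// ler_sqr// nnegrE.
Qed.
Lemma L2_bdd f (M : R) : mf f -> (forall x, `|f x| <= M) -> L2 f.
Proof.
move=> mf0 fM; apply: (L2_le (g := fun=> M)) => //; last exact: L2_cst.
by move=> x; rewrite (le_trans (fM x))// ler_norm.
Qed.
Lemma integ_mul_bdd f g (M : R) : mf f -> (forall x, `|f x| <= M) -> integ g ->
  integ (fun x => f x * g x).
Proof.
move=> mf0 fM gi; apply: (integ_le (h := fun x => M * `|g x|)).
- by apply: mfM => //; exact: integ_mf.
- by move=> x; rewrite normrM ler_wpM2r.
- by apply: integZ; exact: integ_abs.
Qed.

End expectation.

Arguments integ_cst {disp Omega R P} c.
Arguments L2_cst {disp Omega R P} c.
Arguments integ_bdd {disp Omega R P f M}.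
Arguments L2_bdd {disp Omega R P f M}.

(** * Elementary inequalities *)

Section real_inequalities.
Context (R : realType).
Implicit Types (x y K M r th q : R).

Definition clip K x := Num.max (- K) (Num.min K x).
(** For [K >= 0], the signed distance from [x] to [[-K, K]]. Its square replaces x^2 restricted to
    |x| > K as a measure of uniform integrability: it is convex and has the continuous derivative
    [2 * excess K], so that its growth along a martingale can be computed. *)
Definition excess K x := x - clip K x.

Lemma clip_spec K x : 0 <= K ->
  [\/ clip K x = x /\ `|x| <= K, clip K x = K /\ K <= x
    | clip K x = - K /\ x <= - K].
Proof.
move=> K0; rewrite /clip minElt maxElt.
case: (ltP K x) => Kx.
  by case: (ltP (- K) K) => NK; constructor 2; split; lra.
case: (ltP (- K) x) => Nx; last by constructor 3; split.
by constructor 1; rewrite ler_norml Kx (ltW Nx).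
Qed.

Lemma continuous_clip K : continuous (clip K).
Proof.
move=> x; apply: (@continuous_max _ _ (fun=> - K) (Num.min K) x).
  exact: cvg_cst.
apply: (@continuous_min _ _ (fun=> K) id x); first exact: cvg_cst.
exact: cvg_id.
Qed.

Lemma continuous_excess K : continuous (excess K).
Proof. by move=> x; apply: cvgB; [exact: cvg_id|exact: continuous_clip]. Qed.

Lemma abs_clip K x : 0 <= K -> `|clip K x| <= K.
Proof.
move=> K0; case: (clip_spec x K0) => -[->]// _.
  by rewrite ger0_norm.
by rewrite normrN ger0_norm.
Qed.

Lemma abs_excess K x : 0 <= K -> `|excess K x| <= `|x|.
Proof.
move=> K0; rewrite /excess.
by rewrite ler_norml; case: (clip_spec x K0) => -[-> +]; case: (ger0P x); lra.
Qed.

Lemma excessN K x : 0 <= K -> excess K (- x) = - excess K x.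
Proof.
move=> K0; rewrite /excess.
case: (clip_spec x K0) => -[-> ]; case: (clip_spec (- x) K0) => -[-> ];
  rewrite ?ler_norml; lra.
Qed.

Lemma excess_sqrN K x : 0 <= K -> excess K (- x) ^+ 2 = excess K x ^+ 2.
Proof. by move=> K0; rewrite excessN// sqrrN. Qed.

Lemma excess_eq0 K x : `|x| <= K -> excess K x = 0.
Proof.
move=> xK; have K0 : 0 <= K by rewrite (le_trans _ xK).
move: xK; rewrite /excess ler_norml; case: (clip_spec x K0) => -[-> ]; lra.
Qed.

Lemma excess_sqr_le K x : 0 <= K -> excess K x ^+ 2 <= x ^+ 2.
Proof.
move=> K0; rewrite -[excess K x ^+ 2]real_normK ?num_real//.
by rewrite -[x ^+ 2]real_normK ?num_real// ler_sqr ?nnegrE// abs_excess.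
Qed.

Lemma excessM K r x : 0 <= K -> 0 <= r ->
  excess (r * K) (r * x) = r * excess K x.
Proof.
move=> K0 r0; have rK0 : 0 <= r * K by rewrite mulr_ge0.
rewrite /excess; case: (clip_spec x K0) => -[-> ];
 case: (clip_spec (r * x) rK0) => -[-> ]; rewrite ?ler_norml; nra.
Qed.

(** The point [clip K x] lies in [[-K, K]], so its distance to [x + y] bounds the distance from
    [x + y] to the interval. *)
Lemma excess_addl K x y : 0 <= K ->
  excess K (x + y) ^+ 2 <= (excess K x + y) ^+ 2.
Proof.
move=> K0; rewrite /excess.
case: (clip_spec x K0) => -[-> ]; case: (clip_spec (x + y) K0) => -[-> ];
  rewrite ?ler_norml; nra.
Qed.

(** From (a + b)^2 <= 2 a^2 + 2 b^2 with x = excess + clip. This is how truncation enters the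
    estimates below. *)
Lemma sqr_le_excess K x : 0 <= K -> x ^+ 2 <= 2 * excess K x ^+ 2 + 2 * K ^+ 2.
Proof.
move=> K0; rewrite {1}(_ : x = excess K x + clip K x); last by rewrite /excess; lra.
have : clip K x ^+ 2 <= K ^+ 2.
  by rewrite -[clip K x ^+ 2]real_normK ?num_real// ler_sqr ?nnegrE// abs_clip.
by have := sqr_ge0 (excess K x - clip K x); lra.
Qed.

(* The distance to [[-K, K]] is squared: its second-order increment vanishes
   as long as the path stays inside. *)
Lemma excess_increment K M x y : 0 < K -> 0 <= M ->
  excess K (x + y) ^+ 2 <= excess K x ^+ 2 + 2 * (excess K x * y)
    + (2 * excess M y ^+ 2
       + 2 * M ^+ 2 / K ^+ 2 * (x ^+ 2 + (x + y) ^+ 2)).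
Proof.
move=> K0 M0; have yM := sqr_le_excess y M0.
have xyK := excess_addl x y (ltW K0).
have [/andP[xK xyKl]|] := boolP ((`|x| <= K) && (`|x + y| <= K)).
  rewrite (excess_eq0 xK) (excess_eq0 xyKl) expr0n/= mul0r mulr0 !add0r.
  apply: addr_ge0; first by rewrite mulr_ge0 ?sqr_ge0.
  apply: mulr_ge0; last by rewrite addr_ge0 ?sqr_ge0.
  by rewrite divr_ge0 ?sqr_ge0// mulr_ge0 ?sqr_ge0.
rewrite negb_and -!ltNge => xKP.
(* As soon as one end of the step leaves the interval this quotient is at least 1, and it pays for
   the part of y^2 below the level [M]. *)
have : 1 <= (x ^+ 2 + (x + y) ^+ 2) / K ^+ 2.
  rewrite ler_pdivlMr ?exprn_gt0// mul1r.
  have sq z : K < `|z| -> K ^+ 2 <= z ^+ 2.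
    by move=> Kz; rewrite -[z ^+ 2]real_normK ?num_real// ler_sqr ?nnegrE// ltW.
  by case/orP: xKP => /sq h; [have := sqr_ge0 (x + y)|have := sqr_ge0 x]; lra.
set q := (x ^+ 2 + _) / _ => q1.
rewrite (_ : 2 * M ^+ 2 / K ^+ 2 * _ = 2 * M ^+ 2 * q); last by rewrite /q; ring.
have : M ^+ 2 <= M ^+ 2 * q by rewrite ler_peMr ?sqr_ge0.
move: xyK; rewrite sqrrD; lra.
Qed.

(** The Lindeberg factor: [x ^+ 2 * unit_cut x] is the minimum of x^2 and |x|^3, the two bounds of a
    second-order Taylor remainder. *)
Definition unit_cut x := Num.min 1 `|x|.

Lemma unit_cut_ge0 x : 0 <= unit_cut x. Proof. by rewrite /unit_cut le_min ler01 normr_ge0. Qed.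
Lemma unit_cut_le1 x : unit_cut x <= 1. Proof. by rewrite /unit_cut ge_min lexx. Qed.
Lemma unit_cut_le x : unit_cut x <= `|x|. Proof. by rewrite /unit_cut ge_min lexx orbT. Qed.
Lemma abs_sin_le x : `|sin x| <= `|x|.
Proof.
wlog x0 : x / 0 <= x.
  move=> H; have [/H//|x0] := leP 0 x.
  by rewrite -(normrN x) -(normrN (sin x)) -sinN H// oppr_ge0 ltW.
have [|c _] := @MVT_segment R sin cos 0 x x0 (fun y _ => is_derive_sin y).
  by apply: continuous_subspaceT => y; exact: continuous_sin.
rewrite sin0 !subr0 => ->; rewrite normrM ler_piMl// cos_max//.
Qed.

Lemma cos_ge_parabola x : 1 - x ^+ 2 / 2 <= cos x.
Proof.
rewrite [in leRHS](_ : x = (x / 2) *+ 2); last by rewrite mulr2n; field.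
rewrite cos_mulr2n cos2sin2.
have := abs_sin_le (x / 2); rewrite -ler_sqr ?nnegrE//.
rewrite !real_normK ?num_real//.
rewrite (_ : (x / 2) ^+ 2 = x ^+ 2 / 4); last by field.
by lra.
Qed.

Lemma x_sub_sin x : 0 <= x -> 0 <= x - sin x <= x ^+ 3 / 2.
Proof.
move=> x0.
have [|c] := @MVT_segment R (fun y => y - sin y) (fun y => 1 - cos y) 0 x x0
  (fun y _ => is_deriveB (is_derive_id y 1) (is_derive_sin y)).
  apply: continuous_subspaceT => y; apply: cvgB; first exact: cvg_id.
  exact: continuous_sin.
rewrite in_itv/= => /andP[c0 cx]; rewrite sin0 !subr0 => ->.
have := cos_ge_parabola c; have := cos_le1 c => h1 h2.
apply/andP; split; first by rewrite mulr_ge0// subr_ge0.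
rewrite (_ : x ^+ 3 / 2 = x ^+ 2 / 2 * x); last by ring.
rewrite ler_wpM2r//; have : c ^+ 2 <= x ^+ 2 by rewrite ler_sqr ?nnegrE.
by lra.
Qed.

Lemma cos_taylor2 x : 0 <= cos x - 1 + x ^+ 2 / 2 <= x ^+ 2 * unit_cut x.
Proof.
wlog x0 : x / 0 <= x.
  move=> H; have [/H//|x0] := leP 0 x.
  have := H (- x); rewrite /unit_cut cosN sqrrN normrN; apply.
  by rewrite oppr_ge0 ltW.
have h0 := cos_ge_parabola x; apply/andP; split; first lra.
rewrite /unit_cut ger0_norm// minElt; case: ifPn => [x1|].
  by have := cos_le1 x; have := sqr_ge0 x; lra.
rewrite -leNgt => x1.
have d (y : R) : is_derive y 1 (fun y => cos y - 1 + y ^+ 2 / 2) (y - sin y).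
  apply: is_derive_eq; rewrite /GRing.scale/=; lra.
have [|c] := @MVT_segment R (fun y => cos y - 1 + y ^+ 2 / 2) (fun y => y - sin y)
   0 x x0 (fun y _ => d y).
  apply: continuous_subspaceT => y.
  exact/differentiable_continuous/derivable1_diffP/(@ex_derive _ _ _ _ _ _ _ (d y)).
rewrite in_itv/= => /andP[c0 cx].
rewrite cos0 expr0n/= mul0r subrr !addr0 !subr0 => ->.
have /andP[_ h1] := x_sub_sin c0.
apply: (@le_trans _ _ (x ^+ 3 / 2 * x)).
  rewrite ler_wpM2r// (le_trans h1)// ler_wpM2r//.
  by rewrite lerXn2r ?nnegrE.
rewrite (_ : x ^+ 3 / 2 * x = x ^+ 2 * (x ^+ 2 / 2)); last ring.
by rewrite ler_wpM2l ?sqr_ge0//; nra.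
Qed.

Lemma abs_sub_sin x : `|x - sin x| <= 2 * (x ^+ 2 * unit_cut x).
Proof.
wlog x0 : x / 0 <= x.
  move=> H; have [/H//|x0] := leP 0 x.
  have <- : `|- x - sin (- x)| = `|x - sin x|.
    by rewrite sinN -normrN; congr (`|_|); lra.
  have := H (- x); rewrite /unit_cut sqrrN normrN; apply.
  by rewrite oppr_ge0 ltW.
have /andP[h1 h2] := x_sub_sin x0; rewrite (ger0_norm h1).
rewrite /unit_cut ger0_norm// minElt; case: ifPn => [x1|].
  by have := sin_geN1 x; nra.
rewrite -leNgt => x1; rewrite (le_trans h2)//.
rewrite (_ : x ^+ 2 * x = x ^+ 3); last ring.
have : 0 <= x ^+ 3 by rewrite exprn_ge0.
lra.
Qed.

Lemma expRN_taylor1 x : 0 <= x -> 0 <= expR (- x) - 1 + x <= x * unit_cut x.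
Proof.
move=> x0; have h := expR_ge1Dx (- x); apply/andP; split; first lra.
rewrite /unit_cut ger0_norm// minElt; case: ifPn => [x1|].
  have : expR (- x) <= 1 by rewrite expR_le1 oppr_le0.
  lra.
rewrite -leNgt => x1.
have : expR (- x) <= (1 + x)^-1.
  by rewrite expRN lef_pV2 ?posrE ?expR_gt0 ?expR_ge1Dx//; lra.
move=> /le_trans le; have : (1 + x)^-1 <= 1 - x + x * x.
  rewrite -[leLHS]mul1r ler_pdivrMr; last lra.
  have : 0 <= x ^+ 3 by rewrite exprn_ge0.
  lra.
by move=> /le; lra.
Qed.

(** Both functions agree with 1 - x^2 / 2 up to a Lindeberg remainder. It replaces one factor of the
    characteristic function of a Rademacher sum by a Gaussian one. *)
Lemma cos_expR x : `|cos x - expR (- (x ^+ 2 / 2))| <= 2 * (x ^+ 2 * unit_cut x).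
Proof.
have /andP[h1 h2] := cos_taylor2 x.
have y0 : 0 <= x ^+ 2 / 2 by rewrite divr_ge0 ?sqr_ge0.
have /andP[h3 h4] := expRN_taylor1 y0.
have : x ^+ 2 / 2 * unit_cut (x ^+ 2 / 2) <= x ^+ 2 * unit_cut x.
  apply: (@le_trans _ _ (x ^+ 2 * unit_cut (x ^+ 2 / 2))).
    by have := unit_cut_ge0 (x ^+ 2 / 2); nra.
  rewrite ler_wpM2l ?sqr_ge0// /unit_cut (ger0_norm y0) -[x ^+ 2]real_normK ?num_real//.
  rewrite le_min ge_min lexx/= ge_min.
  by have [|] := leP 1 `|x|; rewrite ?orbT//; have := normr_ge0 x; nra.
by rewrite ler_norml; lra.
Qed.

(** By the addition formula the remainder is [cos (q + th)] times that of the cosine plus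
    [sin (q + th)] times that of the sine. *)
Lemma cos_shift_taylor2 th q x :
  `|cos (q + x + th) - cos (q + th) + sin (q + th) * x
    + cos (q + th) * (x ^+ 2 / 2)| <= 3 * (x ^+ 2 * unit_cut x).
Proof.
rewrite -(addrA q x) (addrC x th) (addrA q th).
set a := q + th; rewrite cosD.
have -> : cos a * cos x - sin a * sin x - cos a + sin a * x
  + cos a * (x ^+ 2 / 2) = cos a * (cos x - 1 + x ^+ 2 / 2) + sin a * (x - sin x).
  by ring.
apply: (le_trans (ler_normD _ _)); rewrite !normrM.
have /andP[h1 h2] := cos_taylor2 x; have h3 := abs_sub_sin x.
have := cos_max a; have := sin_max a => h4 h5.
have l1 : `|cos a| * `|cos x - 1 + x ^+ 2 / 2| <= x ^+ 2 * unit_cut x.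
  by rewrite -[leRHS]mul1r ler_pM// ger0_norm.
have l2 : `|sin a| * `|x - sin x| <= 2 * (x ^+ 2 * unit_cut x).
  by rewrite -[leRHS]mul1r ler_pM.
lra.
Qed.

Lemma cos_lipschitz x y : `|cos x - cos y| <= `|x - y|.
Proof.
wlog xy : x y / y <= x.
  move=> H; have [/H//|yx] := leP y x.
  by rewrite distrC (distrC x) H// ltW.
have [|c _ ->] := @MVT_segment R cos (fun z => - sin z) y x xy
  (fun z _ => is_derive_cos z).
  by apply: continuous_subspaceT => z; exact: continuous_cos.
by rewrite normrM normrN ler_piMl// sin_max.
Qed.

Lemma expRN_lipschitz x y : 0 <= x -> 0 <= y ->
  `|expR (- x) - expR (- y)| <= `|x - y|.
Proof.
wlog xy : x y / y <= x.
  move=> H x0 y0; have [/H h|yx] := leP y x; first exact: h.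
  by rewrite distrC (distrC x) H// ltW.
move=> x0 y0; have xy' : expR (- x) <= expR (- y) by rewrite ler_expR lerN2.
rewrite distrC ger0_norm ?subr_ge0// ger0_norm ?subr_ge0//.
have : expR (- y) <= 1 by rewrite expR_le1 oppr_le0.
have -> : expR (- x) = expR (- y) * expR (- (x - y)).
  by rewrite -expRD; congr expR; lra.
by have := expR_ge1Dx (- (x - y)); have := expR_ge0 (- y); nra.
Qed.

(** Plays the role of the Cauchy-Schwarz inequality: a first moment is bounded through a second
    moment, without square roots, at the price of a free parameter. *)
Lemma le_delta_sqr (de x : R) : 0 < de -> `|x| <= de + x ^+ 2 / de.
Proof.
move=> de0; rewrite -[x ^+ 2]real_normK ?num_real//.
have [xd|dx] := leP `|x| de.
  by rewrite (le_trans xd)// lerDl divr_ge0 ?sqr_ge0 ?ltW.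
apply: (@le_trans _ _ (`|x| ^+ 2 / de)); last by rewrite lerDr ltW.
by rewrite ler_pdivlMr//; have := normr_ge0 x; nra.
Qed.

End real_inequalities.

(** * Martingale differences *)

Section martingale_difference_arrays.
Context (disp : measure_display) (Omega : measurableType disp) (R : realType).
Variable P : probability Omega R.
Local Notation Ex := (mean P).
Local Notation L2 := (L2 P).
Local Notation integ := (integ P).

(* [A k] plays the role of the set of functions that are measurable, up to a
   null set, with respect to the [k]-th sigma-algebra of a filtration. *)
Record filtration (A : nat -> (Omega -> R) -> Prop) : Prop := {
  filtration_mf : forall k g, A k g -> mf g;
  filtration_cst : forall k c, A k (fun=> c);
  filtrationD : forall k g h, A k g -> A k h -> A k (fun x => g x + h x);
  filtrationM : forall k g h, A k g -> A k h -> A k (fun x => g x * h x);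
  filtration_comp : forall k g (u : R -> R), continuous u -> A k g ->
    A k (fun x => u (g x));
  filtrationS : forall k g, A k g -> A k.+1 g }.

(** The martingale property is expressed as orthogonality to the square integrable functions of the
    past, so that no conditional expectation has to be formed. The past of [X a] is [A a]. *)
Record mds (A : nat -> (Omega -> R) -> Prop) (X : nat -> Omega -> R) : Prop := {
  mds_filtration : filtration A;
  mds_L2 : forall a, L2 (X a);
  mds_adapted : forall a, A a.+1 (X a);
  mds_orth : forall a G, A a G -> L2 G -> Ex (fun x => G x * X a x) = 0 }.

Section filtration_theory.
Variables (A : nat -> (Omega -> R) -> Prop).
Hypothesis FA : filtration A.

Lemma filtrationZ k c g : A k g -> A k (fun x => c * g x).
Proof. by move=> Ag; apply: (filtrationM FA) => //; exact: filtration_cst. Qed.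

Lemma filtrationX k g n : A k g -> A k (fun x => g x ^+ n).
Proof.
move=> Ag; apply: (filtration_comp FA (u := fun y => y ^+ n)) => //.
exact: exprn_continuous.
Qed.

Lemma filtration_le k l g : (k <= l)%N -> A k g -> A l g.
Proof.
elim: l => [|l IH]; first by rewrite leqn0 => /eqP ->.
by rewrite leq_eqVlt => /orP[/eqP ->//|/IH H /H]; exact: filtrationS.
Qed.

Lemma filtration_sum_ord k n (F : nat -> Omega -> R) :
  (forall i, (i < n)%N -> A k (F i)) -> A k (fun x => \sum_(i < n) F i x).
Proof.
elim: n => [|n IH] AF.
  by under eq_fun do rewrite big_ord0; exact: filtration_cst.
under eq_fun do rewrite big_ord_recr/=.
by apply: filtrationD => //; [apply: IH => i i_n; apply: AF; exact: ltnW|exact: AF].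
Qed.

Lemma filtration_shift l : filtration (fun k => A (l + k)%N).
Proof.
split; move=> k *.
- exact: (filtration_mf FA (k := l + k)).
- exact: (filtration_cst FA).
- exact: (filtrationD FA).
- exact: (filtrationM FA).
- exact: (filtration_comp FA).
- by rewrite addnS; exact: (filtrationS FA).
Qed.

End filtration_theory.

Section mds_theory.
Variables (A : nat -> (Omega -> R) -> Prop) (X : nat -> Omega -> R).
Hypothesis XA : mds A X.
Let FA := mds_filtration XA.
Let XL := mds_L2 XA.

Lemma mds_shift l : mds (fun k => A (l + k)%N) (fun a => X (l + a)%N).
Proof.
split; first exact: filtration_shift.
- by move=> a; exact: XL.
- by move=> a; rewrite addnS; exact: (mds_adapted XA).
- by move=> a G; exact: (mds_orth XA).
Qed.

Lemma mds_sum_adapted (w : nat -> R) n :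
  A n (fun x => \sum_(a < n) w a * X a x).
Proof.
apply: (filtration_sum_ord FA (F := fun a x => w a * X a x)) => i i_n.
by apply: filtrationZ => //; apply: (filtration_le FA i_n); exact: (mds_adapted XA).
Qed.

Lemma mds_sum_L2 (w : nat -> R) n : L2 (fun x => \sum_(a < n) w a * X a x).
Proof. by apply: L2_sum => a; exact: L2Z. Qed.

(** Orthogonality of the increments. The weights serve twice: as signs, and as the difference
    between two normalizations of a sum. *)
Lemma Ex_sqr_sum (w : nat -> R) n :
  Ex (fun x => (\sum_(a < n) w a * X a x) ^+ 2) =
  \sum_(a < n) w a ^+ 2 * Ex (fun x => X a x ^+ 2).
Proof.
elim: n => [|n IH].
  by under eq_Ex do rewrite big_ord0 expr0n/=; rewrite big_ord0 Ex_cst.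
rewrite big_ord_recr/= -IH.
under eq_Ex do rewrite big_ord_recr/= sqrrD exprMn -mulrnAr -mulrA.
have SL := mds_sum_L2 w n; have wXL := L2Z (w n) (XL n).
have i1 := L2_mul SL (XL n).
rewrite (eq_Ex _ (g := fun x => ((\sum_(a < n) w a * X a x) ^+ 2
   + (2 * w n) * ((\sum_(a < n) w a * X a x) * X n x)) + w n ^+ 2 * X n x ^+ 2));
  last by move=> x; rewrite -mulr_natl; ring.
rewrite ExD; [|by apply: integD; [exact: SL.2|exact: integZ]
              |by apply: integZ; exact: (XL n).2].
rewrite ExD; [|exact: SL.2|exact: integZ].
rewrite !ExZ//; last exact: (XL n).2.
by rewrite (mds_orth XA (mds_sum_adapted w n) SL) mulr0 addr0.
Qed.

Lemma Ex_sqr_sum_le (w : nat -> R) (s2 : R) n :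
  (forall a, Ex (fun x => X a x ^+ 2) <= s2) ->
  Ex (fun x => (\sum_(a < n) w a * X a x) ^+ 2) <= s2 * \sum_(a < n) w a ^+ 2.
Proof.
move=> Xs; rewrite Ex_sqr_sum mulr_sumr; apply: ler_sum => a _.
by rewrite mulrC ler_wpM2r ?sqr_ge0.
Qed.

(* If the squares of the differences are uniformly integrable, so are those of
   the normalized sums. *)
Lemma excess_sum_le (w : nat -> R) (s2 K M eta : R) n : (0 < n)%N ->
  (forall a, w a ^+ 2 = 1) -> 0 < K -> 0 <= M ->
  (forall a, Ex (fun x => X a x ^+ 2) <= s2) ->
  (forall a, Ex (fun x => excess M (X a x) ^+ 2) <= eta) ->
  Ex (fun x => excess K ((Num.sqrt n%:R)^-1 * \sum_(a < n) w a * X a x) ^+ 2)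
    <= 2 * eta + 4 * M ^+ 2 * s2 / K ^+ 2.
Proof.
move=> n0 w1 K0 M0 Xs Xeta; set r := (Num.sqrt n%:R)^-1.
have nR : 0 < n%:R :> R by rewrite ltr0n.
have r0 : 0 <= r by rewrite invr_ge0 sqrtr_ge0.
have r2 : r ^+ 2 = n%:R^-1 by rewrite exprVn sqr_sqrtr// ltW.
pose S k x := r * \sum_(a < k) w a * X a x.
have SL k : L2 (S k) by apply: L2Z; exact: mds_sum_L2.
have SA k : A k (S k) by apply: filtrationZ => //; exact: mds_sum_adapted.
have eL K' f : 0 <= K' -> L2 f -> L2 (fun x => excess K' (f x)).
  move=> K'0 fL; apply: (L2_le _ _ fL).
    by apply: mf_comp; [exact: continuous_excess|exact: L2_mf fL].
  by move=> x; exact: abs_excess.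
have S2 k : (k <= n)%N -> Ex (fun x => S k x ^+ 2) <= s2.
  move=> kn; under eq_Ex do rewrite exprMn.
  rewrite ExZ; last exact: (mds_sum_L2 w k).2.
  rewrite r2 ler_pdivrMl// (le_trans (Ex_sqr_sum_le w k Xs))// mulrC.
  have s20 : 0 <= s2 by apply: le_trans (Xs 0%N); apply: Ex_ge0 => x; exact: sqr_ge0.
  rewrite ler_wpM2r// (eq_bigr (fun=> 1)); last by move=> i _; exact: w1.
  by rewrite sumr_const card_ord ler_nat.
(* Since r^2 = 1 / n, each new variable may add an n-th of the bound. *)
suff H k : (k <= n)%N -> Ex (fun x => excess K (S k x) ^+ 2)
    <= k%:R * (r ^+ 2 * (2 * eta + 4 * M ^+ 2 * s2 / K ^+ 2)).
  apply: (le_trans (H n (leqnn n))).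
  by rewrite r2 mulrA divff ?mul1r// gt_eqF.
elim: k => [_|k IH kn].
  rewrite mul0r (eq_Ex _ (g := fun=> 0)) ?Ex_cst// => x.
  by rewrite /S big_ord0 mulr0 excess_eq0 ?normr0 ?expr0n// ltW.
have -> : k.+1%:R = k%:R + 1 :> R by rewrite -natr1.
rewrite mulrDl mul1r; have {}IH := IH (ltnW kn).
pose y x := r * (w k * X k x).
have Sy x : S k.+1 x = S k x + y x by rewrite /S big_ord_recr/= mulrDr.
pose c := 2 * (r * M) ^+ 2 / K ^+ 2.
have yL : L2 y by do 2 apply: L2Z.
have rM0 : 0 <= r * M by rewrite mulr_ge0.
apply: (@le_trans _ _ (Ex (fun x => (excess K (S k x) ^+ 2 +
    (2 * r * w k) * (excess K (S k x) * X k x))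
    + (2 * r ^+ 2 * excess M (X k x) ^+ 2
        + c * (S k x ^+ 2 + S k.+1 x ^+ 2))))).
  apply: le_Ex.
  - exact: (eL _ _ (ltW K0) (SL _)).2.
  - apply: integD; apply: integD.
    + exact: (eL _ _ (ltW K0) (SL _)).2.
    + by apply: integZ; apply: L2_mul => //; apply: eL => //; exact: ltW.
    + by apply: integZ; exact: (eL _ _ M0 (XL k)).2.
    + by apply: integZ; apply: integD; exact: (SL _).2.
  - move=> x; rewrite Sy (le_trans (excess_increment _ _ K0 rM0))// -Sy.
    rewrite le_eqVlt; apply/orP; left; apply/eqP.
    have -> : excess (r * M) (y x) ^+ 2 = r ^+ 2 * excess M (X k x) ^+ 2.
      rewrite /y excessM// exprMn; congr (_ * _).
      have /eqP := w1 k; rewrite sqrf_eq1 => /orP[]/eqP ->.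
        by rewrite mul1r.
      by rewrite mulN1r excess_sqrN.
    rewrite /y /c; ring.
have e1 := (eL _ _ (ltW K0) (SL k)).
have i1 := L2_mul e1 (XL k).
have e2 := eL _ _ M0 (XL k).
rewrite ExD; first last.
- apply: integD; first by apply: integZ; exact: e2.2.
  by apply: integZ; apply: integD; exact: (SL _).2.
- by apply: integD; [exact: e1.2|exact: integZ].
rewrite ExD; [|exact: e1.2|exact: integZ].
rewrite ExD; [|by apply: integZ; exact: e2.2
             |by apply: integZ; apply: integD; exact: (SL _).2].
rewrite !ExZ//; [|by apply: integD; exact: (SL _).2|exact: e2.2].
rewrite ExD; [|exact: (SL _).2|exact: (SL _).2].
(* The linear term of the increment has mean zero: [excess K (S k)] belongs to the past of [X k]. *)
rewrite (mds_orth XA _ e1); last first.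
  by apply: (filtration_comp FA) => //; exact: continuous_excess.
rewrite mulr0 addr0; apply: lerD => //.
rewrite [leRHS]mulrDr; apply: lerD.
  rewrite (mulrCA (r ^+ 2)) mulrA; apply: ler_wpM2l; last exact: Xeta.
  by rewrite mulr_ge0 ?sqr_ge0.
rewrite (_ : r ^+ 2 * _ = c * (s2 + s2)); last by rewrite /c; ring.
rewrite ler_wpM2l//; first by rewrite /c divr_ge0 ?sqr_ge0// mulr_ge0 ?sqr_ge0.
by rewrite lerD// S2// ltnW.
Qed.

End mds_theory.
End martingale_difference_arrays.

(** * Comparison of the cosine with the bracket over one block *)

Section block_comparison.
Context (disp : measure_display) (Omega : measurableType disp) (R : realType).
Variable P : probability Omega R.
Local Notation Ex := (mean P).
Local Notation L2 := (L2 P).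
Local Notation integ := (integ P).

Lemma continuous_cos_shift (th : R) : continuous (fun y => cos (y + th)).
Proof.
move=> y; apply: (@continuous_comp _ _ _ (fun y => y + th) cos).
  by apply: cvgD; [exact: cvg_id|exact: cvg_cst].
exact: continuous_cos.
Qed.

Lemma continuous_sin_shift (th : R) : continuous (fun y => sin (y + th)).
Proof.
move=> y; apply: (@continuous_comp _ _ _ (fun y => y + th) sin).
  by apply: cvgD; [exact: cvg_id|exact: cvg_cst].
exact: continuous_sin.
Qed.

(** Lindeberg's splitting of y^2: the part above [K] keeps a factor at most 1, the bounded part gets
    [unit_cut (r * y)], at most r |y| <= r (1 + y^2), which is small with [r]. *)
Lemma sqr_unit_cut_le (K r y : R) : 0 <= K -> 0 <= r ->
  (r * y) ^+ 2 * unit_cut (r * y) <=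
  r ^+ 2 * (2 * excess K y ^+ 2 + 2 * K ^+ 2 * r * (1 + y ^+ 2)).
Proof.
move=> K0 r0; rewrite exprMn -[leLHS]mulrA; apply: ler_wpM2l; first exact: sqr_ge0.
have c0 := unit_cut_ge0 (r * y); have c1 := unit_cut_le1 (r * y).
have c2 : unit_cut (r * y) <= r * (1 + y ^+ 2).
  rewrite (le_trans (unit_cut_le _))// normrM ger0_norm// ler_wpM2l//.
  by rewrite -[y ^+ 2]real_normK ?num_real//; have := normr_ge0 y; nra.
apply: (@le_trans _ _ ((2 * excess K y ^+ 2 + 2 * K ^+ 2) * unit_cut (r * y))).
  by rewrite ler_wpM2r// sqr_le_excess.
rewrite mulrDl lerD//.
  by rewrite ler_piMr// mulr_ge0// sqr_ge0.
by rewrite -[leRHS]mulrA ler_wpM2l// mulr_ge0// sqr_ge0.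
Qed.

Section block.
Variables (A : nat -> (Omega -> R) -> Prop) (X : nat -> Omega -> R).
Hypothesis XA : mds P A X.
Let FA := mds_filtration XA.
Let XL := mds_L2 XA.
Variables (s2 K eta : R).
Hypothesis K0 : 0 <= K.
Hypothesis Xs : forall a, Ex (fun x => X a x ^+ 2) <= s2.
Hypothesis Xe : forall a, Ex (fun x => excess K (X a x) ^+ 2) <= eta.
Variables (r th de : R) (Q0 e : Omega -> R).
Hypothesis r0 : 0 <= r.
Hypothesis de0 : 0 < de.
Hypothesis AQ0 : A 0 Q0.
Hypothesis Ae : A 0 e.
Hypothesis e01 : forall x, 0 <= e x <= 1.

Let Q l x := Q0 x + r * \sum_(a < l) X a x.
(** The error of one step of a block of length [m], divided by r^2. The Taylor remainder, three
    times [sqr_unit_cut_le], gives 6 [eta] and the second term; freezing the phase at the start of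
    the block gives the other 2 [eta] and the last term, where [de] comes from [le_delta_sqr]. *)
Definition block_err (m : nat) : R :=
  8 * eta + 6 * K ^+ 2 * r * (1 + s2) + K ^+ 2 * (de + r ^+ 2 * m%:R * s2 / de).

Let Xsum_E l x : \sum_(a < l) X a x = \sum_(a < l) 1 * X a x.
Proof. by apply: eq_bigr => a _; rewrite mul1r. Qed.

Let sumL2 l : L2 (fun x => \sum_(a < l) X a x).
Proof. by under eq_fun do rewrite Xsum_E; exact: (mds_sum_L2 XA (fun=> 1)). Qed.

Let AQ l : A l (Q l).
Proof.
apply: (filtrationD FA); first exact: (filtration_le FA (leq0n l)).
apply: filtrationZ => //; under eq_fun do rewrite Xsum_E.
exact: (mds_sum_adapted XA (fun=> 1)).
Qed.

Let mQ l : mf (Q l). Proof. exact: filtration_mf FA _ _ (AQ l). Qed.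
Let me : mf e. Proof. exact: filtration_mf FA _ _ Ae. Qed.
Let mQ0 : mf Q0. Proof. exact: filtration_mf FA _ _ AQ0. Qed.
Let mcos (f : Omega -> R) : mf f -> mf (fun x => cos (f x + th)).
Proof. exact: (mf_comp (u := fun y => cos (y + th)) (@continuous_cos_shift th)). Qed.
Let ne x : `|e x| <= 1.
Proof. by have /andP[e0 e1] := e01 x; rewrite ger0_norm. Qed.
Let eXL a : L2 (fun x => excess K (X a x)).
Proof.
apply: (L2_le _ _ (XL a)) => [|x]; last exact: abs_excess.
by apply: mf_comp; [exact: continuous_excess|exact: L2_mf (XL a)].
Qed.
Let s20 : 0 <= s2.
Proof. by apply: le_trans (Xs 0%N); apply: Ex_ge0 => x; exact: sqr_ge0. Qed.

Let term l x := cos (Q l.+1 x + th) - cos (Q l x + th)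
  + cos (Q0 x + th) * (r ^+ 2 / 2 * X l x ^+ 2).

Let integ_term l : integ (term l).
Proof.
apply: integD.
  apply: (integ_bdd (M := 2)); first by apply: mfB; exact: mcos.
  move=> x; rewrite (le_trans (ler_normB _ _))//.
  by rewrite (_ : 2 = 1 + 1)// lerD// cos_max.
apply: (integ_mul_bdd (M := 1)); first exact: mcos.
  by move=> x; exact: cos_max.
by apply: integZ; exact: (XL l).2.
Qed.

Let h l x := r ^+ 2 * (8 * excess K (X l x) ^+ 2
  + 6 * K ^+ 2 * r * (1 + X l x ^+ 2)
  + K ^+ 2 * (de + (r * \sum_(a < l) X a x) ^+ 2 / de)).

Let integ_h l : integ (h l).
Proof.
apply: integZ; apply: integD; first apply: integD.
- by apply: integZ; exact: (eXL l).2.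
- by apply: integZ; apply: integD; [exact: integ_cst|exact: (XL l).2].
- apply: integZ; apply: integD; first exact: integ_cst.
  under eq_fun do rewrite mulrC; apply: integZ.
  by have := L2Z r (sumL2 l); case.
Qed.

Let Ex_h l m : (l <= m)%N -> Ex (h l) <= r ^+ 2 * block_err m.
Proof.
move=> lm; have SL := L2Z r (sumL2 l).
have SL' : integ (fun x => (r * \sum_(a < l) X a x) ^+ 2 / de).
  by under eq_fun do rewrite mulrC; apply: integZ; exact: SL.2.
have iE := (eXL l).2; have iX := (XL l).2.
have itac1 : integ (fun x => de + (r * \sum_(a < l) X a x) ^+ 2 / de).
  exact: integD (integ_cst de) SL'.
have itac2 : integ (fun x => 1 + X l x ^+ 2) by exact: integD (integ_cst 1) iX.
have i8 := integZ 8 iE.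
have i6 := integZ (6 * K ^+ 2 * r) itac2.
have iK := integZ (K ^+ 2) itac1.
rewrite /h ExZ; last exact: integD (integD i8 i6) iK.
apply: ler_wpM2l; first exact: sqr_ge0.
rewrite ExD//; last exact: integD.
rewrite ExD// (ExZ 8 iE) (ExZ (6 * K ^+ 2 * r) itac2) (ExZ (K ^+ 2) itac1).
rewrite (ExD (integ_cst 1) iX) (ExD (integ_cst de) SL') !Ex_cst.
apply: lerD; first apply: lerD.
- by rewrite ler_wpM2l.
- apply: ler_wpM2l; last by rewrite lerD2l.
  by rewrite mulr_ge0// mulr_ge0// sqr_ge0.
apply: ler_wpM2l; first exact: sqr_ge0.
rewrite lerD2l.
rewrite (eq_Ex _ (g := fun x => r ^+ 2 / de * (\sum_(a < l) X a x) ^+ 2));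
  last by move=> x; ring.
rewrite ExZ; last exact: (sumL2 l).2.
rewrite (_ : r ^+ 2 * m%:R * s2 / de = r ^+ 2 / de * (m%:R * s2)); last ring.
apply: ler_wpM2l.
  by rewrite divr_ge0 ?sqr_ge0 ?ltW.
under eq_Ex do rewrite Xsum_E.
apply: (le_trans (Ex_sqr_sum_le XA (fun=> 1) l Xs)).
rewrite mulrC ler_wpM2r// expr1n sumr_const card_ord ler_nat//.
Qed.

Let term_le l m : (l < m)%N -> `|Ex (fun x => e x * term l x)|
  <= r ^+ 2 * block_err m.
Proof.
move=> lm; apply: le_trans (Ex_h (ltnW lm)).
pose g x := e x * sin (Q l x + th).
have Ag : A l g.
  apply: (filtrationM FA); first exact: (filtration_le FA (leq0n l)).
  exact: (filtration_comp FA (u := fun y => sin (y + th)) (@continuous_sin_shift th)).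
have mg := filtration_mf FA Ag.
have gb x : `|g x| <= 1 by rewrite normrM mulr_ile1// sin_max.
have gL : L2 g by exact: L2_bdd mg gb.
have ie : integ (fun x => e x * term l x).
  by apply: integ_mul_bdd => //.
have ig : integ (fun x => r * (g x * X l x)).
  by apply: integZ; exact: L2_mul.
(* The first-order Taylor term is orthogonal to the past, so it may be inserted at no cost. *)
have -> : Ex (fun x => e x * term l x) =
    Ex (fun x => e x * term l x + r * (g x * X l x)).
  by rewrite ExD// (ExZ r (L2_mul gL (XL l))) (mds_orth XA Ag gL) mulr0 addr0.
apply: (abs_Ex_le (integ_mf (integD ie ig)) (integ_h l)).
move=> x; rewrite (_ : _ + _ = e x * (term l x + sin (Q l x + th) * (r * X l x)));
  last by rewrite /g; ring.
rewrite normrM (le_trans (ler_piMl _ (ne x)))//.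
set y := r * X l x; have QS : Q l.+1 x = Q l x + y.
  by rewrite /Q big_ord_recr/= mulrDr addrA.
have := cos_shift_taylor2 th (Q l x) y; have := sqr_unit_cut_le (X l x) K0 r0.
rewrite -/y => cl ct.
have cosd : `|cos (Q0 x + th) - cos (Q l x + th)| <= `|r * \sum_(a < l) X a x|.
  rewrite (le_trans (cos_lipschitz _ _))// -[leRHS]normrN.
  by rewrite (_ : _ - _ = - (r * \sum_(a < l) X a x))// /Q; ring.
have cosd2 : `|cos (Q0 x + th) - cos (Q l x + th)| <= 2.
  rewrite (le_trans (ler_normB _ _))//.
  by rewrite (_ : 2 = 1 + 1)// lerD// cos_max.
have sd := le_delta_sqr (r * \sum_(a < l) X a x) de0.
have xe := sqr_le_excess (X l x) K0.
rewrite /term QS.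
(* A Taylor remainder at the phase [Q l], plus the effect of having taken the quadratic term at the
   phase [Q0]. *)
rewrite (_ : _ + _ = (cos (Q l x + y + th) - cos (Q l x + th)
    + sin (Q l x + th) * y + cos (Q l x + th) * (y ^+ 2 / 2))
  + (cos (Q0 x + th) - cos (Q l x + th)) * (r ^+ 2 / 2 * X l x ^+ 2)); last first.
  by rewrite /y; field.
rewrite (le_trans (ler_normD _ _))// /h.
set D := excess K _ ^+ 2 in cl xe *; set c := cos _ - cos _ in cosd cosd2 *.
rewrite [leRHS](_ : _ = 3 * (r ^+ 2 * (2 * D + 2 * K ^+ 2 * r * (1 + X l x ^+ 2)))
  + r ^+ 2 * (2 * D + K ^+ 2 * (de + (r * \sum_(a < l) X a x) ^+ 2 / de)));
  last by ring.
apply: lerD; first by rewrite (le_trans ct)// ler_wpM2l.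
rewrite normrM (ger0_norm (_ : 0 <= r ^+ 2 / 2 * X l x ^+ 2)); last first.
  by rewrite mulr_ge0 ?divr_ge0 ?sqr_ge0.
have D0 : 0 <= D by exact: sqr_ge0.
have : `|c| * (X l x ^+ 2 / 2) <= 2 * D
    + K ^+ 2 * (de + (r * \sum_(a < l) X a x) ^+ 2 / de).
  have c0 := normr_ge0 c; have : `|c| * (X l x ^+ 2 / 2) <= `|c| * (D + K ^+ 2).
    by rewrite ler_wpM2l//; lra.
  move=> /le_trans; apply; rewrite mulrDr lerD ?ler_wpM2r//.
  rewrite mulrC ler_wpM2l ?sqr_ge0//.
  exact: le_trans cosd sd.
move=> H; rewrite (_ : `|c| * _ = r ^+ 2 * (`|c| * (X l x ^+ 2 / 2))); last by ring.
by rewrite ler_wpM2l ?sqr_ge0.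
Qed.

(** The increments of the cosine telescope over the block. What is left of them, up to the error, is
    the quadratic term with the phase of the start of the block. *)
Lemma block_taylor m :
  `|Ex (fun x => e x * (cos (Q m x + th) - cos (Q0 x + th)
     + cos (Q0 x + th) * (r ^+ 2 / 2 * \sum_(a < m) X a x ^+ 2)))|
  <= m%:R * (r ^+ 2 * block_err m).
Proof.
rewrite (eq_Ex _ (g := fun x => \sum_(l < m) e x * term l x)); last first.
  move=> x; rewrite -mulr_sumr; congr (_ * _); rewrite big_split/=; congr (_ + _).
    rewrite -(big_mkord xpredT (fun l => cos (Q l.+1 x + th) - cos (Q l x + th))).
    rewrite telescope_sumr//.
    by rewrite /Q big_ord0 mulr0 addr0.
  by rewrite mulr_sumr mulr_sumr.
rewrite Ex_sum => [|l _]; last by apply: integ_mul_bdd.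
rewrite (le_trans (ler_norm_sum _ _ _))//.
rewrite (@le_trans _ _ (\sum_(l < m) r ^+ 2 * block_err m))//.
  by apply: ler_sum => l _; exact: term_le.
by rewrite sumr_const card_ord mulr_natl.
Qed.

Variables (m p : nat) (V Vs Ds : Omega -> R).
Hypothesis m0 : (0 < m)%N.
Hypothesis p0 : (0 < p)%N.
Hypothesis rE : r ^+ 2 = (p%:R * m%:R)^-1.
Hypothesis AVs : A 0 Vs.
Hypothesis iVs : integ Vs.
Hypothesis iDs : integ Ds.
Hypothesis Vs0 : forall x, 0 <= Vs x.
Hypothesis Ds0 : forall x, 0 <= Ds x.
Hypothesis VsDs : forall x, Vs x <= 2 * Ds x + 2 * K ^+ 2.
Hypothesis ExVs : Ex Vs <= s2.
Hypothesis ExDs : Ex Ds <= eta.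
Hypothesis VE : forall x, V x = m%:R^-1 * \sum_(a < m) X a x ^+ 2.

(** Over one block the cosine is damped by an exponential of the bracket, and the bracket [V] of the
    block may be exchanged for a bracket [Vs] known before the block starts, at the cost of their L1
    distance. [Ds] is the part of [Vs] above the truncation level. *)
Lemma block_bracket :
  `|Ex (fun x => e x * (cos (Q m x + th)
       - cos (Q0 x + th) * expR (- (Vs x / (2 * p%:R)))))| <=
  p%:R^-1 * (block_err m + eta + K ^+ 2 * s2 / (2 * p%:R)
             + 2^-1 * Ex (fun x => `|V x - Vs x|)).
Proof.
have pR : 0 < p%:R :> R by rewrite ltr0n.
have mR : 0 < m%:R :> R by rewrite ltr0n.
have iV : integ V.
  rewrite (_ : V = (fun x => m%:R^-1 * \sum_(a < m) X a x ^+ 2)); last exact/funext.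
  by apply: integZ; apply: integ_sum => a _; exact: (XL a).2.
have iVV : integ (fun x => `|V x - Vs x|) by apply: integ_abs; exact: integB.
pose y x := Vs x / (2 * p%:R).
have y0 x : 0 <= y x by rewrite /y divr_ge0// mulr_ge0// ltW.
have mVs := filtration_mf FA AVs.
have my : mf y by apply: mfM => //; exact: mf_cst.
pose t1 x := e x * (cos (Q m x + th) - cos (Q0 x + th)
     + cos (Q0 x + th) * (r ^+ 2 / 2 * \sum_(a < m) X a x ^+ 2)).
(* Two replacements: [V] by [Vs] in the quadratic term, then 1 - y by exp(-y). *)
pose t2 x := e x * (cos (Q0 x + th) * ((y x - V x / (2 * p%:R))
   - (expR (- y x) - 1 + y x))).
have mE : mf (fun x => expR (- y x)).
  apply: (mf_comp (u := fun z => expR (- z))) my.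
  by move=> z; apply: (@continuous_comp _ _ _ -%R expR);
    [exact: oppr_continuous|exact: continuous_expR].
have mt2 : mf t2.
  apply: mfM => //; apply: mfM; first exact: mcos.
  apply: mfB; first by apply: mfB => //; apply: mfM; [exact: integ_mf iV|exact: mf_cst].
  by apply: mfD => //; apply: mfB => //; exact: mf_cst.
pose h2 x := p%:R^-1 * (2^-1 * `|V x - Vs x| + (Ds x + K ^+ 2 / (2 * p%:R) * Vs x)).
have ih2 : integ h2.
  apply: integZ; apply: integD; first exact: integZ.
  by apply: integD => //; exact: integZ.
have t2h x : `|t2 x| <= h2 x.
  rewrite /t2 normrM (le_trans (ler_piMl _ (ne x)))//.
  rewrite normrM (le_trans (ler_piMl _ (cos_max _)))//.
  rewrite (le_trans (ler_normB _ _))// /h2 mulrDr; apply: lerD.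
    rewrite /y -mulrBl normrM distrC mulrC.
    have hp : 0 <= (2 * p%:R)^-1 :> R by rewrite invr_ge0 mulr_ge0// ltW.
    rewrite (ger0_norm hp).
    by rewrite invfM [leRHS]mulrA (mulrC 2^-1).
  have /andP[k1 k2] := expRN_taylor1 (y0 x); rewrite ger0_norm// (le_trans k2)//.
  have c0 := unit_cut_ge0 (y x); have c1 := unit_cut_le1 (y x).
  have c2 : unit_cut (y x) <= y x by have := unit_cut_le (y x); rewrite ger0_norm.
  rewrite [X in X * _](_ : y x = p%:R^-1 * (Vs x / 2)); last first.
    by rewrite /y invfM; ring.
  rewrite -[leLHS]mulrA; apply: ler_wpM2l; first by rewrite invr_ge0 ltW.
  apply: (@le_trans _ _ ((Ds x + K ^+ 2) * unit_cut (y x))).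
    by rewrite ler_wpM2r//; have := VsDs x; lra.
  rewrite mulrDl lerD//; first by rewrite ler_piMr.
  rewrite (_ : _ / _ * _ = K ^+ 2 * y x); last by rewrite /y; ring.
  by apply: ler_wpM2l => //; exact: sqr_ge0.
have it2 : integ t2 by exact: integ_le mt2 t2h ih2.
have it1 : integ t1.
  apply: (integ_mul_bdd (M := 1)) => //; apply: integD.
    apply: (integ_bdd (M := 2)); first by apply: mfB; exact: mcos.
    move=> x; rewrite (le_trans (ler_normB _ _))//.
    by rewrite (_ : 2 = 1 + 1)// lerD// cos_max.
  apply: (integ_mul_bdd (M := 1)); first exact: mcos.
    by move=> x; exact: cos_max.
  by apply: integZ; apply: integ_sum => a _; exact: (XL a).2.
rewrite (eq_Ex _ (g := fun x => t1 x + t2 x)); last first.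
  move=> x; rewrite /t1 /t2 -/(y x) VE rE invfM.
  by field; rewrite !gt_eqF.
rewrite ExD// (le_trans (ler_normD _ _))//.
have := block_taylor m; move: (block_err m) => B bt.
rewrite -!addrA mulrDr; apply: lerD.
  apply: (le_trans bt); rewrite rE.
  rewrite (_ : m%:R * _ = p%:R^-1 * B)//.
  by field; rewrite !gt_eqF.
apply: (le_trans (abs_Ex_le mt2 ih2 t2h)).
rewrite /h2 ExZ; last first.
  apply: integD; first exact: integZ.
  by apply: integD => //; exact: integZ.
apply: ler_wpM2l; first by rewrite invr_ge0 ltW.
rewrite ExD; [|exact: integZ|]; last first.
  by apply: integD => //; exact: integZ.
rewrite ExZ// ExD//; last exact: integZ.
rewrite ExZ//; have : K ^+ 2 / (2 * p%:R) * Ex Vs <= K ^+ 2 * s2 / (2 * p%:R).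
  rewrite [leRHS]mulrAC; apply: ler_wpM2l => //.
  by rewrite divr_ge0 ?sqr_ge0// mulr_ge0// ltW.
move: ExDs; lra.
Qed.

End block.
End block_comparison.

(** * Central limit theorem with a stable bracket *)

Section stable_bracket_clt.
Context (disp : measure_display) (Omega : measurableType disp) (R : realType).
Variable P : probability Omega R.
Local Notation Ex := (mean P).
Local Notation L2 := (L2 P).
Local Notation integ := (integ P).

Lemma sum_blocks (F : nat -> R) (m n : nat) :
  \sum_(a < n * m) F a = \sum_(b < n) \sum_(a < m) F (b * m + a)%N.
Proof.
elim: n => [|n IH]; first by rewrite !big_ord0.
by rewrite big_ord_recr/= -IH mulSnr big_split_ord.
Qed.

Lemma big_ord_window (T : Type) (idx : T) (op : Monoid.law idx) (F : nat -> T)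
    (k m n : nat) : (k <= n)%N ->
  \big[op/idx]_(a < n | (m <= a < k)%N) F a = \big[op/idx]_(m <= a < k) F a.
Proof.
move=> kn; rewrite (big_nat_widen _ _ _ _ _ kn) (big_nat_widenl _ 0%N)//.
by rewrite big_mkord; apply: eq_bigl => a; rewrite andbC.
Qed.

(* An exponential gap controls the gap itself, up to the part of the two
   variables lying above the truncation level. *)
Lemma dist_le_expR (K v v' D D' : R) : 0 <= v -> 0 <= v' -> 0 <= D -> 0 <= D' ->
  v <= 2 * D + 2 * K ^+ 2 -> v' <= 2 * D' + 2 * K ^+ 2 ->
  `|v - v'| <= 4 * expR (K ^+ 2) * `|expR (- (v / 4)) - expR (- (v' / 4))|
     + 4 * (D + D').
Proof.
wlog vv' : v v' D D' / v' <= v.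
  move=> H v0 v'0 D0 D'0 vD v'D; have [/H|/ltW/H h] := leP v' v; first exact.
  by rewrite distrC (distrC (expR _)) (addrC D) h.
move=> v0 v'0 D0 D'0 vD v'D.
have e0 : 0 <= expR (- (v' / 4)) - expR (- (v / 4)).
  by rewrite subr_ge0 ler_expR lerN2 ler_wpM2r.
rewrite ger0_norm ?subr_ge0// distrC ger0_norm//.
have K0 := expR_ge0 (K ^+ 2).
(* Above [4 * K ^+ 2] the assumption on [v] gives v <= 4 D; below, exp(- v / 4) is at least exp(-
   K^2). *)
have [vK|Kv] := leP v (4 * K ^+ 2); last first.
  have : 0 <= expR (K ^+ 2) * (expR (- (v' / 4)) - expR (- (v / 4))).
    exact: mulr_ge0.
  lra.
have -> : expR (- (v' / 4)) - expR (- (v / 4)) =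
    expR (- (v / 4)) * (expR ((v - v') / 4) - 1).
  by rewrite mulrBr mulr1 -expRD; congr (expR _ - _); field.
have h1 := expR_ge1Dx ((v - v') / 4).
have h2 : 1 <= expR (K ^+ 2) * expR (- (v / 4)).
  by rewrite -expRD -[leLHS]expR0 ler_expR; lra.
rewrite -mulrA [X in _ <= 4 * X + _]mulrA.
set z := expR _ * _ in h2 *; set y := expR _ in h1 *.
have : (v - v') / 4 <= z * (y - 1) by nra.
lra.
Qed.

Variables (A : nat -> (Omega -> R) -> Prop) (X : nat -> Omega -> R).
Hypothesis XA : mds P A X.
Let FA := mds_filtration XA.
Let XL := mds_L2 XA.
Variables (s2 K eta : R).
Hypothesis K0 : 0 <= K.
Hypothesis Xs : forall a, Ex (fun x => X a x ^+ 2) <= s2.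
Hypothesis Xe : forall a, Ex (fun x => excess K (X a x) ^+ 2) <= eta.

Definition bracket (k m : nat) (x : Omega) : R :=
  m%:R^-1 * \sum_(a < m) X (k + a)%N x ^+ 2.
Definition laplace_bracket (k m : nat) : R :=
  Ex (fun x => expR (- (bracket k m x / 2))).

Hypothesis stat : forall k m, laplace_bracket k m = laplace_bracket 0 m.

Variables (m p : nat).
Hypothesis m0 : (0 < m)%N.
Hypothesis p0 : (0 < p)%N.

Let mR : 0 < m%:R :> R. Proof. by rewrite ltr0n. Qed.
Let pR : 0 < p%:R :> R. Proof. by rewrite ltr0n. Qed.
Let V b := bracket (b * m) m.
Let D b x : R := m%:R^-1 * \sum_(a < m) excess K (X (b * m + a)%N x) ^+ 2.
(** The square root of the integrand of the Laplace transform: the defect in Jensen's inequality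
    then controls a sum of squared deviations of the [u b]. *)
Let u b x : R := expR (- (V b x / 4)).

Let V_ge0 b x : 0 <= V b x.
Proof.
by rewrite mulr_ge0 ?invr_ge0 ?ler0n// sumr_ge0// => a _; rewrite sqr_ge0.
Qed.
Let D_ge0 b x : 0 <= D b x.
Proof.
by rewrite mulr_ge0 ?invr_ge0 ?ler0n// sumr_ge0// => a _; rewrite sqr_ge0.
Qed.
Let eXL a : integ (fun x => excess K (X a x) ^+ 2).
Proof.
have [] // : L2 (fun x => excess K (X a x)).
apply: (L2_le _ _ (XL a)) => [|x]; last exact: abs_excess.
by apply: mf_comp; [exact: continuous_excess|exact: L2_mf (XL a)].
Qed.
Let iV b : integ (V b).
Proof. by apply: integZ; apply: integ_sum => a _; exact: (XL _).2. Qed.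
Let iD b : integ (D b).
Proof. by apply: integZ; apply: integ_sum => a _; exact: eXL. Qed.
Let avg_le (F : nat -> R) (c : R) : (forall a, F a <= c) ->
  m%:R^-1 * \sum_(a < m) F a <= c.
Proof.
move=> Fc; rewrite ler_pdivrMl//.
apply: (@le_trans _ _ (\sum_(a < m) c)); first by apply: ler_sum.
by rewrite sumr_const card_ord mulr_natl.
Qed.
Let VD b x : V b x <= 2 * D b x + 2 * K ^+ 2.
Proof.
rewrite /V /bracket ler_pdivrMl// mulrDr /D.
rewrite (_ : m%:R * (2 * _) = 2 * \sum_(a < m) excess K (X (b * m + a)%N x) ^+ 2); last first.
  by rewrite mulrCA mulVKf// gt_eqF.
have -> : m%:R * (2 * K ^+ 2) = \sum_(a < m) 2 * K ^+ 2.
  by rewrite sumr_const card_ord mulr_natl.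
rewrite mulr_sumr -big_split/=; apply: ler_sum => a _; exact: sqr_le_excess.
Qed.
Let ExV b : Ex (V b) <= s2.
Proof.
rewrite ExZ; last by apply: integ_sum => a _; exact: (XL _).2.
rewrite Ex_sum => [|a _]; last exact: (XL _).2.
exact: (avg_le (F := fun a => Ex (fun x => X (b * m + a)%N x ^+ 2))).
Qed.
Let ExD' b : Ex (D b) <= eta.
Proof.
rewrite ExZ; last by apply: integ_sum => a _; exact: eXL.
rewrite Ex_sum => [|a _]; last exact: eXL.
exact: (avg_le (F := fun a => Ex (fun x => excess K (X (b * m + a)%N x) ^+ 2))).
Qed.

Let continuous_expRN (c : R) : continuous (fun z : R => expR (- (z * c))).
Proof.
move=> z; apply: (@continuous_comp _ _ _ (fun z : R => - (z * c)) expR).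
  by apply: cvgN; apply: cvgMl; exact: cvg_id.
exact: continuous_expR.
Qed.

Let mu b : mf (u b).
Proof. exact: mf_comp (@continuous_expRN 4^-1) (integ_mf (iV b)). Qed.
Let u01 b x : 0 <= u b x <= 1.
Proof. by rewrite expR_ge0 expR_le1 oppr_le0 divr_ge0. Qed.
Let uL b : L2 (u b).
Proof.
apply: (L2_bdd (M := 1)) => // x; have /andP[? ?] := u01 b x.
by rewrite ger0_norm.
Qed.

Let gap : R := laplace_bracket 0 m - laplace_bracket 0 (p.+1 * m).
Let ubar x : R := p.+1%:R^-1 * \sum_(b < p.+1) u b x.
Let ubarL : L2 ubar. Proof. by apply: L2Z; apply: L2_sum. Qed.

Let V_avg x : bracket 0 (p.+1 * m) x = p.+1%:R^-1 * \sum_(b < p.+1) V b x.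
Proof.
rewrite /V /bracket -mulr_sumr natrM invfM -mulrA; congr (_ * (_ * _)).
exact: (sum_blocks (fun a => X a x ^+ 2)).
Qed.

Let Ex_u2 b : Ex (fun x => u b x ^+ 2) = laplace_bracket 0 m.
Proof.
rewrite -(stat (b * m)); apply: eq_Ex => x.
by rewrite /u expr2 -expRD; congr expR; rewrite /V; field.
Qed.

(** A quantitative Jensen inequality. The squared deviations sum to the sum of the u^2 minus (p + 1)
    ubar^2. Each u^2 has mean [laplace_bracket 0 m] by stationarity, and ubar^2 is at least exp(- V
    / 2) for the bracket V of the p + 1 blocks together. *)
Let sum_gap : \sum_(b < p.+1) Ex (fun x => (u b x - ubar x) ^+ 2) <= p.+1%:R * gap.
Proof.
have p1R : 0 < p.+1%:R :> R by rewrite ltr0n.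
have mBr k l : mf (bracket k l).
  by apply: mfM; [exact: mf_cst|apply: mf_sum => a; apply: mfX; exact: L2_mf (XL _)].
have iLap k l : integ (fun x => expR (- (bracket k l x / 2))).
  apply: (integ_bdd (M := 1)).
    exact: mf_comp (@continuous_expRN 2^-1) (mBr k l).
  move=> x; rewrite ger0_norm ?expR_ge0// expR_le1 oppr_le0 divr_ge0//.
  by rewrite mulr_ge0 ?invr_ge0 ?ler0n// sumr_ge0// => a _; rewrite sqr_ge0.
have iu2 b : integ (fun x => u b x ^+ 2) := (uL b).2.
have isum : integ (fun x => \sum_(b < p.+1) u b x ^+ 2) by apply: integ_sum.
rewrite -Ex_sum => [|b _]; last exact: (L2B (uL b) ubarL).2.
rewrite /gap mulrBr.
have -> : p.+1%:R * laplace_bracket 0 m = Ex (fun x => \sum_(b < p.+1) u b x ^+ 2).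
  rewrite Ex_sum//; under eq_bigr do rewrite Ex_u2.
  by rewrite sumr_const card_ord mulr_natl.
rewrite -ExZ// -ExB//; last exact: integZ.
apply: le_Ex.
- by apply: integ_sum => b _; exact: (L2B (uL b) ubarL).2.
- by apply: integB => //; exact: integZ.
move=> x.
have -> : \sum_(b < p.+1) (u b x - ubar x) ^+ 2 =
    \sum_(b < p.+1) u b x ^+ 2 - p.+1%:R * ubar x ^+ 2.
  transitivity (\sum_(b < p.+1) (u b x ^+ 2 - 2 * ubar x * u b x + ubar x ^+ 2)).
    by apply: eq_bigr => b _; ring.
  rewrite big_split/= sumrB -mulr_sumr sumr_const card_ord -[(ubar x ^+ 2) *+ _]mulr_natl.
  have -> : \sum_(b < p.+1) u b x = p.+1%:R * ubar x.
    by rewrite /ubar mulVKf// gt_eqF.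
  by ring.
rewrite lerD2l lerN2; apply: ler_wpM2l; first exact: ltW.
rewrite V_avg.
set c : R := - (p.+1%:R^-1 * (\sum_(b < p.+1) V b x) / 4).
have -> : expR (- (p.+1%:R^-1 * (\sum_(b < p.+1) V b x) / 2)) = expR c ^+ 2.
  by rewrite expr2 -expRD; congr expR; rewrite /c; field.
rewrite ler_sqr ?nnegrE ?expR_ge0//; last first.
  by rewrite mulr_ge0 ?invr_ge0 ?ler0n// sumr_ge0// => b _; rewrite expR_ge0.
rewrite ler_pdivlMl//.
(* The tangent line of the exponential at the average [c]; the linear terms cancel in the sum. *)
apply: (@le_trans _ _ (\sum_(b < p.+1) expR c * (1 + (- (V b x / 4) - c)))).
  rewrite -mulr_sumr big_split/= sumr_const card_ord sumrB sumr_const card_ord.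
  rewrite sumrN -mulr_suml -[1 *+ _]mulr_natl -[c *+ _]mulr_natl mulr1.
  rewrite mulrC ler_wpM2l ?expR_ge0// /c le_eqVlt; apply/orP; left; apply/eqP.
  by field; rewrite gt_eqF.
apply: ler_sum => b _; rewrite (_ : u b x = expR c * expR (- (V b x / 4) - c)).
  by rewrite ler_wpM2l ?expR_ge0// expR_ge1Dx.
by rewrite -expRD; congr expR; lra.
Qed.

Let sum_gap0 : \sum_(b < p) Ex (fun x => (u b.+1 x - u 0%N x) ^+ 2)
  <= 2 * p.+1%:R ^+ 2 * gap.
Proof.
pose w b := Ex (fun x => (u b x - ubar x) ^+ 2).
have w0 b : 0 <= w b by apply: Ex_ge0 => x; exact: sqr_ge0.
have iw b : integ (fun x => (u b x - ubar x) ^+ 2) := (L2B (uL b) ubarL).2.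
apply: (@le_trans _ _ (\sum_(b < p) (2 * w b.+1 + 2 * w 0%N))).
  apply: ler_sum => b _; rewrite /w -(ExZ 2 (iw b.+1)) -(ExZ 2 (iw 0%N)) -(ExD (integZ 2 (iw _)) (integZ 2 (iw _))).
  apply: le_Ex => [||x]; first exact: (L2B (uL _) (uL _)).2.
    by apply: integD; exact: integZ.
  by have := sqr_ge0 (u b.+1 x - ubar x + (u 0%N x - ubar x)); lra.
have -> : \sum_(b < p) (2 * w b.+1 + 2 * w 0%N) =
    2 * \sum_(b < p) w b.+1 + p%:R * (2 * w 0%N).
  by rewrite big_split/= -mulr_sumr sumr_const card_ord (mulr_natl _ p).
have := sum_gap; rewrite big_ord_recl/= -/(w 0%N).
rewrite (eq_bigr (fun b : 'I_p => w b.+1))// => sg.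
have sw : 0 <= \sum_(b < p) w b.+1 by rewrite sumr_ge0.
rewrite (_ : 2 * _ ^+ 2 * gap = 2 * p.+1%:R * (p.+1%:R * gap)); last by ring.
apply: (@le_trans _ _ (2 * p.+1%:R * (w 0%N + \sum_(b < p) w b.+1))); last first.
  by rewrite ler_wpM2l// mulr_ge0.
rewrite -natr1; have := w0 0%N; have := ltW pR; nra.
Qed.

(** [dist_le_expR] passes from the [u b] to the brackets and [le_delta_sqr] from first to second
    moments. For fixed [p] and [d2], a small gap makes all the brackets close to the one of block 0,
    up to the terms in [d2] and [eta]. *)
Lemma bracket_stable (d2 : R) : 0 < d2 ->
  \sum_(b < p) Ex (fun x => `|V b.+1 x - V 0%N x|) <=
  4 * expR (K ^+ 2) * (p%:R * d2 + 2 * p.+1%:R ^+ 2 * gap / d2) + p%:R * (8 * eta).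
Proof.
move=> d20.
apply: (@le_trans _ _ (\sum_(b < p) (4 * expR (K ^+ 2) *
    (d2 + Ex (fun x => (u b.+1 x - u 0%N x) ^+ 2) / d2) + 8 * eta))).
  apply: ler_sum => b _.
  have i1 : integ (fun x => (u b.+1 x - u 0%N x) ^+ 2) := (L2B (uL _) (uL _)).2.
  have i1' : integ (fun x => (u b.+1 x - u 0%N x) ^+ 2 / d2).
    by under eq_fun do rewrite mulrC; exact: integZ.
  have i2 := integD (integ_cst d2) i1'.
  have i3 := integD (iD b.+1) (iD 0%N).
  apply: (@le_trans _ _ (Ex (fun x => 4 * expR (K ^+ 2) *
     (d2 + (u b.+1 x - u 0%N x) ^+ 2 / d2) + 4 * (D b.+1 x + D 0%N x)))).
    apply: le_Ex => [||x].
    - by apply: integ_abs; exact: integB.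
    - by apply: integD; exact: integZ.
    - rewrite (le_trans (dist_le_expR (V_ge0 _ _) (V_ge0 _ _) (D_ge0 _ _)
        (D_ge0 _ _) (VD _ _) (VD _ _)))// lerD2r.
      apply: ler_wpM2l; first by rewrite mulr_ge0// expR_ge0.
      exact: le_delta_sqr.
  rewrite ExD; [|exact: integZ|exact: integZ].
  rewrite (ExZ _ i2) (ExZ _ i3) (ExD (integ_cst d2) i1') Ex_cst.
  rewrite (ExD (iD _) (iD _)).
  have -> : Ex (fun x => (u b.+1 x - u 0%N x) ^+ 2 / d2) =
      Ex (fun x => (u b.+1 x - u 0%N x) ^+ 2) / d2.
    by under eq_Ex do rewrite mulrC; rewrite ExZ// mulrC.
  by have := ExD' b.+1; have := ExD' 0%N; lra.
rewrite big_split/= sumr_const card_ord -[8 * eta *+ _]mulr_natl lerD2r.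
rewrite -mulr_sumr; apply: ler_wpM2l; first by rewrite mulr_ge0// expR_ge0.
rewrite big_split/= sumr_const card_ord -[d2 *+ _]mulr_natl lerD2l.
by rewrite -mulr_suml; apply: ler_wpM2r; [rewrite invr_ge0 ltW|exact: sum_gap0].
Qed.

Section block_telescoping.
Variables (th de : R).
Hypothesis de0 : 0 < de.
Let r : R := (Num.sqrt (p%:R * m%:R))^-1.
(** Block 0 is left out of the sum: it only serves to make its bracket known before the other blocks
    start. *)
Let Qb b x : R := r * \sum_(a < b * m) X (m + a)%N x.
Let err : R := block_err s2 K eta r de m + eta + K ^+ 2 * s2 / (2 * p%:R).
Let c b : R := (1 - b%:R / p%:R) / 2.
(** Interpolates between the Laplace transform times [cos th], at b = 0, and the expectation of the
    cosine, at b = p. The blocks after the first b summed ones are represented by an exponential of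
    the bracket of block 0. *)
Let W b : R := Ex (fun x => cos (Qb b x + th) * expR (- (V 0%N x * c b))).

Let r0 : 0 <= r. Proof. by rewrite invr_ge0 sqrtr_ge0. Qed.
Let rE : r ^+ 2 = (p%:R * m%:R)^-1.
Proof. by rewrite exprVn sqr_sqrtr// mulr_ge0// ltW. Qed.

Let AV : A m (V 0%N).
Proof.
apply: filtrationZ => //; apply: (filtration_sum_ord FA
  (F := fun a x => X (0 * m + a)%N x ^+ 2)) => a am.
apply: filtrationX => //; rewrite mul0n add0n.
exact: (filtration_le FA am (mds_adapted XA a)).
Qed.

Let AQb b : A (m + b * m)%N (Qb b).
Proof.
apply: filtrationZ => //.
apply: (filtration_sum_ord FA (F := fun a => X (m + a)%N)) => a am.
by apply: (filtration_le FA _ (mds_adapted XA (m + a))); rewrite -addnS leq_add2l.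
Qed.

(** Both [V 0] and the damping factor with exponent [c b.+1] belong to the past of block b + 1, so
    [block_bracket] applies to the array shifted by (b + 1) m. The exponential it produces turns
    [c b.+1] into [c b]. *)
Let W_step b : (b < p)%N ->
  `|W b.+1 - W b| <= p%:R^-1 * (err + 2^-1 * Ex (fun x => `|V b.+1 x - V 0%N x|)).
Proof.
move=> bp; set kappa := (b.+1 * m)%N.
have kE : (m + b * m = kappa + 0)%N by rewrite addn0 /kappa mulSn.
have cb0 : 0 <= c b.+1.
  by rewrite /c divr_ge0// subr_ge0 ler_pdivrMr// mul1r ler_nat.
pose e x := expR (- (V 0%N x * c b.+1)).
have Ae : A (kappa + 0)%N e.
  apply: (filtration_comp FA (u := fun z => expR (- (z * c b.+1)))) => //.
  by apply: (filtration_le FA _ AV); rewrite -kE leq_addr.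
have AQ : A (kappa + 0)%N (Qb b) by rewrite -kE.
have AV' : A (kappa + 0)%N (V 0%N).
  by apply: (filtration_le FA _ AV); rewrite -kE leq_addr.
have e01 x : 0 <= e x <= 1.
  by rewrite expR_ge0 expR_le1 oppr_le0 mulr_ge0.
have := block_bracket (mds_shift XA kappa) K0 (fun a => Xs (kappa + a)%N)
  (fun a => Xe (kappa + a)%N) th r0 de0 AQ Ae e01 m0 p0 rE AV' (iV 0%N) (iD 0%N)
  (V_ge0 0%N) (D_ge0 0%N) (VD 0%N) (ExV 0%N) (ExD' 0%N)
  (V := V b.+1) (fun=> erefl).
congr (`|_| <= _).
have mcosQ k : mf (fun x => cos (Qb k x + th)).
  apply: (mf_comp (u := fun y => cos (y + th)) (@continuous_cos_shift _ th)).
  exact: filtration_mf FA _ _ (AQb k).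
have mexp k : mf (fun x => expR (- (V 0%N x * c k))).
  exact: mf_comp (@continuous_expRN (c k)) (integ_mf (iV 0%N)).
have iW k : (k <= p)%N ->
    integ (fun x => cos (Qb k x + th) * expR (- (V 0%N x * c k))).
  move=> kp; apply: (integ_bdd (M := 1)); first exact: mfM.
  move=> x; rewrite normrM mulr_ile1// ?cos_max//.
  rewrite ger0_norm ?expR_ge0// expR_le1 oppr_le0 mulr_ge0//.
  by rewrite /c divr_ge0// subr_ge0 ler_pdivrMr// mul1r ler_nat.
rewrite /W -ExB; [|exact: iW|by apply: iW; exact: ltnW].
apply: eq_Ex => x; rewrite mulrBr; congr (_ - _).
  rewrite [RHS]mulrC -/(e x); congr (e x * cos (_ + th)).
  have bm : (b.+1 * m = b * m + m)%N by rewrite mulSn addnC.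
  rewrite /Qb bm big_split_ord/= mulrDr; congr (_ + r * _).
  by apply: eq_bigr => a _; rewrite /kappa mulSn addnA.
rewrite mulrCA -expRD; congr (_ * expR _).
by rewrite /c -natr1; field; rewrite gt_eqF.
Qed.

Lemma clt_blocks :
  `|Ex (fun x => cos (Qb p x + th)) - cos th * laplace_bracket 0 m| <=
  err + (2 * p%:R)^-1 * \sum_(b < p) Ex (fun x => `|V b.+1 x - V 0%N x|).
Proof.
have -> : Ex (fun x => cos (Qb p x + th)) = W p.
  by apply: eq_Ex => x; rewrite /c divff ?gt_eqF// subrr mul0r mulr0 oppr0 expR0 mulr1.
have -> : cos th * laplace_bracket 0 m = W 0%N.
  rewrite /W /laplace_bracket -ExZ; last first.
    apply: (integ_bdd (M := 1)).
      by have := mf_comp (@continuous_expRN 2^-1) (integ_mf (iV 0%N)); rewrite /V mul0n.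
    move=> x; rewrite ger0_norm ?expR_ge0// expR_le1 oppr_le0 divr_ge0//.
    by have := V_ge0 0%N x; rewrite /V mul0n.
  apply: eq_Ex => x; rewrite /Qb mul0n big_ord0 mulr0 add0r /V mul0n.
  by rewrite /c mul0r subr0 mul1r.
rewrite -(telescope_sumr W (leq0n p)) big_mkord (le_trans (ler_norm_sum _ _ _))//.
apply: (@le_trans _ _ (\sum_(b < p) p%:R^-1 *
    (err + 2^-1 * Ex (fun x => `|V b.+1 x - V 0%N x|)))).
  by apply: ler_sum => b _; exact: W_step.
rewrite -mulr_sumr big_split/= sumr_const card_ord -mulr_sumr -[err *+ _]mulr_natl.
by rewrite mulrDr mulKf ?gt_eqF// invfM [X in _ <= _ + X]mulrAC [X in _ <= _ + X]mulrC.
Qed.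

(** The full sum differs from the sum over the blocks 1, ..., p by the first block, by at most p
    terms at the end and by the normalization. The difference is a weighted sum of the [X a], whose
    second moment is at most s2 times the sum of the squared weights. *)
Lemma clt_bound (d2 d3 : R) (n : nat) : 0 < d2 -> 0 < d3 ->
  (p.+1 * m <= n)%N -> (n < p.+1 * m.+1)%N ->
  `|Ex (fun x => cos ((Num.sqrt n%:R)^-1 * (\sum_(a < n) X a x) + th))
    - cos th * laplace_bracket 0 m| <=
  err + (2 * p%:R)^-1 * (4 * expR (K ^+ 2) *
      (p%:R * d2 + 2 * p.+1%:R ^+ 2 * gap / d2) + p%:R * (8 * eta))
   + (d3 + 2 * s2 * (p.+1%:R^-1 + p%:R / n%:R) / d3).
Proof.
move=> d20 d30 mn nm.
have n0 : (0 < n)%N by apply: leq_trans mn; rewrite muln_gt0.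
have nR : 0 < n%:R :> R by rewrite ltr0n.
have p1R : 0 < p.+1%:R :> R by rewrite ltr0n.
pose t : R := (Num.sqrt n%:R)^-1.
have t0 : 0 <= t by rewrite invr_ge0 sqrtr_ge0.
have tE : t ^+ 2 = n%:R^-1 by rewrite exprVn sqr_sqrtr// ltW.
pose w (a : nat) : R := if (m <= a < p.+1 * m)%N then t - r else t.
pose Sn x := t * \sum_(a < n) X a x.
have mpn : (m <= p.+1 * m)%N by rewrite mulSn leq_addr.
have s20 : 0 <= s2 by apply: le_trans (Xs 0%N); apply: Ex_ge0 => x; exact: sqr_ge0.
have wE x : \sum_(a < n) w a * X a x = Sn x - Qb p x.
  rewrite /Sn /Qb mulr_sumr.
  have -> : r * \sum_(a < p * m) X (m + a)%N x =
      \sum_(a < n | (m <= a < p.+1 * m)%N) r * X a x.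
    rewrite (big_ord_window _ (fun a => r * X a x))//.
    transitivity (\sum_(0 + m <= a < p.+1 * m) r * X a x); last by rewrite add0n.
    rewrite big_addn mulSn addKn big_mkord mulr_sumr.
    by apply: eq_bigr => a _; rewrite addnC.
  rewrite [X in _ = _ - X]big_mkcond -sumrB; apply: eq_bigr => a _.
  by rewrite /w; case: ifP => _; rewrite ?mulrBl// subr0.
(* With N = p m the sum is 2 - 2 sqrt (N / n), and N / n <= sqrt (N / n) because N <= n. *)
have w2 : \sum_(a < n) w a ^+ 2 <= 2 * (1 - p%:R * m%:R / n%:R).
  have -> : \sum_(a < n) w a ^+ 2 =
      \sum_(a < n) (t ^+ 2 + if (m <= a < p.+1 * m)%N then r ^+ 2 - 2 * t * r else 0).
    by apply: eq_bigr => a _; rewrite /w; case: ifP => _; ring.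
  rewrite big_split/= sumr_const card_ord -[_ *+ n]mulr_natl tE mulfV ?gt_eqF//.
  rewrite -big_mkcond/= sumr_const.
  have -> : #|[pred a : 'I_n | (m <= a < p.+1 * m)%N]| = (p * m)%N.
    rewrite -sum1_card (big_ord_window _ (fun=> 1%N))//.
    by rewrite sum_nat_const_nat muln1 mulSn addKn.
  rewrite -[_ *+ (p * m)]mulr_natl natrM mulrBr rE mulfV ?gt_eqF ?mulr_gt0//.
  set N : R := p%:R * m%:R; have N0 : 0 < N by rewrite mulr_gt0.
  have NR : N <= n%:R.
    by rewrite /N -natrM ler_nat (leq_trans _ mn)// leq_mul2r leqnSn orbT.
  have rN : N * r = Num.sqrt N.
    by rewrite /r -/N -{1}(sqr_sqrtr (ltW N0)) expr2 mulfK// gt_eqF// sqrtr_gt0.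
  have : N / n%:R <= t * Num.sqrt N.
    have -> : N / n%:R = (t * Num.sqrt N) ^+ 2.
      by rewrite exprMn tE (sqr_sqrtr (ltW N0)) mulrC.
    have tN0 : 0 <= t * Num.sqrt N by rewrite mulr_ge0// sqrtr_ge0.
    rewrite expr2 ler_piMl// /t mulrC ler_pdivrMr ?sqrtr_gt0// mul1r.
    by rewrite ler_sqrt ?ler0n.
  have -> : N * (2 * t * r) = 2 * t * (N * r) by ring.
  rewrite rN; lra.
have Sw x : `|cos (Sn x + th) - cos (Qb p x + th)| <=
    d3 + (\sum_(a < n) w a * X a x) ^+ 2 / d3.
  rewrite (le_trans (cos_lipschitz _ _))//.
  rewrite (_ : Sn x + th - _ = \sum_(a < n) w a * X a x); last by rewrite wE; ring.
  exact: le_delta_sqr.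
have SL : L2 Sn.
  apply: L2Z; apply: L2_sum => a; exact: XL.
have mQp : mf (Qb p) := filtration_mf FA (AQb p).
have mcos f : mf f -> mf (fun x => cos (f x + th)).
  exact: (mf_comp (u := fun y => cos (y + th)) (@continuous_cos_shift _ th)).
have icos f : mf f -> integ (fun x => cos (f x + th)).
  by move=> mf0; apply: (integ_bdd (M := 1)); [exact: mcos|move=> x; exact: cos_max].
have iw : integ (fun x => (\sum_(a < n) w a * X a x) ^+ 2) := (mds_sum_L2 XA w n).2.
have iw' : integ (fun x => (\sum_(a < n) w a * X a x) ^+ 2 / d3).
  by under eq_fun do rewrite mulrC; exact: integZ.
have h1 : `|Ex (fun x => cos (Sn x + th)) - Ex (fun x => cos (Qb p x + th))| <=
    d3 + 2 * s2 * (p.+1%:R^-1 + p%:R / n%:R) / d3.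
  rewrite -ExB; [|by apply: icos; exact: L2_mf SL|exact: icos].
  apply: (le_trans (abs_Ex_le _ (integD (integ_cst d3) iw') Sw)).
    by apply: mfB; apply: mcos => //; exact: L2_mf SL.
  rewrite (ExD (integ_cst d3) iw') Ex_cst lerD2l.
  rewrite (eq_Ex _ (g := fun x => d3^-1 * (\sum_(a < n) w a * X a x) ^+ 2));
    last by move=> x; rewrite mulrC.
  rewrite ExZ// mulrC; apply: ler_wpM2r; first by rewrite invr_ge0 ltW.
  apply: (le_trans (Ex_sqr_sum_le XA w n Xs)).
  rewrite (mulrC 2) -mulrA; apply: ler_wpM2l => //.
  apply: (le_trans w2); apply: ler_wpM2l => //.
  rewrite -(ler_pM2r nR) mulrBl mul1r mulfVK ?gt_eqF// mulrDl mulfVK ?gt_eqF//.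
  have : n%:R <= p.+1%:R * m%:R + p%:R :> R.
    by rewrite -natrM -natrD ler_nat -ltnS -addnS -[X in (_ + X)%N]muln1 -mulnDr addn1.
  have : m%:R <= p.+1%:R^-1 * n%:R :> R by rewrite ler_pdivlMl// -natrM ler_nat.
  rewrite -natr1; nra.
have h2 := clt_blocks.
have h3 : (2 * p%:R)^-1 * \sum_(b < p) Ex (fun x => `|V b.+1 x - V 0%N x|) <=
  (2 * p%:R)^-1 * (4 * expR (K ^+ 2) *
      (p%:R * d2 + 2 * p.+1%:R ^+ 2 * gap / d2) + p%:R * (8 * eta)).
  apply: ler_wpM2l; last exact: bracket_stable.
  by rewrite invr_ge0 mulr_ge0// ltW.
have := ler_normD (Ex (fun x => cos (Sn x + th)) - Ex (fun x => cos (Qb p x + th)))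
  (Ex (fun x => cos (Qb p x + th)) - cos th * laplace_bracket 0 m).
rewrite subrKA => /le_trans; apply.
by rewrite addrC; apply: lerD => //; apply: (le_trans h2); rewrite lerD2l.
Qed.

End block_telescoping.
End stable_bracket_clt.

(** * Random signs *)

Section sign_average.
Context (R : realType).
Implicit Types (n : nat) (s : nat -> R).

Definition set_sign s n (e : R) : nat -> R := fun a => if a == n then e else s a.

(* Average over all choices of [s 0, ..., s (n - 1)] in {-1, 1}; the other
   signs are 1. *)
Fixpoint sign_avg n (G : (nat -> R) -> R) : R :=
  if n is n'.+1 then
    (sign_avg n' (fun s => G (set_sign s n' 1)) +
     sign_avg n' (fun s => G (set_sign s n' (-1)))) / 2
  else G (fun=> 1).

Definition signs s := forall a, s a ^+ 2 = 1.

Lemma signs1 : signs (fun=> 1). Proof. by move=> a; rewrite expr1n. Qed.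

Lemma signs_set s n e : signs s -> e ^+ 2 = 1 -> signs (set_sign s n e).
Proof. by move=> ss e1 a; rewrite /set_sign; case: ifP. Qed.

Lemma sign_avg_le n G H : (forall s, signs s -> G s <= H s) ->
  sign_avg n G <= sign_avg n H.
Proof.
elim: n G H => [|n IH] G H GH /=; first exact/GH/signs1.
rewrite ler_pM2r// lerD//; apply: IH => s ss; apply: GH; apply: signs_set => //.
  by rewrite expr1n.
by rewrite sqrrN expr1n.
Qed.

Lemma eq_sign_avg n G H : (forall s, signs s -> G s = H s) ->
  sign_avg n G = sign_avg n H.
Proof. by move=> GH; apply/eqP; rewrite eq_le !sign_avg_le// => s /GH ->. Qed.

Lemma sign_avgD n G H :
  sign_avg n (fun s => G s + H s) = sign_avg n G + sign_avg n H.
Proof. by elim: n G H => [|n IH] G H //=; rewrite !IH; field. Qed.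

Lemma sign_avgZ n (c : R) G : sign_avg n (fun s => c * G s) = c * sign_avg n G.
Proof. by elim: n G => [|n IH] G //=; rewrite !IH; field. Qed.

Lemma sign_avg_cst n (c : R) : sign_avg n (fun=> c) = c.
Proof. by elim: n => [|n IH] //=; rewrite IH; field. Qed.

Lemma sign_avgC n m (G : (nat -> R) -> (nat -> R) -> R) :
  sign_avg n (fun s => sign_avg m (G s)) =
  sign_avg m (fun t => sign_avg n (fun s => G s t)).
Proof.
elim: n G => [|n IH] G //=; rewrite !IH -sign_avgD mulrC -sign_avgZ.
by apply: eq_sign_avg => s _; rewrite mulrC.
Qed.

(** Averaging cos (a + x) and cos (a - x) gives cos a cos x; the phase collects the signs already
    fixed. *)
Lemma sign_avg_cos n (x : nat -> R) (th : R) :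
  sign_avg n (fun s => cos (\sum_(a < n) s a * x a + th)) =
  cos th * \prod_(a < n) cos (x a).
Proof.
elim: n th => [|n IH] th /=; first by rewrite !big_ord0 add0r mulr1.
have E (e : R) s : \sum_(a < n.+1) set_sign s n e a * x a + th =
    \sum_(a < n) s a * x a + (e * x n + th).
  rewrite big_ord_recr/= {2}/set_sign eqxx addrA; congr (_ + _ + _).
  by apply: eq_bigr => a _; rewrite /set_sign ltn_eqF.
under eq_sign_avg do rewrite E.
under [X in _ + X]eq_sign_avg do rewrite E.
rewrite !IH big_ord_recr/= mul1r mulN1r (cosD (x n)) (cosD (- x n)) sinN cosN.
by field.
Qed.

End sign_average.

(** * Estimates uniform over all arrays with controlled moments *)

Section uniform_estimates.
Context (disp : measure_display) (Omega : measurableType disp) (R : realType).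
Variable P : probability Omega R.
Local Notation Ex := (mean P).
Local Notation L2 := (L2 P).
Local Notation integ := (integ P).

Lemma Ex_sign_avg n (F : (nat -> R) -> Omega -> R) : (forall s, integ (F s)) ->
  integ (fun x => sign_avg n (fun s => F s x)) /\
  Ex (fun x => sign_avg n (fun s => F s x)) = sign_avg n (fun s => Ex (F s)).
Proof.
elim: n F => [|n IH] F iF //=.
have [i1 e1] := IH (fun s => F (set_sign s n 1)) (fun s => iF _).
have [i2 e2] := IH (fun s => F (set_sign s n (-1))) (fun s => iF _).
have i12 := integD i1 i2.
split; first by under eq_fun do rewrite mulrC; exact: integZ.
by under eq_Ex do rewrite mulrC; rewrite ExZ// ExD// e1 e2 mulrC.
Qed.

Lemma dist_prod_le n (c e : nat -> R) : (forall a, `|c a| <= 1) ->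
  (forall a, `|e a| <= 1) ->
  `|\prod_(a < n) c a - \prod_(a < n) e a| <= \sum_(a < n) `|c a - e a|.
Proof.
move=> c1 e1; elim: n => [|n IH]; first by rewrite !big_ord0 subrr normr0.
rewrite !big_ord_recr/=; set pc := \prod_(_ < _) c _; set pe := \prod_(_ < _) e _.
have pc1 : `|pc| <= 1.
  by rewrite normr_prod; apply: prodr_ile1 => a _; rewrite normr_ge0 c1.
rewrite (_ : pc * _ - _ = (pc - pe) * e n + pc * (c n - e n)); last by ring.
rewrite (le_trans (ler_normD _ _))// !normrM lerD//.
  by rewrite (le_trans _ IH)// ler_piMr.
by rewrite ler_piMl.
Qed.

(** Pointwise, the average over the signs is [cos th] times a product of cosines, and the
    exponential of the bracket is the matching product of Gaussian factors. They are compared factor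
    by factor; the joint law of the [X a] does not matter. *)
Lemma rademacher_bound (X : nat -> Omega -> R) (s2 K eta th : R) n :
  (forall a, L2 (X a)) -> 0 <= K ->
  (forall a, Ex (fun x => X a x ^+ 2) <= s2) ->
  (forall a, Ex (fun x => excess K (X a x) ^+ 2) <= eta) -> (0 < n)%N ->
  `|sign_avg n (fun s => Ex (fun x =>
      cos ((Num.sqrt n%:R)^-1 * (\sum_(a < n) s a * X a x) + th)))
    - cos th * laplace_bracket P X 0 n| <=
  4 * eta + 4 * K ^+ 2 * (Num.sqrt n%:R)^-1 * (1 + s2).
Proof.
move=> XL K0 Xs Xe n0; set r := (Num.sqrt n%:R)^-1.
have nR : 0 < n%:R :> R by rewrite ltr0n.
have r0 : 0 <= r by rewrite invr_ge0 sqrtr_ge0.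
have rE : r ^+ 2 = n%:R^-1 by rewrite exprVn sqr_sqrtr// ltW.
have mX a : mf (X a) := L2_mf (XL a).
have mS s : mf (fun x => r * \sum_(a < n) s a * X a x).
  apply: mfM; first exact: mf_cst.
  by apply: mf_sum => a; apply: mfM; [exact: mf_cst|exact: mX].
have ic s : integ (fun x => cos (r * (\sum_(a < n) s a * X a x) + th)).
  apply: (integ_bdd (M := 1)); last by move=> x; exact: cos_max.
  exact: (mf_comp (u := fun y => cos (y + th)) (@continuous_cos_shift _ th)).
have [i1 <-] := Ex_sign_avg n (fun s => ic s).
have ib : integ (fun x => expR (- (bracket X 0 n x / 2))).
  apply: (integ_bdd (M := 1)).
    apply: (mf_comp (u := fun y : R => expR (- (y / 2)))).
      move=> z; apply: (@continuous_comp _ _ _ (fun z : R => - (z / 2)) expR).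
        by apply: cvgN; apply: cvgMl; exact: cvg_id.
      exact: continuous_expR.
    apply: mfM; [exact: mf_cst|apply: mf_sum => a; apply: mfX; exact: mX].
  move=> x; rewrite ger0_norm ?expR_ge0// expR_le1 oppr_le0 divr_ge0//.
  by rewrite mulr_ge0 ?invr_ge0 ?ler0n// sumr_ge0// => a _; rewrite sqr_ge0.
rewrite /laplace_bracket -ExZ// -ExB//; last exact: integZ.
have iE a : integ (fun x => excess K (X a x) ^+ 2).
  have [] // : L2 (fun x => excess K (X a x)).
  apply: (L2_le _ _ (XL a)) => [|x]; last exact: abs_excess.
  by apply: mf_comp; [exact: continuous_excess|exact: mX].
pose h a x := 2 * (r ^+ 2 * (2 * excess K (X a x) ^+ 2
  + 2 * K ^+ 2 * r * (1 + X a x ^+ 2))).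
have i3 a := integD (integ_cst 1) (XL a).2.
have i4 a := integD (integZ 2 (iE a)) (integZ (2 * K ^+ 2 * r) (i3 a)).
have ih a : integ (h a) by do 2 apply: integZ.
have Exh a : Ex (h a) <= 2 * (r ^+ 2 * (2 * eta + 2 * K ^+ 2 * r * (1 + s2))).
  rewrite /h ExZ; last exact: integZ.
  rewrite (ExZ _ (i4 a)) (ExD (integZ 2 (iE a)) (integZ (2 * K ^+ 2 * r) (i3 a))).
  rewrite (ExZ _ (iE a)) (ExZ _ (i3 a)) (ExD (integ_cst 1) (XL a).2) Ex_cst.
  apply: ler_wpM2l => //; apply: ler_wpM2l; first exact: sqr_ge0.
  apply: lerD; first by rewrite ler_pM2l.
  apply: ler_wpM2l; last by rewrite lerD2l.
  by rewrite mulr_ge0// mulr_ge0// sqr_ge0.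
apply: (@le_trans _ _ (Ex (fun x => \sum_(a < n) h a x))).
  apply: abs_Ex_le; [|exact: integ_sum|].
    by apply: integ_mf (integB i1 (integZ _ ib)).
  move=> x; rewrite (@eq_sign_avg _ n _ (fun s =>
    cos (\sum_(a < n) s a * (r * X a x) + th))); last first.
    move=> s _; rewrite mulr_sumr; congr (cos (_ + th)).
    by apply: eq_bigr => a _; rewrite mulrCA.
  rewrite (sign_avg_cos _ (fun a => r * X a x)) -mulrBr normrM.
  rewrite (le_trans (ler_piMl _ (cos_max _)))//.
  have -> : expR (- (bracket X 0 n x / 2)) =
      \prod_(a < n) expR (- ((r * X a x) ^+ 2 / 2)).
    rewrite -expR_sum sumrN; congr (expR (- _)).
    rewrite /bracket mulrAC mulr_sumr; apply: eq_bigr => a _.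
    by rewrite exprMn rE; ring.
  apply: (le_trans (dist_prod_le n (fun a => cos_max (r * X a x))
    (e := fun a => expR (- ((r * X a x) ^+ 2 / 2))) _)).
    move=> a; rewrite ger0_norm ?expR_ge0// expR_le1 oppr_le0 divr_ge0//.
    exact: sqr_ge0.
  apply: ler_sum => a _; apply: (le_trans (cos_expR _)).
  by rewrite /h ler_pM2l// sqr_unit_cut_le.
rewrite Ex_sum// (@le_trans _ _ (\sum_(a < n) 2 * (r ^+ 2 * (2 * eta + 2 * K ^+ 2 * r * (1 + s2)))))//.
  by apply: ler_sum.
rewrite sumr_const card_ord -mulr_natl rE le_eqVlt; apply/orP; left; apply/eqP.
by field; rewrite gt_eqF.
Qed.

(** [Kf] is a modulus of uniform integrability of the square: the truncation level to use for each
    tolerance. Sharing it makes the thresholds independent of the array. *)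
Definition tail_controlled (Kf : R -> R) (X : Omega -> R) :=
  forall eta, 0 < eta -> Ex (fun x => excess (Kf eta) (X x) ^+ 2) <= eta.

Lemma inv_sqrt_small (de : R) : 0 < de -> exists n0 : nat,
  forall n, (n0 <= n)%N -> (0 < n)%N /\ (Num.sqrt n%:R)^-1 <= de.
Proof.
move=> de0; exists (Num.trunc (de^-1 ^+ 2)).+1 => n n0n.
have nR : de^-1 ^+ 2 < n%:R :> R.
  by rewrite (lt_le_trans (truncnS_gt _))// ler_nat.
have n0 : (0 < n)%N by exact: leq_trans n0n.
split => //; rewrite -[leRHS]invrK lef_pV2 ?posrE ?invr_gt0 ?sqrtr_gt0 ?ltr0n//.
have di0 : 0 <= de^-1 by rewrite invr_ge0 ltW.
by rewrite -(ger0_norm di0) -sqrtr_sqr ler_sqrt ?ler0n// ltW.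
Qed.

Lemma natr_ge (x : R) : exists n0 : nat, forall n, (n0 <= n)%N -> x <= n%:R.
Proof.
exists (Num.trunc x).+1 => n n0n.
by rewrite ltW// (lt_le_trans (truncnS_gt _))// ler_nat.
Qed.

Lemma rademacher_uniform (s2 : R) (Kf : R -> R) (eps : R) :
  0 <= s2 -> (forall eta, 0 < eta -> 0 <= Kf eta) -> 0 < eps ->
  exists n0 : nat, forall (X : nat -> Omega -> R) (th : R) (n : nat),
  (forall a, L2 (X a)) -> (forall a, Ex (fun x => X a x ^+ 2) <= s2) ->
  (forall a, tail_controlled Kf (X a)) -> (n0 <= n)%N ->
  `|sign_avg n (fun s => Ex (fun x =>
      cos ((Num.sqrt n%:R)^-1 * (\sum_(a < n) s a * X a x) + th)))
    - cos th * laplace_bracket P X 0 n| <= eps.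
Proof.
move=> s20 K0 e0; have eta0 : 0 < eps / 8 by rewrite divr_gt0.
set K := Kf (eps / 8); have {}K0 : 0 <= K by exact: K0.
have c0 : 0 < 8 * K ^+ 2 * (1 + s2) + 1.
  by rewrite ltr_wpDl// mulr_ge0 ?addr_ge0// mulr_ge0// sqr_ge0.
have [n0 Hn0] := inv_sqrt_small (divr_gt0 e0 c0).
exists n0 => X th n XL Xs Xt /Hn0[n_gt0 rn].
apply: (le_trans (rademacher_bound th XL K0 Xs (fun a => Xt a _ eta0) n_gt0)).
move: rn; rewrite ler_pdivlMr// => rn.
have := sqr_ge0 K; have : 0 <= (Num.sqrt n%:R)^-1 :> R by rewrite invr_ge0 sqrtr_ge0.
set r := (Num.sqrt _)^-1 in rn *; lra.
Qed.

(** [p], [C] and [n0] depend only on [s2], [Kf] and [eps]. The number of blocks is fixed before the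
    length, since [C] depends on it. The gap is kept in the bound, as it becomes small only when the
    Laplace transforms converge. *)
Lemma clt_uniform (s2 : R) (Kf : R -> R) (eps : R) :
  0 <= s2 -> (forall eta, 0 < eta -> 0 <= Kf eta) -> 0 < eps ->
  exists (p : nat) (C : R) (n0 : nat), 0 <= C /\
  forall A (X : nat -> Omega -> R) (th : R) (n : nat), mds P A X ->
  (forall a, Ex (fun x => X a x ^+ 2) <= s2) ->
  (forall a, tail_controlled Kf (X a)) ->
  (forall k m, laplace_bracket P X k m = laplace_bracket P X 0 m) ->
  (n0 <= n)%N ->
  `|Ex (fun x => cos ((Num.sqrt n%:R)^-1 * (\sum_(a < n) X a x) + th))
    - cos th * laplace_bracket P X 0 (n %/ p.+1)| <=
  eps + C * (laplace_bracket P X 0 (n %/ p.+1)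
             - laplace_bracket P X 0 (p.+1 * (n %/ p.+1))).
Proof.
(* The total error is 13 eta + 8 e: eta appears 8 times in [block_err], once beside it and 4 times
   through [bracket_stable]; eight other terms are at most e each. *)
move=> s20 K0 e0; set eta := eps / 26; set e := eps / 16.
have eta0 : 0 < eta by rewrite divr_gt0.
have e'0 : 0 < e by rewrite divr_gt0.
set K := Kf eta; have {}K0 : 0 <= K by exact: K0.
have K20 := sqr_ge0 K; have E0 := expR_gt0 (K ^+ 2).
pose de := e / (K ^+ 2 + 1); have de0 : 0 < de by rewrite divr_gt0// ltr_wpDl.
pose d2 := e / (2 * expR (K ^+ 2)); have d20 : 0 < d2 by rewrite divr_gt0// mulr_gt0.
have [p1 Hp1] := natr_ge ((K ^+ 2 * s2 / 2 + K ^+ 2 * (s2 / de) + 2 * s2 / e) / e).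
pose p := p1.+1; have := Hp1 p (leqnSn _); rewrite ler_pdivrMr// => Hp {Hp1}.
have p0 : (0 < p)%N by []. have pR : 0 < p%:R :> R by rewrite ltr0n.
have a1 : 0 <= K ^+ 2 * s2 / 2 by rewrite divr_ge0// mulr_ge0.
have a2 : 0 <= K ^+ 2 * (s2 / de) by rewrite mulr_ge0// divr_ge0// ltW.
have a3 : 0 <= 2 * s2 / e by rewrite divr_ge0 ?mulr_ge0// ltW.
have c0 : 0 < 6 * K ^+ 2 * (1 + s2) + 1.
  by rewrite ltr_wpDl// mulr_ge0 ?addr_ge0// mulr_ge0// sqr_ge0.
have [m0 Hm0] := inv_sqrt_small (divr_gt0 e'0 c0).
have [n1 Hn1] := natr_ge (2 * s2 / e * p%:R / e).
exists p, ((2 * p%:R)^-1 * (4 * expR (K ^+ 2)) * (2 * p.+1%:R ^+ 2 / d2)).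
exists (maxn (p.+1 * m0.+1) n1); split.
  apply: mulr_ge0; [apply: mulr_ge0|apply: divr_ge0].
  - by rewrite invr_ge0 mulr_ge0// ltW.
  - by rewrite mulr_ge0// ltW.
  - by rewrite mulr_ge0// sqr_ge0.
  - exact: ltW.
move=> A X th n XA Xs Xt stat; rewrite geq_max => /andP[mn /Hn1 {}Hn1].
set m := (n %/ p.+1)%N.
have m0m : (m0.+1 <= m)%N by rewrite leq_divRL// mulnC.
have m_gt0 : (0 < m)%N by exact: leq_trans m0m.
have nm1 : (p.+1 * m <= n)%N by rewrite mulnC leq_trunc_div.
have nm2 : (n < p.+1 * m.+1)%N by rewrite mulnC ltn_ceil.
have n_gt0 : 0 < n%:R :> R.
  by rewrite ltr0n (leq_trans _ nm1)// muln_gt0.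
apply: (le_trans (clt_bound XA K0 Xs (fun a => Xt a _ eta0) stat m_gt0 p0 th
  de0 d20 e'0 nm1 nm2)).
set L0 := laplace_bracket P X 0 m; set L1 := laplace_bracket P X 0 (p.+1 * m).
have pm : (0 < p * m)%N by rewrite muln_gt0 p0.
have [|_ rm] := Hm0 (p * m)%N.
  by rewrite (leq_trans (leqnSn _))// (leq_trans m0m)// leq_pmull.
rewrite /block_err -natrM; set r := (Num.sqrt _)^-1 in rm *.
have r0 : 0 <= r by rewrite invr_ge0 sqrtr_ge0.
have mR : 0 < m%:R :> R by rewrite ltr0n.
have rE : r ^+ 2 * m%:R = p%:R^-1.
  rewrite exprVn sqr_sqrtr ?ler0n// natrM invfM mulfVK// gt_eqF//.
rewrite rE.
have b1 : 6 * K ^+ 2 * r * (1 + s2) <= e.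
  by move: rm; rewrite ler_pdivlMr//; lra.
have b2 : K ^+ 2 * de <= e.
  rewrite /de mulrCA ler_piMr ?(ltW e'0)// ler_pdivrMr; last by rewrite ltr_wpDl.
  by rewrite mul1r lerDl.
have b3 : K ^+ 2 * (p%:R^-1 * s2 / de) <= e.
  rewrite (_ : _ * _ = K ^+ 2 * (s2 / de) / p%:R); last by ring.
  by rewrite ler_pdivrMr//; lra.
have b4 : K ^+ 2 * s2 / (2 * p%:R) <= e.
  rewrite invfM mulrA ler_pdivrMr//; lra.
have b5 : (2 * p%:R)^-1 * (4 * expR (K ^+ 2) * (p%:R * d2)) = e.
  by rewrite /d2; field; rewrite !gt_eqF.
have b6 : (2 * p%:R)^-1 * (p%:R * (8 * eta)) = 4 * eta.
  by field; rewrite gt_eqF.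
have b7 : 2 * s2 * p.+1%:R^-1 / e <= e.
  rewrite (_ : _ / e = 2 * s2 / e / p.+1%:R); last by ring.
  rewrite ler_pdivrMr ?ltr0n// -natr1; lra.
have b8 : 2 * s2 * (p%:R / n%:R) / e <= e.
  rewrite (_ : _ / e = 2 * s2 / e * p%:R / n%:R); last by ring.
  by rewrite ler_pdivrMr//; move: Hn1; rewrite ler_pdivrMr// (mulrC _ e).
have c1 : (2 * p%:R)^-1 * (4 * expR (K ^+ 2) * (2 * p.+1%:R ^+ 2 * (L0 - L1) / d2))
  = (2 * p%:R)^-1 * (4 * expR (K ^+ 2)) * (2 * p.+1%:R ^+ 2 / d2) * (L0 - L1).
  by ring.
rewrite (mulrDr (2 * p%:R)^-1) (mulrDr (4 * expR (K ^+ 2))) (mulrDr (2 * p%:R)^-1).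
rewrite b5 b6 c1 (mulrDr (2 * s2)) mulrDl (mulrDr (K ^+ 2)).
have -> : eps = 13 * eta + 8 * e by rewrite /eta /e; field.
have sum_le (t1 t2 t3 t4 t5 t6 T h z : R) : t1 <= z -> t2 <= z -> t3 <= z ->
    t4 <= z -> t5 <= z -> t6 <= z ->
    8 * h + t1 + (t2 + t3) + h + t4 + (z + T + 4 * h) + (z + (t5 + t6)) <=
    13 * h + 8 * z + T by lra.
exact: sum_le.
Qed.

End uniform_estimates.

(** * Multiple filtrations *)

Section sub_sigma_algebras.
Context (disp : measure_display) (Omega : measurableType disp) (R : realType).
Variable P : probability Omega R.
Local Notation Ex := (mean P).
Local Notation L2 := (L2 P).
Local Notation integ := (integ P).

Lemma EFin_Ex g : integ g -> (Ex g)%:E = (\int[P]_x (g x)%:E)%E.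
Proof. by move=> gi; rewrite /mean /Rintegral fineK//; exact: integrable_fin_num. Qed.

(** Dominated convergence in the form needed to remove a truncation: at each point the sequence is
    eventually 0. *)
Lemma Ex_vanish (g : nat -> Omega -> R) (h : Omega -> R) (eps : R) :
  (forall n, mf (g n)) -> integ h -> (forall n x, `|g n x| <= h x) ->
  (forall x, exists N : nat, forall n, (N <= n)%N -> g n x = 0) -> 0 < eps ->
  exists N : nat, forall n, (N <= n)%N -> `|Ex (g n)| <= eps.
Proof.
move=> mg hi gh g0 e0.
have gi n : integ (g n) by exact: integ_le (mg n) (gh n) hi.
have [] := @dominated_convergence _ _ R P setT measurableT
  (fun n => EFin \o g n) (cst 0%E) (EFin \o h).
- by move=> n; apply/measurable_EFinP; exact: mg.
- exact: measurable_cst.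
- apply: aeW => x _; have [N gN] := g0 x.
  apply: cvg_near_cst; exists N => // n /= Nn; rewrite gN//.
- exact: hi.
- by apply: aeW => x n _; rewrite /= lee_fin.
move=> _ _; rewrite integral0.
under eq_fun do rewrite /= -EFin_Ex//.
move=> /fine_cvgP[_ /cvgrPdist_le /(_ _ e0)[N _ HN]].
by exists N => n Nn; have := HN n Nn; rewrite /= sub0r normrN.
Qed.

Lemma Ex_indic (A : set Omega) (f : Omega -> R) : measurable A -> integ f ->
  Ex (fun x => \1_A x * f x) = fine (\int[P]_(x in A) (f x)%:E).
Proof.
move=> mA fi; rewrite integral_mkcond /mean /Rintegral; congr fine.
apply: eq_integral => x _; rewrite patchE indicE.
by case: ifP => xA; rewrite ?mul1r ?mul0r.
Qed.

(** The sum counts the positive integers up to [y], so it is the integer part of [y]. *)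
Lemma staircase (K : nat) (y : R) : 0 <= y -> y <= K%:R ->
  `|y - \sum_(k < K) (k.+1%:R <= y)%R%:R| <= 1.
Proof.
move=> y0; have full n : n%:R <= y -> \sum_(k < n) (k.+1%:R <= y)%R%:R = n%:R :> R.
  move=> ny; rewrite (eq_bigr (fun=> 1)).
    by rewrite sumr_const card_ord.
  by move=> k _; rewrite (le_trans _ ny)// ler_nat.
elim: K => [yK|K IH yK].
  by rewrite big_ord0 subr0 ger0_norm// (le_trans yK).
have [Ky|yK1] := leP K.+1%:R y.
  rewrite full// (_ : y = K.+1%:R) ?subrr ?normr0//.
  by apply/eqP; rewrite eq_le yK.
rewrite big_ord_recr/= (lt_geF yK1) addr0; have [Ky|/ltW/IH//] := leP K%:R y.
by rewrite full// ger0_norm ?subr_ge0//; move: yK; rewrite -natr1; lra.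
Qed.

Section orthogonality.
Variables (G : set_system Omega) (f : Omega -> R).
Hypothesis HG : sub_sigma_algebra_of G.
Hypothesis fi : integ f.
Hypothesis f0 : forall A, G A -> Ex (fun x => \1_A x * f x) = 0.

Lemma sub_sigma_measurable (g : Omega -> R) (B : set R) :
  measurable_fun [set: g_sigma_algebraType G] (g : g_sigma_algebraType G -> R) ->
  measurable B -> G (g @^-1` B).
Proof.
move=> mg mB; have := mg measurableT B mB; rewrite setTI /measurable/=.
by rewrite sigma_algebra_id//; exact: HG.1.
Qed.

Lemma sub_sigma_mf (g : Omega -> R) :
  measurable_fun [set: g_sigma_algebraType G] (g : g_sigma_algebraType G -> R) ->
  mf g.
Proof.
move=> mg _ B mB; rewrite setTI; apply: HG.2.
exact: sub_sigma_measurable.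
Qed.

(* A bounded [G]-measurable function is uniformly approximated by staircase
   functions whose level sets lie in [G]. *)
Lemma sub_sigma_orth_bounded (g : Omega -> R) (N : nat) :
  measurable_fun [set: g_sigma_algebraType G] (g : g_sigma_algebraType G -> R) ->
  (forall x, `|g x| <= N%:R) -> Ex (fun x => g x * f x) = 0.
Proof.
move=> mg gN; have mg' := sub_sigma_mf mg.
suff H n : (0 < n)%N -> `|Ex (fun x => g x * f x)| <= n%:R^-1 * Ex (fun x => `|f x|).
  apply/eqP; rewrite -normr_le0; apply/ler_addgt0Pr => e e0; rewrite add0r.
  have [n0 Hn0] := natr_ge (Ex (fun x => `|f x|) / e).
  apply: (le_trans (H n0.+1 isT)); rewrite ler_pdivrMl ?ltr0n//.
  by rewrite -ler_pdivrMr// Hn0.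
move=> n0; have nR : 0 < n%:R :> R by rewrite ltr0n.
(* The function n (g + N) takes its values in [0, 2 n N], so this many unit steps suffice. *)
pose K := (2 * n * N)%N.
pose A (k : nat) := g @^-1` [set y | k.+1%:R <= n%:R * (y + N%:R)].
have GA k : G (A k).
  apply: sub_sigma_measurable => //.
  rewrite (_ : [set y | _] = `[k.+1%:R / n%:R - N%:R, +oo[%classic)//.
  apply/seteqP; split => y /=; rewrite in_itv/= andbT lerBlDr ler_pdivrMr//;
    by rewrite mulrC.
pose Gn x : R := n%:R^-1 * (\sum_(k < K) \1_(A k) x) - N%:R.
have mA k : measurable (A k) by exact: HG.2.
have Gn_g x : `|g x - Gn x| <= n%:R^-1.
  have := gN x; rewrite ler_norml => /andP[g1 g2].
  have y0 : 0 <= n%:R * (g x + N%:R) by apply: mulr_ge0; [exact: ltW|lra].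
  have yK : n%:R * (g x + N%:R) <= K%:R.
    rewrite /K (mulnC 2) -mulnA natrM ler_pM2l// natrM; lra.
  have := staircase y0 yK.
  have -> : \sum_(k < K) (k.+1%:R <= n%:R * (g x + N%:R))%R%:R =
      \sum_(k < K) \1_(A k) x :> R.
    apply: eq_bigr => k _; rewrite indicE; congr (nat_of_bool _)%:R.
    by apply/idP/idP => [h|]; rewrite ?inE// /A/= mem_setE.
  rewrite -(ler_pM2l (_ : 0 < n%:R^-1 :> R)) ?invr_gt0// mulr1.
  rewrite -{1}(ger0_norm (_ : 0 <= n%:R^-1 :> R)) ?invr_ge0 ?ler0n// -normrM.
  rewrite mulrBr mulKf ?gt_eqF// => /(le_trans _); apply.
  by rewrite le_eqVlt; apply/orP; left; apply/eqP; congr (`|_|); rewrite /Gn; ring.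
have iA k : integ (fun x => \1_(A k) x * f x).
  apply: (integ_mul_bdd (M := 1)) => //; first exact: measurable_indic.
  by move=> x; rewrite indicE; case: (_ \in _); rewrite ?normr1 ?normr0.
have ExT : Ex f = 0.
  have [G0 GC _] := HG.1; have := GC _ G0; rewrite setD0 => /f0 <-.
  by apply: eq_Ex => x; rewrite indicT mul1r.
have iGn : integ (fun x => Gn x * f x).
  rewrite (_ : (fun _ => _) = (fun x => n%:R^-1 * (\sum_(k < K) \1_(A k) x * f x)
    - N%:R * f x)); last by apply/funext => x; rewrite /Gn -mulr_suml; ring.
  by apply: integB; apply: integZ => //; apply: integ_sum => k _; exact: iA.
have ExGn : Ex (fun x => Gn x * f x) = 0.
  rewrite (eq_Ex _ (g := fun x => n%:R^-1 * (\sum_(k < K) \1_(A k) x * f x)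
    - N%:R * f x)); last by move=> x; rewrite /Gn -mulr_suml; ring.
  have isum : integ (fun x => \sum_(k < K) \1_(A k) x * f x).
    by apply: integ_sum => k _; exact: iA.
  rewrite ExB; [|exact: integZ|exact: integZ].
  rewrite !ExZ// ExT mulr0 subr0 Ex_sum => [|k _]; last exact: iA.
  by rewrite big1 ?mulr0// => k _; exact: f0.
have igf : integ (fun x => g x * f x) by exact: (integ_mul_bdd (M := N%:R)).
rewrite -[Ex _]subr0 -ExGn -ExB// -ExZ; last exact: integ_abs.
apply: abs_Ex_le.
- by apply: integ_mf (integB igf iGn).
- by apply: integZ; exact: integ_abs.
- by move=> x; rewrite -mulrBl normrM ler_wpM2r.
Qed.

(** Clip [g] at level n and let n grow: the products are dominated by |g f|, and at each point the
    clipping eventually has no effect. *)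
Lemma sub_sigma_orth (g : Omega -> R) :
  measurable_fun [set: g_sigma_algebraType G] (g : g_sigma_algebraType G -> R) ->
  integ (fun x => g x * f x) -> Ex (fun x => g x * f x) = 0.
Proof.
move=> mg igf; have mg' := sub_sigma_mf mg.
have mcl n : mf (fun x => clip n%:R (g x)).
  by apply: mf_comp mg'; exact: continuous_clip.
have cl0 n : Ex (fun x => clip n%:R (g x) * f x) = 0.
  apply: (sub_sigma_orth_bounded (N := n)).
    exact: (@mf_comp _ (g_sigma_algebraType G) _ _ _ (@continuous_clip _ _) mg).
  by move=> x; exact: abs_clip.
have icl n : integ (fun x => clip n%:R (g x) * f x).
  by apply: (integ_mul_bdd (M := n%:R)) => // x; exact: abs_clip.
apply/eqP; rewrite -normr_le0; apply/ler_addgt0Pr => e e0; rewrite add0r.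
have [] := @Ex_vanish (fun n x => g x * f x - clip n%:R (g x) * f x)
   (fun x => `|g x * f x|) e _ _ _ _ e0.
- by move=> n; apply: integ_mf (integB igf (icl n)).
- exact: integ_abs.
- by move=> n x; rewrite -mulrBl !normrM ler_wpM2r// abs_excess.
- move=> x; have [N HN] := natr_ge `|g x|; exists N => n Nn.
  by rewrite -mulrBl -/(excess _ _) excess_eq0 ?mul0r// HN.
by move=> N /(_ N (leqnn N)); rewrite ExB// cl0 subr0.
Qed.

End orthogonality.

Section automorphisms.
Variable S : Omega -> Omega.
Hypothesis HS : automorphism P S.

Lemma mf_automorphism (g : Omega -> R) : mf g -> mf (fun x => g (S x)).
Proof. by move=> mg; apply: measurableT_comp mg _; exact: automorphism_measurable HS. Qed.

Let S_mixin := isMeasurableFun.Build _ _ _ _ _ (automorphism_measurable HS).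
Let S_pack : {mfun Omega >-> Omega} := HB.pack S S_mixin.

Let PE (A : set Omega) : measurable A -> A `<=` setT -> pushforward P S_pack A = P A.
Proof. by move=> mA _; exact: automorphism_preserving HS _ mA. Qed.

Lemma integ_automorphism g : integ g -> integ (fun x => g (S x)).
Proof.
move=> gi; have mg := integ_mf gi; apply/integrableP; split.
  by apply/measurable_EFinP; exact: mf_automorphism.
have mE : measurable_fun setT (EFin \o g) by exact/measurable_EFinP.
have /integrableP[_] := gi; apply: le_lt_trans.
rewrite -[X in (_ <= X)%E](eq_measure_integral _ PE).
rewrite (ge0_integral_pushforward (automorphism_measurable HS))//.
by apply: measurableT_comp.
Qed.

Lemma Ex_automorphism g : integ g -> Ex (fun x => g (S x)) = Ex g.
Proof.
move=> gi; have mg := integ_mf gi; rewrite /mean /Rintegral; congr fine.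
rewrite -[in RHS](eq_measure_integral _ PE).
rewrite (integral_pushforward (automorphism_measurable HS))//.
  exact/measurable_EFinP.
by rewrite preimage_setT; exact: integ_automorphism.
Qed.

Lemma L2_automorphism g : L2 g -> L2 (fun x => g (S x)).
Proof.
move=> [mg gi]; split; first exact: mf_automorphism.
exact: (integ_automorphism gi).
Qed.

Lemma ae_automorphism (Q : Omega -> Prop) :
  {ae P, forall x, Q x} -> {ae P, forall x, Q (S x)}.
Proof.
move=> [N [mN PN QN]]; exists (S @^-1` N); split.
- by rewrite -[_ @^-1` _]setTI; exact: (automorphism_measurable HS).
- by rewrite (automorphism_preserving HS).
- by move=> x nQ; exact: QN.
Qed.

End automorphisms.
End sub_sigma_algebras.

(** * The action on the filtrations and on martingale differences *)

Section lattice_action.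
Context (disp : measure_display) (Omega : measurableType disp) (R : realType).
Variable P : probability Omega R.
Local Notation Ex := (mean P).
Local Notation L2 := (L2 P).
Local Notation integ := (integ P).
Variables (d : nat) (T : 'rV[int]_d -> Omega -> Omega).
Hypothesis HT : Zd_action P T.
Implicit Types (u v : 'rV[int]_d) (g : Omega -> R).

Lemma action_comp i j x : T i (T j x) = T (i + j) x.
Proof. by have /(congr1 (fun h => h x)) := Zd_actionD HT i j. Qed.

Lemma action0 x : T 0 x = x.
Proof.
have := action_comp 0 0 x; rewrite addr0.
exact: (bij_inj (automorphism_bij (Zd_action_automorphism HT 0))).
Qed.

Lemma actionK v x : T v (T (- v) x) = x.
Proof. by rewrite action_comp subrr action0. Qed.

Lemma actionNK v x : T (- v) (T v x) = x.
Proof. by rewrite action_comp addNr action0. Qed.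

Lemma transport_comp (S1 S2 : Omega -> Omega) (G : set_system Omega) :
  transport S1 (transport S2 G) = transport (S1 \o S2) G.
Proof.
apply/seteqP; split => A /=.
  by move=> [_ [B GB <-] <-]; exists B => //; rewrite image_comp.
by move=> [B GB <-]; exists (S2 @` B); [exists B|rewrite image_comp].
Qed.

Lemma transport_id (S : Omega -> Omega) (G : set_system Omega) : S =1 id ->
  transport S G = G.
Proof.
move=> /funext ->; apply/seteqP; split => A /=.
  by move=> [B GB <-]; rewrite image_id.
by move=> GA; exists A => //; rewrite image_id.
Qed.

Variable F : 'I_d -> int -> set_system Omega.
Hypothesis HF : multiple_filtration T F.

(** The vectors acting on every filtration by a shift of the index form a subgroup of Z^d. It
    contains the canonical basis, hence everything. *)
Let shifts v := forall q i, transport (T (- v)) (F q i) = F q (i + v 0 q).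

Let shiftsD u v : shifts u -> shifts v -> shifts (u + v).
Proof.
move=> su sv q i; rewrite opprD mxE (addrC (u 0 q)) addrA -su -sv transport_comp.
by congr transport; apply/funext => x; rewrite /= action_comp.
Qed.

Let shiftsN v : shifts v -> shifts (- v).
Proof.
move=> sv q i; have := sv q (i - v 0 q); rewrite subrK => <-.
rewrite transport_comp mxE transport_id// => x /=.
by rewrite opprK actionK.
Qed.

Let shifts0 : shifts 0.
Proof.
by move=> q i; rewrite mxE addr0 oppr0 transport_id// => x; rewrite action0.
Qed.

Let shifts_delta j : shifts (delta_mx 0 j).
Proof.
move=> q i; rewrite mxE eqxx/=; have [->|qj] := eqVneq q j.
  exact: (multiple_filtration_shift HF).
(* The invariance is given for [T (delta_mx 0 j)]; writing [F q i] as its own transport yields it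
   for the inverse map. *)
rewrite addr0 -[in LHS](multiple_filtration_invariant HF i (q := q) (q' := j)) 1?eq_sym//.
by rewrite transport_comp transport_id// => x /=; rewrite actionNK.
Qed.

Lemma transport_action v q i : transport (T (- v)) (F q i) = F q (i + v 0 q).
Proof.
suff : shifts v by exact.
have shiftsM (n : nat) u : shifts u -> shifts (u *+ n).
  by move=> su; elim: n => [//|n IH]; rewrite mulrS; exact: shiftsD.
rewrite (row_sum_delta v); elim/big_ind : _ => //.
move=> j _; case: (v 0 j) => n.
  by rewrite -[Posz n]natz scaler_nat; exact: shiftsM.
by rewrite NegzE scaleNr -natz scaler_nat; apply: shiftsN; exact: shiftsM.
Qed.

Lemma multiple_filtrationS q i : F q i `<=` F q (i + 1).
Proof.
have := multiple_filtration_shift HF q i => <-.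
exact: (multiple_filtration_incr HF).
Qed.

(** Measurability up to a null set, because [f] is a difference of conditional expectations only
    almost surely. [g_sigma_algebraType] turns [F q i] into a measurable structure on [Omega]. *)
Definition adapted (q : 'I_d) (i : int) (g : Omega -> R) :=
  mf g /\ exists g' : Omega -> R,
    measurable_fun [set: g_sigma_algebraType (F q i)]
      (g' : g_sigma_algebraType (F q i) -> R) /\
    {ae P, forall x, g x = g' x}.

(** The preimage of a set by [T v] is its image by [T (- v)], whose effect on [F q i] is
    [transport_action]. *)
Lemma adapted_action q i v g : adapted q i g ->
  adapted q (i + v 0 q) (fun x => g (T v x)).
Proof.
have Tv := Zd_action_automorphism HT v.
move=> [mg [g' [mg' gg']]]; split; first exact: (mf_automorphism Tv).
exists (fun x => g' (T v x)); split; last exact: (ae_automorphism Tv gg').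
move=> _ B mB; rewrite setTI; apply: sub_sigma_algebra.
have GB : F q i (g' @^-1` B).
  exact: (sub_sigma_measurable (multiple_filtration_sub HF q i) mg' mB).
rewrite -transport_action; exists (g' @^-1` B) => //.
apply/seteqP; split => x /=; first by move=> [y By <-]; rewrite actionK.
by move=> Bx; exists (T v x) => //; rewrite actionNK.
Qed.

Lemma adapted_le q i (n : nat) g : adapted q i g -> adapted q (i + n%:Z) g.
Proof.
move=> Ag; elim: n => [|n [mg [g' [mg' gg']]]]; first by rewrite addr0.
split => //; exists g'; split => // _ B mB; rewrite setTI; apply: sub_sigma_algebra.
rewrite -addn1 PoszD addrA; apply: multiple_filtrationS.
exact: (sub_sigma_measurable (multiple_filtration_sub HF q _) mg' mB).
Qed.

Lemma filtration_adapted q i : filtration (fun k : nat => adapted q (i + k%:Z)).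
Proof.
split.
- by move=> k g [].
- move=> k c; split; first exact: mf_cst.
  by exists (fun=> c); split; [exact: measurable_cst|exact: aeW].
- move=> k g h [mg [g' [mg' gg']]] [mh [h' [mh' hh']]]; split; first exact: mfD.
  exists (fun x => g' x + h' x); split.
    exact: (@mfD _ (g_sigma_algebraType (F q (i + k%:Z))) _ g' h').
  by apply: filterS2 gg' hh' => x -> ->.
- move=> k g h [mg [g' [mg' gg']]] [mh [h' [mh' hh']]]; split; first exact: mfM.
  exists (fun x => g' x * h' x); split.
    exact: (@mfM _ (g_sigma_algebraType (F q (i + k%:Z))) _ g' h').
  by apply: filterS2 gg' hh' => x -> ->.
- move=> k g u cu [mg [g' [mg' gg']]]; split; first exact: mf_comp.
  exists (fun x => u (g' x)); split.
    exact: (@mf_comp _ (g_sigma_algebraType (F q (i + k%:Z))) _ u g').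
  by apply: filterS gg' => x ->.
- by move=> k g Ag; rewrite -addn1 PoszD addrA; exact: (adapted_le 1).
Qed.

(** The martingale difference property in the direction [q] alone. Unlike the property in all
    directions at once, it is inherited by sums along the other directions. *)
Record mdq (q : 'I_d) (g : Omega -> R) : Prop := {
  mdq_L2 : L2 g;
  mdq_adapted : adapted q 0 g;
  mdq_orth : forall G, adapted q (- 1) G -> L2 G -> Ex (fun x => G x * g x) = 0 }.

(** A translation with no component along [q] preserves each [F q i]; measure preservation moves it
    from [g] to the test function. *)
Lemma mdq_action q v g : v 0 q = 0 -> mdq q g -> mdq q (fun x => g (T v x)).
Proof.
move=> v0 [gL Ag Og]; have Tv := Zd_action_automorphism HT.
split; first exact: (L2_automorphism (Tv v)).
  by have := adapted_action v Ag; rewrite v0 addr0.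
move=> G AG GL.
have GL' := L2_automorphism (Tv (- v)) GL.
rewrite -(Og (fun x => G (T (- v) x))) //; last first.
  by have := adapted_action (- v) AG; rewrite mxE v0 oppr0 addr0.
rewrite -(Ex_automorphism (Tv v) (L2_mul GL' gL)).
by apply: eq_Ex => x; rewrite actionNK.
Qed.

Lemma mdqZ q c g : mdq q g -> mdq q (fun x => c * g x).
Proof.
move=> [gL Ag Og]; have FA := filtration_adapted q 0.
split; first exact: L2Z.
  by have := filtrationZ FA (k := 0) c; rewrite addr0; apply.
move=> G AG GL; rewrite (eq_Ex _ (g := fun x => c * (G x * g x))).
  by rewrite ExZ ?Og ?mulr0//; exact: L2_mul.
by move=> x; ring.
Qed.

Lemma mdq_sum q n (g : nat -> Omega -> R) : (forall a, mdq q (g a)) ->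
  mdq q (fun x => \sum_(a < n) g a x).
Proof.
move=> gq; have FA := filtration_adapted q 0; split.
- by apply: L2_sum => a; exact: mdq_L2.
- have := filtration_sum_ord FA (k := 0) (n := n) (F := g); rewrite addr0.
  by apply => a _; exact: mdq_adapted.
- move=> G AG GL; under eq_Ex do rewrite mulr_sumr.
  rewrite Ex_sum => [|a _]; last exact: L2_mul GL (mdq_L2 (gq a)).
  by rewrite big1// => a _; exact: (mdq_orth (gq a)).
Qed.

Definition step (q : 'I_d) (n : nat) : 'rV[int]_d := delta_mx 0 q *+ n.

Lemma stepE q n j : step q n 0 j = if j == q then n%:Z else 0.
Proof.
rewrite /step mulmxnE mxE eqxx/= eq_sym; case: eqVneq => _; last by rewrite mul0rn.
by rewrite mulr1n natz.
Qed.

(** The step is a + 1 because blocks start at index 1: the translate belongs to level a + 1 of the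
    filtration, and translating the past at level a back by a + 1 steps gives level -1. *)
Lemma mds_mdq q g : mdq q g ->
  mds P (fun k : nat => adapted q k%:Z) (fun a x => g (T (step q a.+1) x)).
Proof.
move=> gq; have Tv := Zd_action_automorphism HT.
split.
- have := filtration_adapted q 0.
  by congr filtration; apply/funext => k; rewrite add0r.
- by move=> a; exact: (L2_automorphism (Tv _) (mdq_L2 gq)).
- move=> a; have := adapted_action (step q a.+1) (mdq_adapted gq).
  by rewrite stepE eqxx add0r.
- move=> a G AG GL; set v := step q a.+1.
  have GL' := L2_automorphism (Tv (- v)) GL.
  rewrite -(mdq_orth gq (G := fun x => G (T (- v) x))) //; last first.
    have := adapted_action (- v) AG; rewrite mxE stepE eqxx.
    by rewrite -addn1 PoszD opprD addrA subrr add0r.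
  rewrite -(Ex_automorphism (Tv v) (L2_mul GL' (mdq_L2 gq))).
  by apply: eq_Ex => x; rewrite actionNK.
Qed.

Lemma Ex_step_sqr q g a : L2 g ->
  Ex (fun x => g (T (step q a) x) ^+ 2) = Ex (fun x => g x ^+ 2).
Proof.
move=> gL.
exact: (Ex_automorphism (Zd_action_automorphism HT (step q a)) gL.2).
Qed.

Lemma tail_controlled_action Kf v g : L2 g -> (forall eta, 0 < eta -> 0 <= Kf eta) ->
  tail_controlled P Kf g -> tail_controlled P Kf (fun x => g (T v x)).
Proof.
move=> gL K0 tg eta e0; rewrite (le_trans _ (tg _ e0))// le_eqVlt; apply/orP; left.
apply/eqP; apply: (Ex_automorphism (Zd_action_automorphism HT v)
  (g := fun x => excess (Kf eta) (g x) ^+ 2)).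
have [] // : L2 (fun x => excess (Kf eta) (g x)).
apply: (L2_le _ _ gL) => [|x]; last by apply: abs_excess; exact: K0.
by apply: mf_comp; [exact: continuous_excess|exact: L2_mf gL].
Qed.

Lemma laplace_bracket_step q g k m : L2 g ->
  laplace_bracket P (fun a x => g (T (step q a.+1) x)) k m =
  laplace_bracket P (fun a x => g (T (step q a.+1) x)) 0 m.
Proof.
move=> gL; have Tv := Zd_action_automorphism HT.
rewrite /laplace_bracket.
have mb : mf (bracket (fun a x => g (T (step q a.+1) x)) 0 m).
  apply: mfM; first exact: mf_cst.
  by apply: mf_sum => a; apply: mfX; exact: L2_mf (L2_automorphism (Tv _) gL).
rewrite -[RHS](Ex_automorphism (Tv (step q k))); last first.
  apply: (integ_bdd (M := 1)).
    apply: (mf_comp (u := fun y : R => expR (- (y / 2))) _ mb).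
    move=> z; apply: (@continuous_comp _ _ _ (fun z : R => - (z / 2)) expR).
      by apply: cvgN; apply: cvgMl; exact: cvg_id.
    exact: continuous_expR.
  move=> x; rewrite ger0_norm ?expR_ge0// expR_le1 oppr_le0 divr_ge0//.
  by rewrite mulr_ge0 ?invr_ge0 ?ler0n// sumr_ge0// => a _; rewrite sqr_ge0.
apply: eq_Ex => x; rewrite /bracket; congr expR; congr (- (_ * _ / _)).
apply: eq_bigr => a _; rewrite action_comp /step -mulrnDr.
by rewrite add0n addSn addnC.
Qed.

End lattice_action.

(** * Sums along one direction *)

Section laplace_bracket_monotone.
Context (disp : measure_display) (Omega : measurableType disp) (R : realType).
Variable P : probability Omega R.
Local Notation Ex := (mean P).
Local Notation L2 := (L2 P).
Local Notation integ := (integ P).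
Variables (X : nat -> Omega -> R) (s2 : R).
Hypothesis XL : forall a, L2 (X a).
Hypothesis Xs : forall a, Ex (fun x => X a x ^+ 2) <= s2.
Hypothesis stat : forall k m, laplace_bracket P X k m = laplace_bracket P X 0 m.

Lemma expR_avg_le (k : nat) (c : nat -> R) : (0 < k)%N ->
  expR (k%:R^-1 * \sum_(b < k) c b) <= k%:R^-1 * \sum_(b < k) expR (c b).
Proof.
move=> k0; have kR : 0 < k%:R :> R by rewrite ltr0n.
rewrite ler_pdivlMl//; set m := _ * \sum_(b < k) c b.
apply: (@le_trans _ _ (\sum_(b < k) expR m * (1 + (c b - m)))).
  rewrite -mulr_sumr big_split/= sumrB !sumr_const card_ord.
  rewrite -[1 *+ k]mulr_natl -[m *+ k]mulr_natl mulr1 {3}/m mulVKf ?gt_eqF//.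
  by rewrite subrr addr0 mulrC.
apply: ler_sum => b _; rewrite (_ : expR (c b) = expR m * expR (c b - m)).
  by rewrite ler_wpM2l ?expR_ge0// expR_ge1Dx.
by rewrite -expRD; congr expR; lra.
Qed.

Lemma bracket_ge0 k m x : 0 <= bracket X k m x.
Proof.
by rewrite mulr_ge0 ?invr_ge0 ?ler0n// sumr_ge0// => a _; rewrite sqr_ge0.
Qed.

Lemma integ_bracket k m : integ (bracket X k m).
Proof. by apply: integZ; apply: integ_sum => a _; exact: (XL _).2. Qed.

Lemma integ_expR_bracket c k m : 0 <= c -> integ (fun x => expR (- (bracket X k m x * c))).
Proof.
move=> c0; apply: (integ_bdd (M := 1)).
  apply: (mf_comp (u := fun y : R => expR (- (y * c)))) _.
    move=> z; apply: (@continuous_comp _ _ _ (fun z : R => - (z * c)) expR).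
      by apply: cvgN; apply: cvgMl; exact: cvg_id.
    exact: continuous_expR.
  exact: integ_mf (integ_bracket k m).
move=> x; rewrite ger0_norm ?expR_ge0// expR_le1 oppr_le0 mulr_ge0//.
exact: bracket_ge0.
Qed.

(** The bracket of a block of length k m is the average of k brackets of length m, which share one
    Laplace transform by stationarity; Jensen's inequality concludes. *)
Lemma laplace_bracket_mul k m : (0 < k)%N ->
  laplace_bracket P X 0 (k * m) <= laplace_bracket P X 0 m.
Proof.
move=> k0; have kR : 0 < k%:R :> R by rewrite ltr0n.
have ie j l : integ (fun x => expR (- (bracket X j l x / 2))).
  by apply: (@integ_expR_bracket 2^-1); rewrite invr_ge0.
apply: (@le_trans _ _ (Ex (fun x => k%:R^-1 * \sum_(b < k)
    expR (- (bracket X (b * m) m x / 2))))); last first.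
  rewrite ExZ; last by apply: integ_sum.
  rewrite Ex_sum// ler_pdivrMl//.
  rewrite (eq_bigr (fun=> laplace_bracket P X 0 m)) => [|b _]; last exact: stat.
  by rewrite sumr_const card_ord mulr_natl.
apply: le_Ex => //; first by apply: integZ; apply: integ_sum.
move=> x; apply: (le_trans _ (expR_avg_le (fun b => - (bracket X (b * m) m x / 2)) k0)).
rewrite le_eqVlt; apply/orP; left; apply/eqP; congr expR.
rewrite /bracket natrM invfM (sum_blocks (fun a => X (0 + a)%N x ^+ 2)).
rewrite sumrN -!mulr_suml -mulr_sumr mulrN !mulrA.
by congr (- (_ * _ / _)); exact: mulrC.
Qed.

(** Let k = n' / n rounded down and c = k n / n'. Keeping only the first k n squares, the bracket of
    length n' is at least c times that of length k n, to which [laplace_bracket_mul] applies.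
    Dropping the factor c costs at most s2 (1 - c) / 2, and 1 - c <= n / n'. *)
Lemma laplace_bracket_le n n' : (0 < n)%N -> (n <= n')%N ->
  laplace_bracket P X 0 n' <= laplace_bracket P X 0 n + s2 * (n%:R / n'%:R).
Proof.
move=> n0 nn'; have n'0 : (0 < n')%N by exact: leq_trans nn'.
have n'R : 0 < n'%:R :> R by rewrite ltr0n.
set k := (n' %/ n)%N; have k0 : (0 < k)%N by rewrite divn_gt0.
have kn : (k * n <= n')%N := leq_trunc_div n' n.
have kn0 : 0 < (k * n)%:R :> R by rewrite ltr0n muln_gt0 k0.
have s20 : 0 <= s2 by apply: le_trans (Xs 0%N); apply: Ex_ge0 => x; exact: sqr_ge0.
pose c : R := (k * n)%:R / n'%:R.
have c1 : c <= 1 by rewrite ler_pdivrMr// mul1r ler_nat.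
have c0 : 0 <= c by rewrite divr_ge0 ?ler0n.
have cn : 1 - c <= n%:R / n'%:R.
  rewrite lerBlDr -mulrDl ler_pdivlMr// mul1r -natrD ler_nat addnC -mulSnr.
  by rewrite ltnW// ltn_ceil.
have ExV : Ex (bracket X 0 (k * n)) <= s2.
  rewrite ExZ; last by apply: integ_sum => a _; exact: (XL _).2.
  rewrite Ex_sum => [|a _]; last exact: (XL _).2.
  rewrite ler_pdivrMl//; apply: (@le_trans _ _ (\sum_(a < k * n) s2)).
    by apply: ler_sum.
  by rewrite sumr_const card_ord mulr_natl.
have ie j l : integ (fun x => expR (- (bracket X j l x / 2))).
  by apply: (@integ_expR_bracket 2^-1); rewrite invr_ge0.
have iV := integZ ((1 - c) / 2) (integ_bracket 0 (k * n)).
apply: (@le_trans _ _ (laplace_bracket P X 0 (k * n)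
    + (1 - c) / 2 * Ex (bracket X 0 (k * n)))).
  rewrite -(ExZ _ (integ_bracket _ _)) -ExD//; apply: le_Ex => //.
    exact: integD.
  move=> x; set V := bracket X 0 (k * n) x.
  have V0 : 0 <= V by exact: bracket_ge0.
  have VV : c * V <= bracket X 0 n' x.
    rewrite /c /V /bracket mulrAC [in leLHS]mulrCA mulrA mulVf ?gt_eqF// mul1r.
    rewrite mulrC ler_wpM2l ?invr_ge0 ?ler0n//.
    rewrite -(big_mkord xpredT (fun a => X (0 + a)%N x ^+ 2)).
    rewrite -(big_mkord xpredT (fun a => X (0 + a)%N x ^+ 2)).
    rewrite [leRHS](big_cat_nat (n := (k * n)%N))//= lerDl.
    by apply: sumr_ge0 => a _; exact: sqr_ge0.
  apply: (@le_trans _ _ (expR (- (c * V / 2)))).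
    by rewrite ler_expR lerN2 ler_wpM2r.
  have cV : 0 <= c * V / 2 by rewrite divr_ge0// mulr_ge0.
  have V2 : 0 <= V / 2 by rewrite divr_ge0.
  have := expRN_lipschitz cV V2.
  have -> : c * V / 2 - V / 2 = - ((1 - c) / 2 * V) by ring.
  rewrite normrN (ger0_norm (_ : 0 <= (1 - c) / 2 * V)); last first.
    by apply: mulr_ge0 => //; rewrite divr_ge0// subr_ge0.
  by rewrite ler_norml => /andP[_]; rewrite lerBlDl.
apply: lerD; first exact: laplace_bracket_mul.
apply: (@le_trans _ _ ((1 - c) / 2 * s2)).
  by apply: ler_wpM2l => //; rewrite divr_ge0// subr_ge0.
by rewrite [leRHS]mulrC; apply: ler_wpM2r => //; lra.
Qed.

End laplace_bracket_monotone.

(** * Normalized sums along directions *)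

Section directional_sums.
Context (disp : measure_display) (Omega : measurableType disp) (R : realType).
Variable P : probability Omega R.
Local Notation Ex := (mean P).
Local Notation L2 := (L2 P).
Local Notation integ := (integ P).
Variables (d : nat) (T : 'rV[int]_d -> Omega -> Omega).
Hypothesis HT : Zd_action P T.
Variable F : 'I_d -> int -> set_system Omega.
Hypothesis HF : multiple_filtration T F.
Implicit Types (q j : 'I_d) (g : Omega -> R) (n : 'I_d -> nat) (w : 'I_d -> nat -> R)
  (s : seq 'I_d).
Local Notation mdq := (mdq P F).

Definition dirsum q (m : nat) (c : nat -> R) g (x : Omega) : R :=
  (Num.sqrt m%:R)^-1 * \sum_(a < m) c a * g (T (step q a.+1) x).

Lemma dirsumC q j m m' c c' g :
  dirsum q m c (dirsum j m' c' g) = dirsum j m' c' (dirsum q m c g).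
Proof.
apply/funext => x; rewrite /dirsum.
set r := (Num.sqrt m%:R)^-1; set r' := (Num.sqrt m'%:R)^-1.
transitivity (\sum_(a < m) \sum_(b < m')
    r * r' * (c a * c' b) * g (T (step q a.+1 + step j b.+1) x)).
  rewrite mulr_sumr; apply: eq_bigr => a _; rewrite !mulr_sumr.
  apply: eq_bigr => b _; rewrite (action_comp HT) (addrC (step j _)); ring.
rewrite exchange_big/= mulr_sumr; apply: eq_bigr => b _; rewrite !mulr_sumr.
by apply: eq_bigr => a _; rewrite (action_comp HT); ring.
Qed.

Lemma mdq_dirsum q j m c g : j != q -> mdq q g -> mdq q (dirsum j m c g).
Proof.
move=> jq gq; apply: (mdqZ HF).
apply: (mdq_sum HF m (g := fun a x => c a * g (T (step j a.+1) x))) => a.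
apply: (mdqZ HF); apply: (mdq_action HT HF) => //.
by rewrite stepE eq_sym (negbTE jq).
Qed.

Lemma L2_dirsum q m c g : L2 g -> L2 (dirsum q m c g).
Proof.
move=> gL; apply: L2Z; apply: L2_sum => a; apply: L2Z.
exact: (L2_automorphism (Zd_action_automorphism HT _) gL).
Qed.

Lemma Ex_dirsum_sqr q m c g : (0 < m)%N -> signs c -> mdq q g ->
  Ex (fun x => dirsum q m c g x ^+ 2) = Ex (fun x => g x ^+ 2).
Proof.
move=> m0 c1 gq; have XA := mds_mdq HT HF gq; have gL := mdq_L2 gq.
under eq_Ex do rewrite /dirsum exprMn.
rewrite ExZ; last exact: (mds_sum_L2 XA c m).2.
rewrite (Ex_sqr_sum XA) exprVn sqr_sqrtr ?ler0n//.
rewrite (eq_bigr (fun=> Ex (fun x => g x ^+ 2))); last first.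
  by move=> a _; rewrite c1 mul1r; exact: Ex_step_sqr.
by rewrite sumr_const card_ord -[X in _ * X]mulr_natl mulKf// pnatr_eq0 -lt0n.
Qed.

(** The level K that [excess_sum_le] requires with M = [Kf (eta / 4)]: one half of eta is left for 4
    M^2 s2 / K^2. The summand 1 gives K <= K^2 and avoids a square root. *)
Definition next_cut (s2 : R) (Kf : R -> R) (eta : R) : R :=
  1 + 8 * Kf (eta / 4) ^+ 2 * s2 / eta.

Lemma next_cut_ge1 (s2 : R) Kf eta : 0 <= s2 -> 0 < eta -> 1 <= next_cut s2 Kf eta.
Proof.
move=> s20 e0; rewrite lerDl divr_ge0 ?(ltW e0)// mulr_ge0//.
by rewrite mulr_ge0// sqr_ge0.
Qed.

Lemma dirsum_tail q m c g (s2 : R) Kf : (0 < m)%N -> signs c -> mdq q g ->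
  Ex (fun x => g x ^+ 2) <= s2 -> (forall eta, 0 < eta -> 0 <= Kf eta) ->
  tail_controlled P Kf g -> tail_controlled P (next_cut s2 Kf) (dirsum q m c g).
Proof.
move=> m0 c1 gq gs K0 tg eta e0; have XA := mds_mdq HT HF gq.
have gL := mdq_L2 gq.
have s20 : 0 <= s2 by apply: le_trans gs; apply: Ex_ge0 => x; exact: sqr_ge0.
have e40 : 0 < eta / 4 by rewrite divr_gt0.
have K1 := next_cut_ge1 Kf s20 e0; set K := next_cut _ _ _ in K1 *.
have K_gt0 : 0 < K by exact: lt_le_trans K1.
apply: le_trans (excess_sum_le XA (s2 := s2) (M := Kf (eta / 4)) (eta := eta / 4)
  m0 c1 K_gt0 (K0 _ e40) _ _) _.
- by move=> a; rewrite (Ex_step_sqr HT)//.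
- by move=> a; exact: (tail_controlled_action HT _ gL K0 tg).
set M := Kf (eta / 4); have KK : K <= K ^+ 2 by rewrite expr2 ler_peMl// ltW.
have : 4 * M ^+ 2 * s2 / K ^+ 2 <= eta / 2.
  rewrite ler_pdivrMr ?exprn_gt0//; apply: (@le_trans _ _ (eta / 2 * K)).
    rewrite /K /next_cut -/M mulrDr mulr1.
    have -> : eta / 2 * (8 * M ^+ 2 * s2 / eta) = 4 * M ^+ 2 * s2.
      by field; rewrite gt_eqF.
    by rewrite lerDr divr_ge0// ltW.
  by apply: ler_wpM2l => //; rewrite divr_ge0// ltW.
lra.
Qed.

Definition bsum s n w g : Omega -> R :=
  foldr (fun q h => dirsum q (n q) (w q) h) g s.

Lemma bsum_perm s s' n w g : perm_eq s s' -> bsum s n w g = bsum s' n w g.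
Proof.
have mid q p1 p2 : bsum (p1 ++ q :: p2) n w g = bsum (q :: p1 ++ p2) n w g.
  by elim: p1 => [//|r p1 IH]; rewrite /= -/(bsum _ n w g) IH/= dirsumC.
elim: s s' => [|q s IH] s' ss'; first by have := perm_size ss'; case: s' ss'.
have qs' : q \in s' by rewrite -(perm_mem ss') mem_head.
case/splitPr: qs' ss' => p1 p2 ss'.
rewrite mid /= -/(bsum _ n w g); congr dirsum; apply: IH.
by rewrite -(perm_cons q) (perm_trans ss')// perm_catC/= perm_cons perm_catC.
Qed.

Lemma eq_bsum s n n' w w' g : {in s, n =1 n'} -> {in s, w =1 w'} ->
  bsum s n w g = bsum s n' w' g.
Proof.
elim: s => [//|q s IH] nn' ww' /=; rewrite -!/(bsum _ _ _ _) IH.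
- by rewrite nn' ?ww' ?mem_head.
- by move=> j js; apply: nn'; rewrite inE js orbT.
- by move=> j js; apply: ww'; rewrite inE js orbT.
Qed.

Lemma iter_next_cut_ge0 (s2 : R) Kf k : 0 <= s2 -> (forall eta, 0 < eta -> 0 <= Kf eta) ->
  forall eta, 0 < eta -> 0 <= iter k (next_cut s2) Kf eta.
Proof.
move=> s20 K0 eta e0; case: k => [|k]; first exact: K0.
by rewrite iterS (le_trans ler01)// next_cut_ge1.
Qed.

(** Summing along a direction leaves the martingale property of the others intact, so the next
    direction can still use its own. The resulting second moment and modulus depend neither on the
    sizes nor on the signs. *)
Lemma bsum_properties s n w f (s2 : R) Kf : uniq s -> (forall q, (0 < n q)%N) ->
  (forall q, signs (w q)) -> (forall q, mdq q f) ->
  Ex (fun x => f x ^+ 2) = s2 -> (forall eta, 0 < eta -> 0 <= Kf eta) ->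
  L2 f -> tail_controlled P Kf f ->
  [/\ forall q, q \notin s -> mdq q (bsum s n w f),
      L2 (bsum s n w f),
      Ex (fun x => bsum s n w f x ^+ 2) = s2 &
      tail_controlled P (iter (size s) (next_cut s2) Kf) (bsum s n w f)].
Proof.
move=> us n0 w1 fq fs K0 fL tf.
have s20 : 0 <= s2 by rewrite -fs; apply: Ex_ge0 => x; exact: sqr_ge0.
elim: s us => [_|q s IH /=/andP[qs us]]; first by split.
have [gq gL gs gt] := IH us; rewrite -/(bsum s n w f).
split.
- move=> j; rewrite inE negb_or => /andP[jq js]; apply: mdq_dirsum; last exact: gq.
  by rewrite eq_sym.
- exact: L2_dirsum.
- by rewrite Ex_dirsum_sqr//; exact: gq.
- apply: dirsum_tail => //; [exact: gq|by rewrite gs|].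
  exact: iter_next_cut_ge0.
Qed.

End directional_sums.

(** * Removal of the signs *)

Section limits_along_all_infty.
Context (R : realType) (d : nat).
Implicit Types (n : 'I_d -> nat) (h : ('I_d -> nat) -> R).

Definition eventually_all (Q : ('I_d -> nat) -> Prop) :=
  exists K : nat, forall n, (forall j, (K <= n j)%N) -> Q n.

Definition tends_to h (l : R) :=
  forall eps : R, 0 < eps -> eventually_all (fun n => `|h n - l| <= eps).

Lemma eventually_all2 Q1 Q2 : eventually_all Q1 -> eventually_all Q2 ->
  eventually_all (fun n => Q1 n /\ Q2 n).
Proof.
move=> [K1 H1] [K2 H2]; exists (maxn K1 K2) => n Hn; split.
  by apply: H1 => j; rewrite (leq_trans _ (Hn j))// leq_maxl.
by apply: H2 => j; rewrite (leq_trans _ (Hn j))// leq_maxr.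
Qed.

Lemma tends_to_near h h' (c l : R) :
  (forall eps, 0 < eps -> eventually_all (fun n => `|h' n - c * h n| <= eps)) ->
  tends_to h l -> tends_to h' (c * l).
Proof.
move=> hh' hl eps e0.
have c0 : 0 < `|c| + 1 by rewrite ltr_wpDl.
have e2 : 0 < eps / 2 by rewrite divr_gt0.
have ec : 0 < eps / 2 / (`|c| + 1) by rewrite divr_gt0.
have [K HK] := eventually_all2 (hh' _ e2) (hl _ ec).
exists K => n /HK[H1 H2].
rewrite (_ : _ - _ = (h' n - c * h n) + c * (h n - l)); last by ring.
rewrite (le_trans (ler_normD _ _))// normrM.
have : `|c| * `|h n - l| <= eps / 2.
  apply: (@le_trans _ _ ((`|c| + 1) * `|h n - l|)).
    by rewrite ler_wpM2r// lerDl.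
  by rewrite mulrC -ler_pdivlMr.
lra.
Qed.

(** The limit is the upper limit, written as the infimum of the eventual upper bounds. By almost
    monotonicity [h n + eps] is itself such a bound, which gives the inequality from below. *)
Lemma tends_to_almost_decreasing h : (exists M, forall n, `|h n| <= M) ->
  (forall eps, 0 < eps -> eventually_all (fun n =>
     eventually_all (fun n' => h n' <= h n + eps))) ->
  exists l, tends_to h l.
Proof.
move=> [M h1] hdec; pose A := [set y : R | eventually_all (fun n => h n <= y)].
have A1 : A M by exists 0%N => n _; have := h1 n; rewrite ler_norml => /andP[].
have Alb y : A y -> - M <= y.
  move=> [K HK]; have := HK (fun=> K) (fun=> leqnn K); apply: le_trans.
  by have := h1 (fun=> K); rewrite ler_norml => /andP[].
have infA : has_inf A by split; [exists M|exists (- M) => y /Alb].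
exists (inf A) => eps e0.
have [y [Ky Hy] ylt] := inf_adherent e0 infA.
have [K HK] := hdec _ e0.
exists (maxn Ky K) => n Hn.
have Hn1 j : (Ky <= n j)%N by rewrite (leq_trans _ (Hn j))// leq_maxl.
have Hn2 j : (K <= n j)%N by rewrite (leq_trans _ (Hn j))// leq_maxr.
have u := Hy n Hn1.
have : inf A <= h n + eps.
  by apply: ge_inf; [exact: infA.2|exact: HK n Hn2].
by rewrite ler_norml; lra.
Qed.

Definition set_coord n (q : 'I_d) (m : nat) : 'I_d -> nat :=
  fun j => if j == q then m else n j.

Lemma tends_to_set_coord h l q (m : ('I_d -> nat) -> nat) :
  (forall K : nat, exists K' : nat, forall n, (forall j, K' <= n j)%N ->
     (K <= m n)%N) ->
  tends_to h l -> tends_to (fun n => h (set_coord n q (m n))) l.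
Proof.
move=> mK hl eps e0; have [K HK] := hl _ e0; have [K' HK'] := mK K.
exists (maxn K K') => n Hn; apply: HK => j; rewrite /set_coord.
case: eqVneq => _; last by rewrite (leq_trans _ (Hn j))// leq_maxl.
by apply: HK' => i; rewrite (leq_trans _ (Hn i))// leq_maxr.
Qed.

End limits_along_all_infty.

(** * Averages over signs in several directions *)

Section sign_averages.
Context (R : realType) (d : nat).
Implicit Types (n : 'I_d -> nat) (w : 'I_d -> nat -> R) (q j : 'I_d)
  (Q : seq 'I_d) (Phi Psi : ('I_d -> nat -> R) -> R).

Definition set_dir w q (c : nat -> R) : 'I_d -> nat -> R :=
  fun j => if j == q then c else w j.

Definition sign_avg_dir (q : 'I_d) (m : nat) Phi : ('I_d -> nat -> R) -> R :=
  fun w => sign_avg m (fun c => Phi (set_dir w q c)).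

(** Each average is an operator on functionals of the sign array, so that averages compose; the
    directions outside [Q] keep the signs of the argument. *)
Definition sign_avgs Q n Phi : ('I_d -> nat -> R) -> R :=
  foldr (fun q Psi => sign_avg_dir q (n q) Psi) Phi Q.

Definition all_signs w := forall j, signs (w j).

Lemma all_signs_set w q c : all_signs w -> signs c -> all_signs (set_dir w q c).
Proof. by move=> sw sc j; rewrite /set_dir; case: ifP => _; [exact: sc|exact: sw]. Qed.

Lemma set_dirC w q j c c' : q != j ->
  set_dir (set_dir w q c) j c' = set_dir (set_dir w j c') q c.
Proof.
move=> qj; apply/funext => i; rewrite /set_dir.
by case: eqVneq => [->|//]; rewrite eq_sym (negbTE qj).
Qed.

(** The comparison may use that w' agrees with w outside [Q]: starting from signs all equal to 1, a
    direction outside [Q] carries an honest martingale sum. *)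
Lemma sign_avgs_le Q n Phi Psi w : all_signs w ->
  (forall w', all_signs w' -> (forall j, j \notin Q -> w' j = w j) ->
     Phi w' <= Psi w') ->
  sign_avgs Q n Phi w <= sign_avgs Q n Psi w.
Proof.
elim: Q w => [|q Q IH] w sw PP; first exact: PP.
apply: sign_avg_le => c sc; apply: IH; first exact: all_signs_set.
move=> w' sw' ww'; apply: PP => // j; rewrite inE negb_or => /andP[jq jQ].
by rewrite ww'// /set_dir (negbTE jq).
Qed.

Lemma sign_avgsD Q n Phi Psi w :
  sign_avgs Q n (fun w => Phi w + Psi w) w = sign_avgs Q n Phi w + sign_avgs Q n Psi w.
Proof.
elim: Q w => [//|q Q IH] w; rewrite /= /sign_avg_dir -sign_avgD.
by apply: eq_sign_avg => c _; exact: IH.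
Qed.

Lemma sign_avgsZ Q n (c : R) Phi w :
  sign_avgs Q n (fun w => c * Phi w) w = c * sign_avgs Q n Phi w.
Proof.
elim: Q w => [//|q Q IH] w; rewrite /= /sign_avg_dir -sign_avgZ.
by apply: eq_sign_avg => s _; exact: IH.
Qed.

Lemma sign_avgs_cst Q n (c : R) w : sign_avgs Q n (fun=> c) w = c.
Proof.
elim: Q w => [//|q Q IH] w; rewrite /= /sign_avg_dir -[RHS](sign_avg_cst (n q)).
by apply: eq_sign_avg => s _; exact: IH.
Qed.

Lemma sign_avgs_dist Q n Phi Psi Xi w : all_signs w ->
  (forall w', all_signs w' -> (forall j, j \notin Q -> w' j = w j) ->
     `|Phi w' - Psi w'| <= Xi w') ->
  `|sign_avgs Q n Phi w - sign_avgs Q n Psi w| <= sign_avgs Q n Xi w.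
Proof.
move=> sw PP; rewrite ler_distl; apply/andP; split.
  rewrite lerBlDr -sign_avgsD; apply: sign_avgs_le => // w' sw' ww'.
  by have := PP _ sw' ww'; rewrite ler_distl => /andP[]; lra.
rewrite -sign_avgsD; apply: sign_avgs_le => // w' sw' ww'.
by have := PP _ sw' ww'; rewrite ler_distl => /andP[_]; lra.
Qed.

Lemma eq_sign_avgs Q n n' Phi Psi w : {in Q, n =1 n'} -> all_signs w ->
  (forall w', all_signs w' -> Phi w' = Psi w') ->
  sign_avgs Q n Phi w = sign_avgs Q n' Psi w.
Proof.
elim: Q w => [|q Q IH] w nn' sw PP; first exact: PP.
rewrite /= /sign_avg_dir nn' ?mem_head//; apply: eq_sign_avg => c sc.
apply: IH => //; last exact: all_signs_set.
by move=> j jQ; apply: nn'; rewrite inE jQ orbT.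
Qed.

Lemma sign_avgs_rcons Q q n Phi w :
  sign_avgs (rcons Q q) n Phi w = sign_avgs Q n (sign_avg_dir q (n q) Phi) w.
Proof. by rewrite /sign_avgs foldr_rcons. Qed.

Lemma sign_avg_dirC q j m m' Phi : q != j ->
  sign_avg_dir q m (sign_avg_dir j m' Phi) = sign_avg_dir j m' (sign_avg_dir q m Phi).
Proof.
move=> qj; apply/funext => w; rewrite /sign_avg_dir.
rewrite (sign_avgC m m' (fun c c' => Phi (set_dir (set_dir w q c) j c'))).
by apply: eq_sign_avg => c _; apply: eq_sign_avg => c' _; rewrite set_dirC.
Qed.

Lemma sign_avgs_perm Q Q' n Phi : uniq Q -> perm_eq Q Q' ->
  sign_avgs Q n Phi = sign_avgs Q' n Phi.
Proof.
have mid q p1 p2 : uniq (p1 ++ q :: p2) ->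
    sign_avgs (p1 ++ q :: p2) n Phi = sign_avgs (q :: p1 ++ p2) n Phi.
  elim: p1 => [//|r p1 IH] /=/andP[rp u]; rewrite -/(sign_avgs _ n Phi) IH//=.
  rewrite sign_avg_dirC//; apply: contraNneq rp => ->.
  by rewrite mem_cat mem_head orbT.
elim: Q Q' => [|q Q IH] Q' uQ QQ'; first by have := perm_size QQ'; case: Q' QQ'.
have uQ' : uniq Q' by rewrite -(perm_uniq QQ').
have qQ' : q \in Q' by rewrite -(perm_mem QQ') mem_head.
case/splitPr: qQ' QQ' uQ' => p1 p2 QQ' uQ'.
rewrite mid//= -!/(sign_avgs _ n Phi); congr sign_avg_dir; apply: IH.
  by case/andP: uQ.
by rewrite -(perm_cons q) (perm_trans QQ')// perm_catC/= perm_cons perm_catC.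
Qed.

End sign_averages.

(** * The induction on the directions that carry signs *)

Section sign_removal.
Context (disp : measure_display) (Omega : measurableType disp) (R : realType).
Variable P : probability Omega R.
Local Notation Ex := (mean P).
Local Notation L2 := (L2 P).
Local Notation integ := (integ P).
Variables (d : nat) (T : 'rV[int]_d -> Omega -> Omega).
Hypothesis HT : Zd_action P T.
Variable F : 'I_d -> int -> set_system Omega.
Hypothesis HF : multiple_filtration T F.
Variables (f : Omega -> R) (Kf : R -> R).
Hypothesis fq : forall q, mdq P F q f.
Hypothesis fL : L2 f.
Hypothesis K0 : forall eta, 0 < eta -> 0 <= Kf eta.
Hypothesis tf : tail_controlled P Kf f.
Implicit Types (q j : 'I_d) (n : 'I_d -> nat) (w : 'I_d -> nat -> R)
  (Q S : seq 'I_d).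

Let s2 : R := Ex (fun x => f x ^+ 2).
(** A slice is summed over d - 1 directions, each of which transforms the modulus once. *)
Let Kd : R -> R := iter d.-1 (next_cut s2) Kf.
Let dirs := enum 'I_d.
Let w1 : 'I_d -> nat -> R := fun _ _ => 1.

Definition slice q n w : Omega -> R := bsum T (rem q dirs) n w f.
Definition slice_path q n w (a : nat) (x : Omega) : R := slice q n w (T (step q a.+1) x).

(** Random signs are present in the directions of [Q] and absent from the others. The induction
    alternates between [H] and the brackets [G]: [H_of_G] goes from the bracket along q, outside
    [Q], to the cosine, and [G_of_H] back to a bracket with one sign direction fewer. *)
Let H Q th n : R :=
  sign_avgs Q n (fun w => Ex (fun x => cos (bsum T dirs n w f x + th))) w1.
Let G Q q n : R :=
  sign_avgs Q n (fun w => laplace_bracket P (slice_path q n w) 0 (n q)) w1.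

Let s20 : 0 <= s2. Proof. by apply: Ex_ge0 => x; exact: sqr_ge0. Qed.
Let Kd0 eta : 0 < eta -> 0 <= Kd eta. Proof. exact: iter_next_cut_ge0. Qed.
Let w1_signs : all_signs w1. Proof. by move=> j; exact: signs1. Qed.
Let dirs_uniq : uniq dirs. Proof. exact: enum_uniq. Qed.

Let notin_rem q : q \notin rem q dirs.
Proof. by rewrite mem_rem_uniqF. Qed.

Let slice_properties q n w : (forall j, (0 < n j)%N) -> all_signs w ->
  [/\ mdq P F q (slice q n w), L2 (slice q n w),
      Ex (fun x => slice q n w x ^+ 2) = s2 &
      tail_controlled P Kd (slice q n w)].
Proof.
move=> n0 sw; have [] := bsum_properties HT HF (w := w) (rem_uniq q dirs_uniq) n0 sw
  fq erefl K0 fL tf.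
rewrite size_rem ?mem_enum// size_enum_ord => h1 h2 h3 h4; split => //.
exact: h1.
Qed.

Let path_properties q n w : (forall j, (0 < n j)%N) -> all_signs w ->
  [/\ mds P (fun k : nat => adapted P F q k%:Z) (slice_path q n w),
      forall a, Ex (fun x => slice_path q n w a x ^+ 2) <= s2,
      forall a, tail_controlled P Kd (slice_path q n w a) &
      forall k m, laplace_bracket P (slice_path q n w) k m =
                  laplace_bracket P (slice_path q n w) 0 m].
Proof.
move=> n0 sw; have [h1 h2 h3 h4] := slice_properties q n0 sw; split.
- exact: mds_mdq.
- by move=> a; rewrite -h3 (Ex_step_sqr HT).
- by move=> a; exact: (tail_controlled_action HT).
- by move=> k m; exact: (laplace_bracket_step HT).
Qed.

Let bsum_slice q n w :
  bsum T dirs n w f = dirsum T q (n q) (w q) (slice q n w).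
Proof.
by rewrite (@bsum_perm _ _ _ P _ _ HT dirs (q :: rem q dirs))// perm_to_rem ?mem_enum.
Qed.

Let slice_set_dir q n w c : slice q n (set_dir w q c) = slice q n w.
Proof.
apply: eq_bsum => // j jq; rewrite /set_dir.
by case: eqVneq jq => // ->; rewrite (negbTE (notin_rem q)).
Qed.

Let slice_set_coord q n m w : slice q (set_coord n q m) w = slice q n w.
Proof.
apply: eq_bsum => // j jq; rewrite /set_coord.
by case: eqVneq jq => // ->; rewrite (negbTE (notin_rem q)).
Qed.

Let slice_path_set_coord q n m w :
  slice_path q (set_coord n q m) w = slice_path q n w.
Proof.
by apply/funext => a; apply/funext => x; rewrite /slice_path slice_set_coord.
Qed.

Let set_coord_at q n m : set_coord n q m q = m.
Proof. by rewrite /set_coord eqxx. Qed.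

Let G_set_coord Q q n m : q \notin Q -> G Q q (set_coord n q m) =
  sign_avgs Q n (fun w => laplace_bracket P (slice_path q n w) 0 m) w1.
Proof.
move=> qQ; apply: eq_sign_avgs; [|exact: w1_signs|].
  by move=> j jQ; rewrite /set_coord; case: eqVneq jQ qQ => [->->|].
by move=> w _; rewrite slice_path_set_coord set_coord_at.
Qed.

(** For fixed signs in the other directions the sum is a Rademacher sum of translated slices. The
    estimate is uniform in those signs, so it survives their average. *)
Let H_near_G th eps : 0 < eps -> exists K : nat, forall n, (forall j, (K <= n j)%N) ->
  forall Q q, `|H (rcons Q q) th n - cos th * G Q q n| <= eps.
Proof.
move=> e0; have [n0 Hn0] := rademacher_uniform P s20 Kd0 e0.
exists (maxn n0 1) => n Hn Q q.
have n_gt0 j : (0 < n j)%N by rewrite (leq_trans _ (Hn j))// leq_maxr.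
rewrite /H sign_avgs_rcons /G -sign_avgsZ.
rewrite -[leRHS](sign_avgs_cst Q n eps w1); apply: sign_avgs_dist => // w sw _.
have [h1 h2 h3 h4] := path_properties q n_gt0 sw.
have := Hn0 (slice_path q n w) th (n q) (mds_L2 h1) h2 h3.
rewrite (leq_trans (leq_maxl _ _) (Hn q)) => /(_ isT).
congr (`|_ - _| <= _); apply: eq_sign_avg => c _; apply: eq_Ex => x.
by rewrite (bsum_slice q) slice_set_dir /set_dir eqxx.
Qed.

Let G_quasi_decreasing Q q n m : q \notin Q -> (forall j, (0 < n j)%N) ->
  (n q <= m)%N -> G Q q (set_coord n q m) <= G Q q n + s2 * ((n q)%:R / m%:R).
Proof.
move=> qQ n0 nm; rewrite G_set_coord// -(sign_avgs_cst Q n (s2 * _) w1) -sign_avgsD.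
apply: sign_avgs_le => // w sw _; have [h1 h2 h3 h4] := path_properties q n0 sw.
exact: (laplace_bracket_le (mds_L2 h1) h2 h4).
Qed.

(** For each choice of the signs in [Q], the translates of the slice along [q] are martingale
    differences, and they are summed with signs 1 as [q] is outside [Q]. The linear error bound
    commutes with the average. *)
Let H_clt th eps : 0 < eps -> exists (p : nat) (C : R) (K : nat), 0 <= C /\
  forall Q q n, q \notin Q -> (forall j, (K <= n j)%N) ->
  `|H Q th n - cos th * G Q q (set_coord n q (n q %/ p.+1))| <=
  eps + C * (G Q q (set_coord n q (n q %/ p.+1))
             - G Q q (set_coord n q (p.+1 * (n q %/ p.+1)))).
Proof.
move=> e0; have [p [C [n0 [C0 Hn0]]]] := clt_uniform P s20 Kd0 e0.
exists p, C, (maxn n0 1); split => // Q q n qQ Hn.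
have n_gt0 j : (0 < n j)%N by rewrite (leq_trans _ (Hn j))// leq_maxr.
set m := (n q %/ p.+1)%N; rewrite !G_set_coord//.
pose L m' w : R := laplace_bracket P (slice_path q n w) 0 m'.
have -> : eps + C * (sign_avgs Q n (L m) w1 - sign_avgs Q n (L (p.+1 * m)%N) w1) =
    sign_avgs Q n (fun w => eps + C * (L m w + - 1 * L (p.+1 * m)%N w)) w1.
  rewrite (sign_avgsD Q n (fun=> eps)) sign_avgs_cst.
  rewrite (sign_avgsZ Q n C (fun w => L m w + - 1 * L (p.+1 * m)%N w)).
  by rewrite sign_avgsD (sign_avgsZ Q n (- 1)) mulN1r.
rewrite -sign_avgsZ; apply: sign_avgs_dist => // w sw ww1.
have [h1 h2 h3 h4] := path_properties q n_gt0 sw; rewrite mulN1r.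
have := Hn0 _ _ th (n q) h1 h2 h3 h4.
rewrite (leq_trans (leq_maxl _ _) (Hn q)) => /(_ isT).
congr (`|_ - _| <= _); apply: eq_Ex => x; rewrite (bsum_slice q) ww1//.
by congr (cos (_ * _ + _)); apply: eq_bigr => a _; rewrite mul1r.
Qed.

Let H_le1 Q th n : `|H Q th n| <= 1.
Proof.
rewrite -[H Q th n]subr0 -[X in _ - X](sign_avgs_cst Q n 0 w1).
rewrite -[leRHS](sign_avgs_cst Q n 1 w1); apply: sign_avgs_dist => // w sw _.
rewrite subr0 -[leRHS](Ex_cst P); apply: abs_Ex_le => //.
- apply: (mf_comp (u := fun y => cos (y + th)) (@continuous_cos_shift _ th)).
  suff : L2 (bsum T dirs n w f) by exact: L2_mf.
  by elim: dirs => [|q s IH]; [exact: fL|exact: (L2_dirsum HT _ _ _ IH)].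
- exact: integ_cst.
- by move=> x; exact: cos_max.
Qed.

Let H_perm Q Q' th n : uniq Q -> perm_eq Q Q' -> H Q th n = H Q' th n.
Proof. by move=> uQ QQ'; rewrite /H (sign_avgs_perm _ _ uQ QQ'). Qed.

(** When only the coordinate q of n increases, [H] is compared with a bracket along q, which almost
    decreases: since every direction carries signs, q can be permuted to the last place. *)
Let H_full_converges : exists l, tends_to (H dirs 0) l.
Proof.
apply: tends_to_almost_decreasing => [|eps e0]; first by exists 1 => n; exact: H_le1.
(* Changing one coordinate costs 3 e: [H] to [G], the almost decrease, [G] to [H]. Using d + 1
   instead of d keeps the divisor positive. *)
pose e : R := eps / (3 * d.+1%:R).
have e'0 : 0 < e by rewrite divr_gt0// mulr_gt0.
have [K HK] := H_near_G 0 e'0; exists (maxn K 1) => n Hn.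
have HnK j : (K <= n j)%N by rewrite (leq_trans _ (Hn j))// leq_maxl.
have n_gt0 j : (0 < n j)%N by rewrite (leq_trans _ (Hn j))// leq_maxr.
have [K1 HK1] := natr_ge (s2 * (\sum_j n j)%:R / e).
exists (maxn (\sum_j n j) K1) => n' Hn'.
have nS j : (n j <= \sum_j n j)%N by rewrite (bigD1 j)//= leq_addr.
have nn' j : (n j <= n' j)%N.
  by rewrite (leq_trans (nS j))// (leq_trans _ (Hn' j))// leq_maxl.
have small j : s2 * ((n j)%:R / (n' j)%:R) <= e.
  have n'R : 0 < (n' j)%:R :> R by rewrite ltr0n (leq_trans _ (nn' j)).
  have := HK1 (n' j); rewrite (leq_trans (leq_maxr _ _) (Hn' j)) => /(_ isT).
  rewrite ler_pdivrMr// => h; rewrite mulrA ler_pdivrMr// (mulrC e).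
  by apply: le_trans h; rewrite ler_wpM2l// ler_nat.
(* Interpolates between n and n' by changing the coordinates of [S], one at a time. *)
pose hyb S j := if j \in S then n' j else n j.
suff hybP S : uniq S -> H dirs 0 (hyb S) <= H dirs 0 n + (size S)%:R * (3 * e).
  have := hybP dirs dirs_uniq.
  rewrite (_ : hyb dirs = n'); last first.
    by apply/funext => j; rewrite /hyb mem_enum.
  move=> /le_trans; apply; rewrite lerD2l size_enum_ord.
  have D0 : 0 < d.+1%:R :> R by rewrite ltr0n.
  have -> : 3 * e = eps / d.+1%:R by rewrite /e invfM; field; rewrite gt_eqF.
  rewrite mulrA ler_pdivrMr// mulrC; apply: ler_wpM2l; first exact: ltW.
  by rewrite ler_nat.
elim: S => [_|q S IH /=/andP[qS uS]].
  by rewrite mul0r addr0.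
have hybK S' j : (K <= hyb S' j)%N.
  by rewrite /hyb; case: ifP => _ //; exact: leq_trans (nn' j).
have hyb0 S' j : (0 < hyb S' j)%N.
  by rewrite /hyb; case: ifP => _ //; exact: leq_trans (nn' j).
have hyb_cons : hyb (q :: S) = set_coord (hyb S) q (n' q).
  apply/funext => j; rewrite /set_coord /hyb inE.
  by case: eqVneq => [->|].
have hq : hyb S q = n q by rewrite /hyb (negbTE qS).
have uq : perm_eq dirs (rcons (rem q dirs) q).
  by rewrite perm_sym perm_rcons perm_sym perm_to_rem ?mem_enum.
have a1 := HK _ (hybK (q :: S)) (rem q dirs) q.
have a2 := HK _ (hybK S) (rem q dirs) q.
have := G_quasi_decreasing (notin_rem q) (hyb0 S) (m := n' q).
rewrite hq => /(_ (nn' q)) a3; have a4 := small q; have := IH uS.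
rewrite !(H_perm _ _ dirs_uniq uq) -hyb_cons in a3 *.
move: a1 a2; rewrite cos0 !mul1r !ler_norml -natr1 => /andP[_ a1] /andP[a2 _].
lra.
Qed.

(** The two block lengths in the gap of [H_clt] both tend to infinity with n q, so the two Laplace
    transforms have the same limit and the gap vanishes. *)
Let H_of_G Q q th l : q \notin Q -> tends_to (G Q q) l ->
  tends_to (H Q th) (cos th * l).
Proof.
move=> qQ Gl eps e0; have e3 : 0 < eps / 3 by rewrite divr_gt0.
have [p [C [K [C0 HK]]]] := H_clt th e3.
have divK K1 : exists K', forall n, (forall j, K' <= n j)%N -> (K1 <= n q %/ p.+1)%N.
  by exists (K1 * p.+1)%N => n Hn; rewrite leq_divRL.
have mdivK K1 : exists K', forall n, (forall j, K' <= n j)%N ->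
    (K1 <= p.+1 * (n q %/ p.+1))%N.
  have [K' HK'] := divK K1; exists K' => n Hn.
  by rewrite (leq_trans (HK' _ Hn))// leq_pmull.
have c0 : 0 < 2 * C + 1 by rewrite ltr_wpDl// mulr_ge0.
have de0 : 0 < eps / 3 / (2 * C + 1) by rewrite divr_gt0.
have [K2 HK2] := eventually_all2 (tends_to_set_coord q divK Gl de0)
  (tends_to_set_coord q mdivK Gl de0).
exists (maxn K K2) => n Hn.
have [|b1 b2] := HK2 n.
  by move=> j; rewrite (leq_trans _ (Hn j))// leq_maxr.
have b3 : forall j, (K <= n j)%N by move=> j; rewrite (leq_trans _ (Hn j))// leq_maxl.
have {HK b3} b4 := HK Q q n qQ b3.
set de := eps / 3 / _ in b1 b2 de0.
have deE : 2 * C * de + de = eps / 3 by rewrite /de; field; rewrite gt_eqF.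
set g1 := G _ _ _ in b1 b4; set g2 := G _ _ _ in b2 b4.
have b5 : C * (g1 - g2) <= C * (2 * de).
  apply: ler_wpM2l => //; move: b1 b2; rewrite !ler_norml => /andP[_ ?] /andP[? _]; lra.
rewrite (_ : _ - _ = (H Q th n - cos th * g1) + cos th * (g1 - l)); last by ring.
rewrite (le_trans (ler_normD _ _))// normrM.
have : `|cos th| * `|g1 - l| <= de.
  by rewrite (le_trans _ b1)// ler_piMl// cos_max.
lra.
Qed.

(** The Rademacher estimate read backwards, at th = 0 where [cos th] is 1. *)
Let G_of_H Q q l : tends_to (H (rcons Q q) 0) l -> tends_to (G Q q) l.
Proof.
move=> Hl; rewrite -[l]mul1r; apply: tends_to_near Hl => eps e0.
have [K HK] := H_near_G 0 e0; exists K => n /HK /(_ Q q).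
by rewrite cos0 !mul1r distrC.
Qed.

(* The signs are removed one direction at a time. *)
Lemma block_sum_limits (hd : (0 < d)%N) : exists l : R,
  (forall th, tends_to (fun n => Ex (fun x => cos (bsum T dirs n w1 f x + th)))
     (cos th * l)) /\
  (forall q, tends_to (fun n => laplace_bracket P (slice_path q n w1) 0 (n q)) l).
Proof.
have [l Hl] := H_full_converges; exists l.
(* [Q] carries signs, [q] is the direction of the bracket, and [S] lists the directions already
   freed from their signs. *)
have key S Q q : perm_eq (rcons Q q ++ S) dirs -> tends_to (G Q q) l.
  elim: S Q q => [Q q|q' S IH Q q] QS.
    apply: G_of_H; rewrite cats0 in QS => eps e0; have [K HK] := Hl _ e0.
    exists K => n /HK; rewrite (H_perm 0 n (_ : uniq (rcons Q q)) QS)//.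
    by rewrite (perm_uniq QS).
  have QS' : perm_eq (rcons (rcons Q q) q' ++ S) dirs by rewrite cat_rcons.
  have qQ' : q' \notin rcons Q q.
    have := dirs_uniq; rewrite -(perm_uniq QS') cat_uniq rcons_uniq.
    by case/andP => /andP[].
  by have := H_of_G 0 qQ' (IH _ _ QS'); rewrite cos0 mul1r => /G_of_H.
have G0 q : tends_to (G [::] q) l.
  by apply: (key (rem q dirs)); rewrite perm_sym perm_to_rem ?mem_enum.
split=> [th|q]; last exact: G0.
exact: (@H_of_G [::] (Ordinal hd) th l isT (G0 _)).
Qed.

End sign_removal.

(** * Existence of the limit laws *)

Section bernstein.
Context (R : realType).
Implicit Types (g h : nat -> R) (y : R).

(** Only [x] is confined to the segment, so that [y] may be a grid point outside it. *)
Lemma uniformly_continuous_segment (phi : R -> R) (K eps : R) :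
  continuous phi -> 0 < eps ->
  exists2 de : R, 0 < de & forall x y, `|x| <= K -> `|x - y| < de ->
    `|phi x - phi y| <= eps.
Proof.
move=> cphi e0; have cK : compact (`[- K, K]%classic : set R).
  exact: segment_compact.
move/compact_near_coveringP : cK.
move=> /(_ R (0^'+) (fun de x => forall y, `|x - y| < de -> `|phi x - phi y| <= eps)
  _) H.
have {}H : \forall de \near 0^'+, forall x, `[- K, K]%classic x ->
    forall y, `|x - y| < de -> `|phi x - phi y| <= eps.
  apply: H => x _.
  have e2 : 0 < eps / 2 by rewrite divr_gt0.
  have /cvgrPdist_lt /(_ _ e2) := cphi x.
  rewrite -nbhs_nearE -nbhs_ballE => -[r /= r0 Hr].
  have r2 : 0 < r / 2 by rewrite divr_gt0.
  exists (ball x (r / 2), [set de | de < r / 2]).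
    split; first by rewrite /= -nbhs_ballE; exists (r / 2).
    by apply: nbhs_right_lt.
  move=> [x' de] /= [xx' de2] y x'y.
  have h1 : `|phi x - phi x'| < eps / 2.
    apply: Hr; rewrite /ball/=; move: xx'; rewrite /ball/= => /lt_trans; apply.
    by rewrite ltr_pdivrMr// ltr_pMr// ltr1n.
  have h2 : `|phi x - phi y| < eps / 2.
    apply: Hr; rewrite /ball/=; move: xx'; rewrite /ball/= => xx'.
    rewrite (_ : x - y = (x - x') + (x' - y)); last by ring.
    by rewrite (le_lt_trans (ler_normD _ _))//; lra.
  rewrite (_ : phi x' - phi y = (phi x - phi y) - (phi x - phi x')); last by ring.
  by rewrite (le_trans (ler_normB _ _))//; lra.
have [de [Hde de0]] := filter_ex (filterI H (nbhs_right_gt (0 : R))).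
by exists de => // x y xK; apply: Hde; rewrite /= in_itv/= -ler_norml.
Qed.

(* [bern n g y] is the expectation of [g k] when [k] is binomial with
   parameters [n] and [y]. *)
Fixpoint bern (n : nat) g y : R :=
  if n is n'.+1 then y * bern n' (fun k => g k.+1) y + (1 - y) * bern n' g y
  else g 0%N.

Lemma eq_bern n g h y : g =1 h -> bern n g y = bern n h y.
Proof. by move=> /funext ->. Qed.

Lemma bern_dist n (c : R) g h y : 0 <= y <= 1 -> (forall k, `|c - g k| <= h k) ->
  `|c - bern n g y| <= bern n h y.
Proof.
move=> y01; have /andP[y0 y1] := y01; elim: n g h => [|n IH] g h gh /=; first exact: gh.
rewrite (_ : c - _ = y * (c - bern n (fun k => g k.+1) y)
  + (1 - y) * (c - bern n g y)); last by ring.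
rewrite (le_trans (ler_normD _ _))// !normrM (ger0_norm y0).
rewrite (ger0_norm (_ : 0 <= 1 - y)) ?subr_ge0//.
rewrite lerD// ler_wpM2l// ?subr_ge0//; apply: IH => // k; exact: gh.
Qed.

Lemma bern_lin n (a b : R) g h y :
  bern n (fun k => a * g k + b * h k) y = a * bern n g y + b * bern n h y.
Proof. by elim: n g h => [|n IH] g h //=; rewrite !IH; ring. Qed.

Lemma bern_cst n (c : R) y : bern n (fun=> c) y = c.
Proof. by elim: n => [|n IH] //=; rewrite IH; ring. Qed.

(** Binomial variance plus squared bias. The center is arbitrary because the recursion moves it to c
    - 1. *)
Lemma bern_sqr n (c : R) y :
  bern n (fun k => (k%:R - c) ^+ 2) y = n%:R * (y * (1 - y)) + (n%:R * y - c) ^+ 2.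
Proof.
elim: n c => [|n IH] c /=; first by ring.
rewrite (eq_bern _ _ (h := fun k => (k%:R - (c - 1)) ^+ 2)); last first.
  by move=> k; rewrite -natr1; ring.
by rewrite !IH -natr1; ring.
Qed.

(** Bernstein's proof of the Weierstrass theorem: uniform continuity for k / n close to y,
    Chebyshev's inequality and the binomial variance otherwise. *)
Lemma bern_approx (Phi : R -> R) (M eps : R) : continuous Phi ->
  (forall y, `|Phi y| <= M) -> 0 < eps ->
  exists n : nat, forall y, 0 <= y <= 1 ->
    `|Phi y - bern n (fun k => Phi (k%:R / n%:R)) y| <= eps.
Proof.
move=> cPhi PhiM e0; have e2 : 0 < eps / 2 by rewrite divr_gt0.
have [de de0 Hde] := uniformly_continuous_segment 1 cPhi e2.
have M0 : 0 <= M by rewrite (le_trans _ (PhiM 0)).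
have [n0 Hn0] := natr_ge (2 * M / de ^+ 2 / (eps / 2)).
exists n0.+1 => y y01; set n := n0.+1.
have nR : 0 < n%:R :> R by rewrite ltr0n.
have := Hn0 n (leqnSn _); rewrite ler_pdivrMr// => nM.
have pw k : `|Phi y - Phi (k%:R / n%:R)| <=
    eps / 2 + 2 * M / de ^+ 2 / n%:R ^+ 2 * (k%:R - n%:R * y) ^+ 2.
  have -> : 2 * M / de ^+ 2 / n%:R ^+ 2 * (k%:R - n%:R * y) ^+ 2 =
      2 * M * ((y - k%:R / n%:R) ^+ 2 / de ^+ 2).
    by field; rewrite !gt_eqF.
  have [close|far] := ltP `|y - k%:R / n%:R| de.
    rewrite (@le_trans _ _ (eps / 2))//; last first.
      rewrite lerDl; apply: mulr_ge0; first exact: mulr_ge0.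
      by rewrite divr_ge0 ?sqr_ge0.
    apply: Hde => //; have /andP[y0 y1] := y01; by rewrite ger0_norm.
  have : 1 <= (y - k%:R / n%:R) ^+ 2 / de ^+ 2.
    rewrite ler_pdivlMr ?exprn_gt0// mul1r -[leRHS]real_normK ?num_real//.
    by rewrite ler_sqr ?nnegrE// ltW.
  have := ler_normB (Phi y) (Phi (k%:R / n%:R)).
  have := PhiM y; have := PhiM (k%:R / n%:R).
  set z := _ / de ^+ 2 => h1 h2 h3 h4; have : M <= M * z by rewrite ler_peMr.
  lra.
have bnd : eps / 2 + 2 * M / de ^+ 2 / n%:R ^+ 2 *
    bern n (fun k => (k%:R - n%:R * y) ^+ 2) y <= eps.
  rewrite bern_sqr subrr expr0n/= addr0.
  have -> : 2 * M / de ^+ 2 / n%:R ^+ 2 * (n%:R * (y * (1 - y))) =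
      2 * M / de ^+ 2 / n%:R * (y * (1 - y)) by field; rewrite !gt_eqF.
  have : 2 * M / de ^+ 2 / n%:R <= eps / 2 by rewrite ler_pdivrMr// (mulrC (eps / 2)).
  have : 0 <= 2 * M / de ^+ 2 / n%:R.
    by rewrite divr_ge0 ?ler0n// divr_ge0 ?sqr_ge0// mulr_ge0.
  have /andP[y0 y1] := y01; nra.
apply: le_trans bnd; apply: (le_trans (bern_dist n y01 pw)).
set B := 2 * M / _ / _.
rewrite (eq_bern _ _ (h := fun k => 1 * (eps / 2) + B * (k%:R - n%:R * y) ^+ 2)).
  by rewrite bern_lin bern_cst mul1r.
by move=> k; rewrite mul1r.
Qed.

End bernstein.

(** * Classes of test functions whose expectations converge *)

Section convergence_of_expectations.
Context (disp : measure_display) (Omega : measurableType disp) (R : realType).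
Variable P : probability Omega R.
Local Notation Ex := (mean P).
Variables (d : nat) (X : ('I_d -> nat) -> Omega -> R).
Hypothesis mX : forall n, mf (X n).
Implicit Types (phi psi : R -> R).

Definition bounded_continuous phi :=
  continuous phi /\ exists M : R, forall y, `|phi y| <= M.

Definition converges phi :=
  exists l : R, tends_to (fun n => Ex (fun x => phi (X n x))) l.

Lemma bc_cst (c : R) : bounded_continuous (fun=> c).
Proof. by split; [move=> y; exact: cvg_cst|exists `|c|]. Qed.

Lemma bcD phi psi : bounded_continuous phi -> bounded_continuous psi ->
  bounded_continuous (fun y => phi y + psi y).
Proof.
move=> [cphi [M HM]] [cpsi [N HN]]; split.
  by move=> y; apply: cvgD; [exact: cphi|exact: cpsi].
by exists (M + N) => y; rewrite (le_trans (ler_normD _ _))// lerD.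
Qed.

Lemma bcM phi psi : bounded_continuous phi -> bounded_continuous psi ->
  bounded_continuous (fun y => phi y * psi y).
Proof.
move=> [cphi [M HM]] [cpsi [N HN]]; split.
  by move=> y; apply: cvgM; [exact: cphi|exact: cpsi].
by exists (M * N) => y; rewrite normrM ler_pM.
Qed.

Lemma bcZ (c : R) phi : bounded_continuous phi ->
  bounded_continuous (fun y => c * phi y).
Proof. by apply: bcM; exact: bc_cst. Qed.

Lemma mf_bc phi n : bounded_continuous phi -> mf (fun x => phi (X n x)).
Proof. by move=> [cphi _]; apply: mf_comp. Qed.

Lemma integ_bc phi n : bounded_continuous phi -> integ P (fun x => phi (X n x)).
Proof.
by move=> bphi; have [_ [M HM]] := bphi; apply: (integ_bdd (M := M)) => //; exact: mf_bc.
Qed.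

Lemma convergesZ (c : R) phi : bounded_continuous phi -> converges phi ->
  converges (fun y => c * phi y).
Proof.
move=> bphi [l Hl]; exists (c * l); apply: tends_to_near Hl => eps e0.
exists 0%N => n _; rewrite ExZ ?subrr ?normr0 ?ltW//; exact: integ_bc.
Qed.

Lemma convergesD phi psi : bounded_continuous phi -> bounded_continuous psi ->
  converges phi -> converges psi -> converges (fun y => phi y + psi y).
Proof.
move=> bphi bpsi [l Hl] [l' Hl']; exists (l + l') => eps e0.
have e2 : 0 < eps / 2 by rewrite divr_gt0.
have [K HK] := eventually_all2 (Hl _ e2) (Hl' _ e2).
exists K => n /HK[]; rewrite ExD; [|exact: integ_bc|exact: integ_bc].
set a := Ex _; set b := Ex _ => h1 h2.
rewrite (_ : _ - _ = (a - l) + (b - l')); last by ring.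
by rewrite (le_trans (ler_normD _ _))//; lra.
Qed.

(** The values for large n and n' are within eps of each other; in particular they are almost
    decreasing, which provides the limit. *)
Lemma converges_approx phi : bounded_continuous phi ->
  (forall eps, 0 < eps -> exists2 psi, converges psi &
     eventually_all (fun n =>
       `|Ex (fun x => phi (X n x)) - Ex (fun x => psi (X n x))| <= eps)) ->
  converges phi.
Proof.
move=> bphi happ; apply: tends_to_almost_decreasing.
  have [_ [M HM]] := bphi; exists M => n; rewrite -[leRHS](Ex_cst P).
  by apply: abs_Ex_le => //; [exact: mf_bc|exact: integ_cst].
move=> eps e0; have e4 : 0 < eps / 4 by rewrite divr_gt0.
have [psi [l Hl] Hpsi] := happ _ e4.
have [K HK] := eventually_all2 Hpsi (Hl _ e4).
exists K => n /HK; rewrite !ler_distl => -[/andP[? ?] /andP[? ?]].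
exists K => n' /HK; rewrite !ler_distl => -[/andP[? ?] /andP[? ?]].
lra.
Qed.

Lemma bc_bern (y : R -> R) n g : bounded_continuous y ->
  bounded_continuous (fun x => bern n g (y x)).
Proof.
move=> by_; elim: n g => [|n IH] g /=; first exact: bc_cst.
apply: bcD; apply: bcM => //.
by under eq_fun do rewrite -mulN1r; apply: bcD; [exact: bc_cst|exact: bcZ].
Qed.

Lemma converges_bern (y : R -> R) : bounded_continuous y ->
  (forall k, converges (fun x => y x ^+ k)) ->
  forall n g, converges (fun x => bern n g (y x)).
Proof.
move=> by_ yk n g.
have bX k : bounded_continuous (fun x => y x ^+ k).
  elim: k => [|k IH]; first by under eq_fun do rewrite expr0; exact: bc_cst.
  by under eq_fun do rewrite exprS; exact: bcM.
have bbern m h := bc_bern m h by_.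
suff H k : converges (fun x => bern n g (y x) * y x ^+ k).
  by have := H 0%N; under eq_fun do rewrite expr0 mulr1.
elim: n g k => [|n IH] g k /=; first exact: convergesZ.
have b0 h m : bounded_continuous (fun x => bern n h (y x) * y x ^+ m) by exact: bcM.
rewrite (_ : (fun x => _) = (fun x => bern n (fun k => g k.+1) (y x) * y x ^+ k.+1
  + (bern n g (y x) * y x ^+ k + (-1) * (bern n g (y x) * y x ^+ k.+1)))); last first.
  by apply/funext => x; rewrite !exprS; ring.
apply: convergesD => //.
  by apply: bcD => //; exact: bcZ.
apply: convergesD => //; first exact: bcZ.
exact: convergesZ.
Qed.

Lemma converges_comp (y Phi : R -> R) : continuous y -> (forall x, 0 <= y x <= 1) ->
  bounded_continuous Phi -> (forall k, converges (fun x => y x ^+ k)) ->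
  converges (fun x => Phi (y x)).
Proof.
move=> cy y01 [cPhi [M HM]] yk.
have by_ : bounded_continuous y.
  split => //; exists 1 => x; have /andP[y0 y1] := y01 x; by rewrite ger0_norm.
have bPhi : bounded_continuous (fun x => Phi (y x)).
  split; last by exists M.
  by move=> x; apply: (@continuous_comp _ _ _ y Phi); [exact: cy|exact: cPhi].
apply: converges_approx => // eps e0.
have [n Hn] := bern_approx cPhi HM e0.
exists (fun x => bern n (fun k => Phi (k%:R / n%:R)) (y x)).
  exact: converges_bern.
exists 0%N => m _.
have bb : bounded_continuous (fun x => bern n (fun k => Phi (k%:R / n%:R)) (y x)).
  exact: bc_bern.
rewrite -ExB; [|exact: integ_bc (fun x => Phi (y x)) _ bPhi|exact: integ_bc _ _ bb].
rewrite -[leRHS](Ex_cst P); apply: abs_Ex_le.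
- apply: mfB; [exact: (mf_bc (phi := fun x => Phi (y x)))|exact: (mf_bc _ bb)].
- exact: integ_cst.
- by move=> x; exact: Hn.
Qed.

(* [y] maps the line into [0, 1] and [z] inverts it on the part of [D] where
   the variables mostly live. *)
Lemma converges_of_charts (D : set R) (C : R) : (forall n x, D (X n x)) ->
  (forall n, integ P (X n)) ->
  eventually_all (fun n => Ex (fun x => `|X n x|) <= C) ->
  (forall K : R, 0 < K -> exists y z : R -> R,
    [/\ continuous y, forall x, 0 <= y x <= 1, continuous z,
        forall x, D x -> `|x| <= K -> z (y x) = x &
        forall k, converges (fun x => y x ^+ k)]) ->
  forall phi, bounded_continuous phi -> converges phi.
Proof.
move=> XD iX XC charts phi bphi; have [cphi [M HM]] := bphi.
apply: converges_approx => // eps e0.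
have M0 : 0 <= M by rewrite (le_trans _ (HM 0)).
(* Outside [-K, K] the error is at most 2 M |X| / K, whose mean is then below eps by the bound on
   the first moments. *)
pose K : R := 2 * M * `|C| / eps + 1.
have K0 : 0 < K by rewrite ltr_wpDl// divr_ge0 ?(ltW e0)// !mulr_ge0.
have [y [z [cy y01 cz zy yk]]] := charts K K0.
have bphiz : bounded_continuous (fun u => phi (z u)).
  split; last by exists M.
  by move=> x; apply: (@continuous_comp _ _ _ z phi); [exact: cz|exact: cphi].
exists (fun x => phi (z (y x))); first exact: converges_comp cy y01 bphiz yk.
have bb : bounded_continuous (fun x => phi (z (y x))).
  split; last by exists M.
  by move=> x; apply: (@continuous_comp _ _ _ y (fun u => phi (z u))); [exact: cy|exact: bphiz.1].
have [N HN] := XC; exists N => n /HN {}HN.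
rewrite -ExB; [|exact: integ_bc|exact: integ_bc (fun x => phi (z (y x))) _ bb].
have iaX := integ_abs (iX n).
apply: (@le_trans _ _ (Ex (fun x => 2 * M / K * `|X n x|))).
  apply: abs_Ex_le.
  - by apply: mfB; [exact: mf_bc|exact: (mf_bc (phi := fun x => phi (z (y x))))].
  - exact: integZ.
  move=> x; have [XK|KX] := leP `|X n x| K.
    by rewrite zy// subrr normr0 mulr_ge0// divr_ge0 ?mulr_ge0// ltW.
  rewrite (le_trans (ler_normB _ _))//; apply: (@le_trans _ _ (2 * M)).
    by have := HM (X n x); have := HM (z (y (X n x))); lra.
  rewrite -mulrA ler_peMr ?mulr_ge0// mulrC ler_pdivlMr// mul1r; exact: ltW.
rewrite ExZ//; apply: (@le_trans _ _ (2 * M / K * `|C|)).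
  apply: ler_wpM2l; first by rewrite divr_ge0 ?mulr_ge0// ltW.
  by rewrite (le_trans HN)// ler_norm.
rewrite mulrAC ler_pdivrMr//.
have -> : eps * K = 2 * M * `|C| + eps by rewrite /K; field; rewrite gt_eqF.
by rewrite lerDl ltW.
Qed.

End convergence_of_expectations.

(** * Positive functionals determined by a distribution function *)

Section positive_functionals.
Context (R : realType).
Implicit Types (phi psi : R -> R) (Lam : (R -> R) -> R) (a b k y : R).

(** A normalized positive linear functional on the bounded continuous functions: both a law and a
    pointwise limit of expectations are of this kind. The law of the limit is constructed through
    its distribution function. *)
Record state Lam : Prop := {
  state_le : forall phi psi, bounded_continuous phi -> bounded_continuous psi ->
    (forall y, phi y <= psi y) -> Lam phi <= Lam psi;
  stateD : forall phi psi, bounded_continuous phi -> bounded_continuous psi ->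
    Lam (fun y => phi y + psi y) = Lam phi + Lam psi;
  stateZ : forall c phi, bounded_continuous phi ->
    Lam (fun y => c * phi y) = c * Lam phi;
  state_cst : forall c, Lam (fun=> c) = c }.

Lemma bc_sum (n : nat) (phi : nat -> R -> R) :
  (forall i, bounded_continuous (phi i)) ->
  bounded_continuous (fun y => \sum_(i < n) phi i y).
Proof.
move=> bphi; elim: n => [|n IH].
  by under eq_fun do rewrite big_ord0; exact: bc_cst.
by under eq_fun do rewrite big_ord_recr/=; exact: bcD.
Qed.

Lemma state_sum Lam (n : nat) (phi : nat -> R -> R) : state Lam ->
  (forall i, bounded_continuous (phi i)) ->
  Lam (fun y => \sum_(i < n) phi i y) = \sum_(i < n) Lam (phi i).
Proof.
move=> SL bphi; elim: n => [|n IH].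
  by under eq_fun do rewrite big_ord0; rewrite big_ord0 (state_cst SL).
under eq_fun do rewrite big_ord_recr/=.
by rewrite big_ord_recr/= (stateD SL)// ?IH//; exact: bc_sum.
Qed.

(** For [k > 0], a continuous version of the indicator of ]-oo, a]: it is 1 up to a, 0 from a + 1 /
    k, and affine in between. *)
Definition ramp a k y : R := Num.max 0 (Num.min 1 (1 - k * (y - a))).

Lemma ramp_spec a k y : [\/ ramp a k y = 1 /\ k * (y - a) <= 0,
  ramp a k y = 0 /\ 1 <= k * (y - a) |
  ramp a k y = 1 - k * (y - a) /\ 0 <= k * (y - a) <= 1].
Proof.
rewrite /ramp minElt maxElt; case: (ltP 1 (1 - k * (y - a))) => h1.
  by rewrite ltr01; constructor 1; split => //; lra.
case: (ltP 0 (1 - k * (y - a))) => h2; first by constructor 3; split => //; lra.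
by constructor 2; split => //; lra.
Qed.

Lemma ramp01 a k y : 0 <= ramp a k y <= 1.
Proof. by case: (ramp_spec a k y) => -[-> ?]; lra. Qed.

Lemma bc_ramp a k : bounded_continuous (ramp a k).
Proof.
split; last first.
  exists 1 => y; have /andP[r0 r1] := ramp01 a k y; by rewrite ger0_norm.
move=> y; apply: (@continuous_max _ _ (fun=> 0) (fun y => Num.min 1 (1 - k * (y - a))) y).
  exact: cvg_cst.
apply: (@continuous_min _ _ (fun=> 1) (fun y => 1 - k * (y - a)) y); first exact: cvg_cst.
apply: cvgB; first exact: cvg_cst.
by apply: cvgMr; apply: cvgB; [exact: cvg_id|exact: cvg_cst].
Qed.

Lemma ramp_le a b k y : 0 < k -> a <= b -> ramp a k y <= ramp b k y.
Proof.
move=> k0 ab; have : k * (y - b) <= k * (y - a) by rewrite ler_pM2l//; lra.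
by case: (ramp_spec a k y) => -[-> ?]; case: (ramp_spec b k y) => -[-> ?]; lra.
Qed.

Lemma ramp_le_far a b k k' y : 0 < k -> 0 < k' -> a + k^-1 <= b ->
  ramp a k y <= ramp b k' y.
Proof.
move=> k0 k'0 ab; have /andP[r0 r1] := ramp01 a k y.
have [yb|by_] := leP y b.
  rewrite (_ : ramp b k' y = 1)//.
  have : k' * (y - b) <= 0 by rewrite pmulr_rle0//; lra.
  by case: (ramp_spec b k' y) => -[-> ?]; lra.
rewrite (_ : ramp a k y = 0); first by have /andP[] := ramp01 b k' y.
have : 1 <= k * (y - a) by rewrite -ler_pdivrMl// mulr1; lra.
by case: (ramp_spec a k y) => -[-> ?]; lra.
Qed.

Lemma ramp_lipschitz a b k y : 0 < k -> a <= b ->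
  ramp b k y <= ramp a k y + k * (b - a).
Proof.
move=> k0 ab; have : 0 <= k * (b - a) by apply: mulr_ge0; [exact: ltW|rewrite subr_ge0].
have : k * (y - a) = k * (y - b) + k * (b - a) by ring.
by case: (ramp_spec a k y) => -[-> ?]; case: (ramp_spec b k y) => -[-> ?]; lra.
Qed.

(** A descent of slope k is the average of m descents of slope k m on consecutive intervals. *)
Lemma ramp_split (m : nat) a k y : (0 < m)%N -> 0 < k ->
  ramp a k y = m%:R^-1 * \sum_(l < m) ramp (a + l%:R / (k * m%:R)) (k * m%:R) y.
Proof.
move=> m0 k0; have mR : 0 < m%:R :> R by rewrite ltr0n.
pose v := k * m%:R * (y - a).
have vE (l : nat) : k * m%:R * (y - (a + l%:R / (k * m%:R))) = v - l%:R.
  by rewrite /v; field; rewrite !gt_eqF.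
have H (n : nat) : \sum_(l < n) ramp (a + l%:R / (k * m%:R)) (k * m%:R) y =
    Num.max 0 (Num.min n%:R (n%:R - v)).
  elim: n => [|n IH].
    rewrite big_ord0 sub0r minElt maxElt; case: (ltP 0 (- v)) => h.
      by rewrite ltxx.
    by rewrite ltNge h.
  rewrite big_ord_recr/= IH; have := ramp_spec (a + n%:R / (k * m%:R)) (k * m%:R) y.
  rewrite vE -natr1 !minElt !maxElt; have n0 : 0 <= n%:R :> R by rewrite ler0n.
  case: (ltP n%:R (n%:R - v)) => h1; case: (ltP (n%:R + 1) (n%:R + 1 - v)) => h2;
  try lra.
    case: (ltP 0 n%:R) => h3; case: (ltP 0 (n%:R + 1)) => h4 -[][-> ?]; lra.
  case: (ltP 0 (n%:R - v)) => h3; case: (ltP 0 (n%:R + 1 - v)) => h4 -[][-> ?]; lra.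
rewrite H; have := ramp_spec a k y; have vk : k * (y - a) = v / m%:R.
  by rewrite /v; field; rewrite gt_eqF.
rewrite vk ler_pdivrMr// mul0r !ler_pdivlMr// !mul1r ler_pdivrMr// mul1r.
rewrite minElt maxElt; case: (ltP m%:R (m%:R - v)) => h1.
  by rewrite mR mulVf ?gt_eqF// => -[][-> ?] //; lra.
case: (ltP 0 (m%:R - v)) => h2.
  rewrite mulrBr mulVf ?gt_eqF// (mulrC _ v) => -[][-> h] //; last by exfalso; lra.
  by rewrite (_ : v = 0) ?mul0r ?subr0//; lra.
rewrite mulr0 => -[][-> h] //; first by exfalso; lra.
have -> : v = m%:R by lra.
by rewrite divff ?gt_eqF// subrr.
Qed.

Section agreement.
Variables (Lam1 Lam2 : (R -> R) -> R) (F : R -> R).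
Hypothesis S1 : state Lam1.
Hypothesis S2 : state Lam2.
Hypothesis F01 : forall a, 0 <= F a <= 1.
Hypothesis sandwich1 : forall a k, 0 < k -> F a <= Lam1 (ramp a k) <= F (a + k^-1).
Hypothesis sandwich2 : forall a k, 0 < k -> F a <= Lam2 (ramp a k) <= F (a + k^-1).

(** After [ramp_split], both values lie between two averages of [F] whose grids differ by one step.
    These differ by a telescoping sum, at most 1 / m, even where [F] jumps. *)
Lemma states_agree_ramp a k : 0 < k -> Lam1 (ramp a k) = Lam2 (ramp a k).
Proof.
move=> k0; suff H (m : nat) : (0 < m)%N ->
    `|Lam1 (ramp a k) - Lam2 (ramp a k)| <= m%:R^-1.
  apply/eqP; rewrite -subr_eq0 -normr_le0; apply/ler_addgt0Pr => e e0; rewrite add0r.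
  have [n0 Hn0] := natr_ge e^-1.
  apply: (le_trans (H n0.+1 isT)); rewrite -[leRHS]invrK lef_pV2 ?posrE ?invr_gt0//.
  exact: Hn0.
move=> m0; have mR : 0 < m%:R :> R by rewrite ltr0n.
have km0 : 0 < k * m%:R by rewrite mulr_gt0.
pose x l : R := a + l%:R / (k * m%:R).
have xS l : x l + (k * m%:R)^-1 = x l.+1.
  by rewrite /x -natr1; field; rewrite !gt_eqF.
have E Lam : state Lam -> Lam (ramp a k) =
    m%:R^-1 * \sum_(l < m) Lam (ramp (x l) (k * m%:R)).
  move=> SL; rewrite -(@state_sum Lam m (fun l => ramp (x l) (k * m%:R)))//; last first.
    by move=> l; exact: bc_ramp.
  rewrite -(stateZ SL); last first.
    apply: (@bc_sum m (fun l => ramp (x l) (k * m%:R))) => l; exact: bc_ramp.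
  by congr Lam; apply/funext => y; exact: ramp_split.
have tel : \sum_(l < m) F (x l.+1) - \sum_(l < m) F (x l) = F (x m) - F (x 0%N).
  by rewrite -sumrB -(telescope_sumr (fun l => F (x l)) (leq0n m)) big_mkord.
have sand Lam : (forall b k', 0 < k' -> F b <= Lam (ramp b k') <= F (b + k'^-1)) ->
    \sum_(l < m) F (x l) <= \sum_(l < m) Lam (ramp (x l) (k * m%:R)) <=
    \sum_(l < m) F (x l.+1).
  move=> SL; apply/andP; split; apply: ler_sum => l _.
    by have /andP[] := SL (x l) _ km0.
  by have /andP[_] := SL (x l) _ km0; rewrite xS.
rewrite (E _ S1) (E _ S2) -mulrBr normrM ger0_norm ?invr_ge0 ?ler0n//.
rewrite -[leRHS]mulr1 ler_pM2l ?invr_gt0//.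
have /andP[? ?] := sand _ sandwich1; have /andP[? ?] := sand _ sandwich2.
have /andP[? ?] := F01 (x m); have /andP[? ?] := F01 (x 0%N).
rewrite ler_norml; lra.
Qed.

Hypothesis F_low : forall eps, 0 < eps -> exists A : R, forall a, a <= A -> F a <= eps.
Hypothesis F_high : forall eps, 0 < eps ->
  exists A : R, forall a, A <= a -> 1 - eps <= F a.

(** On a large interval [phi] is close to a linear combination of ramps, where the functionals
    agree; the behavior of [F] at infinity makes the rest negligible for both. *)
Lemma states_agree phi : bounded_continuous phi -> Lam1 phi = Lam2 phi.
Proof.
move=> bphi; have [cphi [M HM]] := bphi.
have M0 : 0 <= M by rewrite (le_trans _ (HM 0)).
suff H eps : 0 < eps -> `|Lam1 phi - Lam2 phi| <= 2 * (M * (2 * eps) + eps).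
  apply/eqP; rewrite -subr_eq0 -normr_le0; apply/ler_addgt0Pr => e e0; rewrite add0r.
  have c0 : 0 < 4 * M + 2 by rewrite ltr_wpDl// mulr_ge0.
  apply: (le_trans (H (e / (4 * M + 2)) _)); first by rewrite divr_gt0.
  by rewrite le_eqVlt; apply/orP; left; apply/eqP; field; rewrite gt_eqF.
move=> e0; have [A1 HA1] := F_low e0; have [A2 HA2] := F_high e0.
(* The additional 1 absorbs the shift by 1 / k in the sandwich at -A. *)
have [A3 HA3] := natr_ge (`|A1| + `|A2| + 1); pose A := A3.
have AE := HA3 A (leqnn _).
have [de de0 Hde] := uniformly_continuous_segment (A%:R + 2) cphi e0.
have [k1 Hk1] := natr_ge de^-1; pose k := k1.+1.
have kR : 1 <= k%:R :> R by rewrite ler1n.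
have k0 : 0 < k%:R :> R by rewrite ltr0n.
have kde : k%:R^-1 < de.
  rewrite -[ltRHS]invrK ltf_pV2 ?posrE ?invr_gt0//.
  by rewrite (le_lt_trans (Hk1 k1 (leqnn _)))// ltr_nat.
have ki1 : k%:R^-1 <= 1 :> R by rewrite invf_le1.
pose N := (2 * A * k)%N; pose x l : R := - A%:R + l%:R / k%:R.
have xS l : x l.+1 = x l + k%:R^-1 by rewrite /x -natr1; field; rewrite gt_eqF.
have xN : x N = A%:R by rewrite /x /N !natrM; field; rewrite gt_eqF.
have x0 : x 0%N = - A%:R by rewrite /x mul0r addr0.
(* A hat function supported in [x l, x (l + 2)] with peak at x (l + 1). Together the hats form a
   partition of unity in the middle of the window. *)
pose t l y := ramp (x l.+1) k%:R y - ramp (x l) k%:R y.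
have bt l : bounded_continuous (t l).
  rewrite (_ : t l = (fun y => ramp (x l.+1) k%:R y + (-1) * ramp (x l) k%:R y)).
    by apply: bcD; [exact: bc_ramp|apply: bcZ; exact: bc_ramp].
  by apply/funext => y; rewrite /t mulN1r.
have t0 l y : 0 <= t l y.
  by rewrite subr_ge0 ramp_le// xS lerDl invr_ge0 ltW.
have st y : \sum_(l < N) t l y = ramp A%:R k%:R y - ramp (- A%:R) k%:R y.
  by rewrite -x0 -xN -(telescope_sumr (fun l => ramp (x l) k%:R y) (leq0n N)) big_mkord.
pose phit y := \sum_(l < N) phi (x l.+1) * t l y.
have bphit : bounded_continuous phit.
  by apply: (@bc_sum N (fun l y => phi (x l.+1) * t l y)) => l; exact: bcZ.
(* What the hats leave uncovered: one minus their sum. *)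
pose theta y := 1 + (-1) * ramp A%:R k%:R y + ramp (- A%:R) k%:R y.
have btheta : bounded_continuous theta.
  apply: bcD; last exact: bc_ramp.
  by apply: bcD; [exact: bc_cst|apply: bcZ; exact: bc_ramp].
have xlN l : (l < N)%N -> - A%:R <= x l /\ x l.+2 <= A%:R + 1.
  move=> lN; split; first by rewrite /x lerDl divr_ge0 ?ler0n.
  have : x l.+1 <= x N.
    by rewrite /x lerD2l ler_pM2r ?invr_gt0// ler_nat.
  by rewrite xN => ?; rewrite xS; lra.
have close y : `|phi y - phit y| <= M * theta y + eps.
  have -> : phi y - phit y = phi y * theta y + \sum_(l < N) (phi y - phi (x l.+1)) * t l y.
    under [in RHS]eq_bigr do rewrite mulrBl.
    by rewrite sumrB -mulr_sumr st /phit /theta; ring.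
  have th0 : 0 <= theta y.
    have /andP[_ r1] := ramp01 A%:R k%:R y; have /andP[r0 _] := ramp01 (- A%:R) k%:R y.
    by rewrite /theta; lra.
  rewrite (le_trans (ler_normD _ _))// lerD//.
    by rewrite normrM (ger0_norm th0) ler_wpM2r.
  rewrite (le_trans (ler_norm_sum _ _ _))//.
  apply: (@le_trans _ _ (\sum_(l < N) eps * t l y)); last first.
    rewrite -mulr_sumr st; apply: ler_piMr; first exact: ltW.
    have /andP[_ r1] := ramp01 A%:R k%:R y; have /andP[r0 _] := ramp01 (- A%:R) k%:R y.
    lra.
  apply: ler_sum => l _; rewrite normrM (ger0_norm (t0 l y)).
  have [lo hi] := xlN l (ltn_ord l).
  have [yl|ly] := leP y (x l).
    have h1 : ramp (x l) k%:R y = 1.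
      have : k%:R * (y - x l) <= 0 by rewrite pmulr_rle0//; lra.
      by case: (ramp_spec (x l) k%:R y) => -[-> ?]; lra.
    have h2 : ramp (x l.+1) k%:R y = 1.
      have := ramp_le y k0 (_ : x l <= x l.+1); rewrite h1 xS lerDl invr_ge0 ler0n.
      by move=> /(_ isT); have /andP[] := ramp01 (x l + k%:R^-1) k%:R y; lra.
    by rewrite /t h1 h2 subrr !mulr0.
  have [ly2|yl2] := leP (x l.+2) y.
    have far b : b + k%:R^-1 <= y -> ramp b k%:R y = 0.
      move=> hb; have : 1 <= k%:R * (y - b) by rewrite -ler_pdivrMl// mulr1; lra.
      by case: (ramp_spec b k%:R y) => -[-> ?]; lra.
    rewrite /t !far ?subrr ?mulr0//; first by move: ly2; rewrite !xS; lra.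
    by apply: le_trans ly2; rewrite !xS; have := ltW k0; rewrite -invr_ge0; lra.
  rewrite ler_wpM2r//; apply: Hde.
    by move: yl2 hi lo ly; rewrite !xS ler_norml; lra.
  by move: yl2 ly kde; rewrite !xS ltr_norml; lra.
have tight Lam : state Lam ->
    (forall b k', 0 < k' -> F b <= Lam (ramp b k') <= F (b + k'^-1)) ->
    `|Lam phi - Lam phit| <= M * (2 * eps) + eps.
  move=> SL sand.
  have bbd : bounded_continuous (fun y => M * theta y + eps).
    by apply: bcD; [exact: bcZ|exact: bc_cst].
  have Lth : Lam (fun y => M * theta y + eps) <= M * (2 * eps) + eps.
    rewrite (stateD SL) ?(state_cst SL) ?(stateZ SL)//;
      [|exact: bcZ|exact: bc_cst].
    rewrite lerD2r ler_wpM2l// (stateD SL); [|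
      by apply: bcD; [exact: bc_cst|apply: bcZ; exact: bc_ramp]|exact: bc_ramp].
    rewrite (stateD SL) ?(state_cst SL) ?(stateZ SL)//; [|exact: bc_ramp|exact: bc_cst
      |apply: bcZ; exact: bc_ramp].
    have /andP[h1 _] := sand A%:R _ k0; have /andP[_ h2] := sand (- A%:R) _ k0.
    have h3 : 1 - eps <= F A%:R.
      by apply: HA2; have := ler_norm A2; have := normr_ge0 A1; lra.
    have h4 : F (- A%:R + k%:R^-1) <= eps.
      apply: HA1; have := ler_norm (- A1); rewrite normrN.
      by have := normr_ge0 A2; lra.
    lra.
  have bN g : bounded_continuous g -> bounded_continuous (fun y => (-1) * g y).
    exact: bcZ.
  have bd : bounded_continuous (fun y => phi y + (-1) * phit y).
    by apply: bcD => //; exact: bN.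
  have dE : Lam (fun y => phi y + (-1) * phit y) = Lam phi - Lam phit.
    by rewrite (stateD SL) ?(stateZ SL) ?mulN1r//; exact: bN.
  rewrite -dE ler_norml; apply/andP; split; last first.
    apply: le_trans Lth; apply: (state_le SL) => // y.
    by have := close y; rewrite ler_norml => /andP[_]; rewrite mulN1r.
  rewrite -[leRHS]opprK lerN2 -(mulN1r (Lam _)) -(stateZ SL)//.
  apply: le_trans Lth; apply: (state_le SL) => //; first exact: bcZ.
  by move=> y; have := close y; rewrite ler_norml => /andP[? _]; lra.
have phitE : Lam1 phit = Lam2 phit.
  have E Lam : state Lam -> Lam phit =
      \sum_(l < N) phi (x l.+1) * (Lam (ramp (x l.+1) k%:R) - Lam (ramp (x l) k%:R)).
    move=> SL; rewrite (@state_sum Lam N (fun l y => phi (x l.+1) * t l y))//; last first.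
      by move=> l; exact: bcZ.
    apply: eq_bigr => l _; rewrite (stateZ SL)//; congr (_ * _).
    rewrite -mulN1r -(stateZ SL); last exact: bc_ramp.
    rewrite -(stateD SL); [|exact: bc_ramp|apply: bcZ; exact: bc_ramp].
    by congr Lam; apply/funext => y; rewrite /t mulN1r.
  rewrite (E _ S1) (E _ S2); apply: eq_bigr => l _.
  by rewrite !states_agree_ramp.
have h1 := tight _ S1 sandwich1; have h2 := tight _ S2 sandwich2.
rewrite (_ : _ - _ = (Lam1 phi - Lam1 phit) - (Lam2 phi - Lam2 phit)); last first.
  by rewrite phitE; ring.
by rewrite (le_trans (ler_normB _ _))//; lra.
Qed.

End agreement.
End positive_functionals.

Lemma tends_toP (R : realType) d (h : ('I_d -> nat) -> R) l :
  tends_to h l <-> h n @[n --> @all_infty d] --> l.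
Proof.
split=> [H|/cvgrPdist_le H eps e0].
  apply/cvgrPdist_le => eps e0; have [K HK] := H _ e0.
  by exists K => // n /HK; rewrite distrC.
by have [K _ HK] := H _ e0; exists K => n /HK; rewrite distrC.
Qed.

(** * Laws with a given distribution function *)

Section law_of_cdf.
Context {R : realType} (F : cumulativeBounded (0 : R) (1 : R)).
Local Open Scope measure_display_scope.

(** The Lebesgue-Stieltjes measure is defined on the alias [measurableTypeR R]; its image by the
    identity is a law on [R]. *)
Let idTR : measurableTypeR R -> R := idfun.

#[local] HB.instance Definition _ :=
  @isMeasurableFun.Build _ _ _ _ idTR (@measurable_id _ _ setT).

Let lsF : probability (measurableTypeR R) R := lebesgue_stieltjes_measure F.

Lemma law_of_cumulative :
  exists nu : probability R R, forall r, nu `]-oo, r]%classic = (F r)%:E.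
Proof.
exists (distribution lsF (idTR : {RV lsF >-> R})) => r.
exact: (cdf_lebesgue_stieltjes_id F r).
Qed.

End law_of_cdf.

Lemma law_of_cdf (R : realType) (F : R -> R) : nondecreasing F ->
  right_continuous F -> F @ -oo --> (0 : R) -> F @ +oo --> (1 : R) ->
  exists nu : probability R R, forall r, nu `]-oo, r]%classic = (F r)%:E.
Proof.
move=> ndF rcF F0 F1.
exact: (law_of_cumulative (CumulativeBounded.Pack (CumulativeBounded.Class
  (isCumulativeBounded.Build R 0 1 F F0 F1) (isCumulative.Build R _ R F ndF rcF)))).
Qed.

Section state_of_law.
Context (R : realType) (nu : probability R R).

Lemma bc_mf (phi : R -> R) : bounded_continuous phi -> mf phi.
Proof. by move=> [cphi _]; exact: continuous_measurable_fun. Qed.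

Lemma bc_integ (phi : R -> R) : bounded_continuous phi -> integ nu phi.
Proof.
by move=> bphi; have [_ [M HM]] := bphi; apply: (integ_bdd (M := M)) => //; exact: bc_mf.
Qed.

Lemma state_of_law : state (fun phi => mean nu phi).
Proof.
split.
- by move=> phi psi bphi bpsi ?; apply: le_Ex => //; exact: bc_integ.
- by move=> phi psi bphi bpsi; rewrite ExD//; exact: bc_integ.
- by move=> c phi bphi; rewrite ExZ//; exact: bc_integ.
- by move=> c; rewrite Ex_cst.
Qed.

Lemma cdf_ramp (F : R -> R) : (forall r, nu `]-oo, r]%classic = (F r)%:E) ->
  forall a k, 0 < k -> F a <= mean nu (ramp a k) <= F (a + k^-1).
Proof.
move=> nuF a k k0.
have FE r : F r = mean nu (\1_(`]-oo, r]%classic)).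
  transitivity (mean nu (fun x => \1_(`]-oo, r]%classic) x * 1)).
    by rewrite Ex_indic//; [rewrite integral_cst//= mul1e nuF|exact: integ_cst].
  by apply: eq_Ex => x; rewrite mulr1.
have i1 r : integ nu (\1_(`]-oo, r]%classic)).
  apply: (integ_bdd (M := 1)); first exact: measurable_indic.
  by move=> x; rewrite indicE; case: (_ \in _); rewrite ?normr1 ?normr0.
have ir : integ nu (ramp a k) by apply: bc_integ; exact: bc_ramp.
rewrite !FE; apply/andP; split; apply: le_Ex => // y.
  rewrite indicE; case: (boolP (y \in _)) => [|_]; last by case/andP: (ramp01 a k y).
  rewrite inE/= in_itv/= => ya; have : k * (y - a) <= 0 by rewrite pmulr_rle0//; lra.
  by case: (ramp_spec a k y) => -[-> ?]; lra.
rewrite indicE; case: (boolP (y \in _)) => [_|]; first by case/andP: (ramp01 a k y).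
rewrite notin_setE/= in_itv/= => /negP; rewrite -ltNge => ya.
have : 1 <= k * (y - a) by rewrite -ler_pdivrMl// mulr1; lra.
by case: (ramp_spec a k y) => -[-> ?]; lra.
Qed.

End state_of_law.

Section law_of_state.
Context (R : realType) (Lam : (R -> R) -> R).
Hypothesis SL : state Lam.
Hypothesis Lam_low : forall eps, 0 < eps ->
  exists A : R, forall a, a <= A -> Lam (ramp a 1) <= eps.
Hypothesis Lam_high : forall eps, 0 < eps ->
  exists A : R, forall a, A <= a -> 1 - eps <= Lam (ramp a 1).

(** The mass of ]-oo, a], approached from above by continuous functions; this choice makes [F] right
    continuous. *)
Let F a := inf [set Lam (ramp a k) | k in [set k | 0 < k]].

Let Lam_ge0 a k : 0 <= Lam (ramp a k).
Proof.
rewrite -[leLHS](state_cst SL); apply: (state_le SL); [exact: bc_cst|exact: bc_ramp|].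
by move=> y; case/andP: (ramp01 a k y).
Qed.

Let F_le a k : 0 < k -> F a <= Lam (ramp a k).
Proof.
move=> k0; apply: ge_inf; last by exists k.
by exists 0 => _ [k' _ <-].
Qed.

Let F_ge a c : (forall k, 0 < k -> c <= Lam (ramp a k)) -> c <= F a.
Proof.
move=> H; apply: lb_le_inf; first by exists (Lam (ramp a 1)); exists 1 => /=.
by move=> _ [k k0 <-]; exact: H.
Qed.

Let sandwich a k : 0 < k -> F a <= Lam (ramp a k) <= F (a + k^-1).
Proof.
move=> k0; rewrite F_le//=; apply: F_ge => k' k'0.
apply: (state_le SL); [exact: bc_ramp|exact: bc_ramp|].
by move=> y; exact: ramp_le_far.
Qed.

Let F01 a : 0 <= F a <= 1.
Proof.
apply/andP; split; first exact: F_ge.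
apply: (le_trans (F_le a ltr01)); rewrite -[leRHS](state_cst SL).
apply: (state_le SL); [exact: bc_ramp|exact: bc_cst|].
by move=> y; case/andP: (ramp01 a 1 y).
Qed.

Let F_nd : nondecreasing F.
Proof.
move=> a b ab; apply: F_ge => k k0; apply: (le_trans (F_le a k0)).
apply: (state_le SL); [exact: bc_ramp|exact: bc_ramp|].
by move=> y; exact: ramp_le.
Qed.

(** A ramp at [a] that is nearly optimal for the infimum dominates the ramp of the same slope at b >
    a up to k (b - a). *)
Let F_rc : right_continuous F.
Proof.
move=> a; apply/cvgrPdist_le => eps e0.
have e2 : 0 < eps / 2 by rewrite divr_gt0.
have [k k0 Hk] : exists2 k, 0 < k & Lam (ramp a k) < F a + eps / 2.
  have : has_inf [set Lam (ramp a k) | k in [set k | 0 < k]].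
    split; first by exists (Lam (ramp a 1)); exists 1 => /=.
    by exists 0 => _ [k' _ <-].
  by move=> /(inf_adherent e2)[_ [k k0 <-] H]; exists k.
near=> b.
have ab : a <= b by apply: ltW; near: b; exact: nbhs_right_gt.
have ba : k * (b - a) <= eps / 2.
  rewrite -ler_pdivlMl// lerBlDl; near: b; apply: nbhs_right_le.
  by rewrite ltrDl mulr_gt0// invr_gt0.
have FF := F_nd ab.
have : F b <= Lam (ramp a k) + k * (b - a).
  apply: (le_trans (F_le b k0)).
  rewrite -[X in _ + X](state_cst SL) -(stateD SL); [|exact: bc_ramp|exact: bc_cst].
  apply: (state_le SL); [exact: bc_ramp|apply: bcD; [exact: bc_ramp|exact: bc_cst]|].
  by move=> y; exact: ramp_lipschitz.
by rewrite ler_norml; lra.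
Unshelve. all: by end_near. Qed.

Let F_low eps : 0 < eps -> exists A : R, forall a, a <= A -> F a <= eps.
Proof.
by move=> /Lam_low[A HA]; exists A => a /HA; apply: le_trans; exact: F_le.
Qed.

Let F_high eps : 0 < eps -> exists A : R, forall a, A <= a -> 1 - eps <= F a.
Proof.
(* A ramp of slope 1 at a - 1 bounds [F] from below only at a, one unit further. *)
move=> /Lam_high[A HA]; exists (A + 1) => a Aa.
apply: (@le_trans _ _ (Lam (ramp (a - 1) 1))); first by apply: HA; lra.
by have /andP[_] := sandwich (a - 1) ltr01; rewrite invr1 subrK.
Qed.

Lemma law_of_state : exists nu : probability R R,
  forall phi, bounded_continuous phi -> mean nu phi = Lam phi.
Proof.
have [||nu nuF] := law_of_cdf F_nd F_rc.
- apply/cvgrPdist_le => eps /F_low[A HA]; near=> a.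
  have /HA : a <= A by near: a; apply: nbhs_ninfty_le; exact: num_real.
  by have := F01 a; rewrite sub0r normrN => /andP[? ?]; rewrite ger0_norm.
- apply/cvgrPdist_le => eps /F_high[A HA]; near=> a.
  have /HA : A <= a by near: a; apply: nbhs_pinfty_ge; exact: num_real.
  by have := F01 a => /andP[? ?]; rewrite ger0_norm; lra.
exists nu => phi bphi.
exact: (states_agree (state_of_law nu) SL F01 (cdf_ramp nuF) sandwich F_low F_high).
Unshelve. all: by end_near. Qed.

End law_of_state.

(** * The law of a limit of expectations *)

Section limit_law.
Context (disp : measure_display) (Omega : measurableType disp) (R : realType).
Variable P : probability Omega R.
Local Notation Ex := (mean P).
Variables (d : nat) (X : ('I_d -> nat) -> Omega -> R) (C : R).
Hypothesis mX : forall n, mf (X n).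
Hypothesis iX : forall n, integ P (X n).
Hypothesis XC : eventually_all (fun n => Ex (fun x => `|X n x|) <= C).
Hypothesis cX : forall phi, bounded_continuous phi -> converges P X phi.

Let Lam (phi : R -> R) := lim (Ex (fun x => phi (X n x)) @[n --> @all_infty d]).

Let LamP phi : bounded_continuous phi ->
  Ex (fun x => phi (X n x)) @[n --> @all_infty d] --> Lam phi.
Proof.
by move=> /cX[l /tends_toP Hl]; rewrite /Lam (cvg_lim _ Hl).
Qed.

Let state_Lam : state Lam.
Proof.
split.
- move=> phi psi bphi bpsi phipsi; rewrite -subr_ge0.
  apply: (cvgr_to_ge (cvgB (LamP bpsi) (LamP bphi))).
  apply: nearW => n /=; rewrite subr_ge0; apply: le_Ex; [exact: (integ_bc P mX n bphi)|exact: (integ_bc P mX n bpsi)|by move=> x].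
- move=> phi psi bphi bpsi; apply: cvg_lim => //.
  rewrite (_ : (fun n => _) = (fun n => Ex (fun x => phi (X n x)) + Ex (fun x => psi (X n x)))).
    by apply: cvgD; exact: LamP.
  by apply/funext => n; rewrite ExD//; exact: (integ_bc P mX n).
- move=> c phi bphi; apply: cvg_lim => //.
  rewrite (_ : (fun n => _) = (fun n => c * Ex (fun x => phi (X n x)))).
    by apply: cvgMr; exact: LamP.
  by apply/funext => n; rewrite ExZ//; exact: (integ_bc P mX n).
- move=> c; rewrite /Lam; under eq_fun do rewrite Ex_cst.
  by apply: cvg_lim => //; exact: cvg_cst.
Qed.

(** The bound on the first moments passes to the limit; applied to ramps it is Markov's inequality
    and gives tightness. *)
Let Lam_abs phi (c : R) : bounded_continuous phi -> 0 <= c ->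
  (forall y, phi y <= c * `|y|) -> Lam phi <= c * C.
Proof.
move=> bphi c0 H; apply: (cvgr_to_le (LamP bphi)).
have [K HK] := XC; exists K => // n /= /HK CK.
have iaX := integ_abs (iX n).
apply: (@le_trans _ _ (Ex (fun x => c * `|X n x|))).
  by apply: le_Ex => //; [exact: (integ_bc P mX n bphi)|exact: integZ].
by rewrite ExZ// ler_wpM2l.
Qed.

Lemma law_of_limit : exists nu : probability R R, forall phi, bounded_continuous phi ->
  tends_to (fun n => Ex (fun x => phi (X n x))) (mean nu phi).
Proof.
have le_eps (eps : R) : 0 < eps -> (`|C| / eps + 1)^-1 * C <= eps.
  move=> e0; have c0 : 0 < `|C| / eps + 1 by rewrite ltr_wpDl// divr_ge0// ltW.
  rewrite ler_pdivrMl// mulrDl mulfVK ?gt_eqF// mul1r.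
  by have := ler_norm C; lra.
have [||nu nuE] := law_of_state state_Lam.
(* The ramp may be nonzero up to a + 1; with 2 in the witness, |y| is still at least |C| / eps + 1
   there. *)
- move=> eps e0; exists (- (`|C| / eps + 2)) => a aA.
  have c0 : 0 < `|C| / eps + 1 by rewrite ltr_wpDl// divr_ge0// ltW.
  apply: le_trans (le_eps _ e0); apply: Lam_abs; first exact: bc_ramp.
    by rewrite invr_ge0 ltW.
  move=> y; rewrite ler_pdivlMl//; have := ler_norm (- y); rewrite normrN.
  have := normr_ge0 y.
  by case: (ramp_spec a 1 y) => -[-> ?]; rewrite ?mulr0 ?mulr1 //; nra.
- move=> eps e0; exists (`|C| / eps + 1) => a aA.
  have c0 : 0 < `|C| / eps + 1 by rewrite ltr_wpDl// divr_ge0// ltW.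
  have b1 : bounded_continuous (fun y => (-1) * ramp a 1 y).
    by apply: bcZ; exact: bc_ramp.
  rewrite lerBlDl -lerBlDr.
  have <- : Lam (fun y => 1 + (-1) * ramp a 1 y) = 1 - Lam (ramp a 1).
    rewrite (stateD state_Lam) ?(state_cst state_Lam) ?(stateZ state_Lam) ?mulN1r//.
      exact: bc_ramp.
    exact: bc_cst.
  apply: le_trans (le_eps _ e0); apply: Lam_abs.
  + by apply: bcD => //; exact: bc_cst.
  + by rewrite invr_ge0 ltW.
  move=> y; rewrite ler_pdivlMl//; have := ler_norm y; have := normr_ge0 y.
  by case: (ramp_spec a 1 y) => -[-> ?]; nra.
exists nu => phi bphi; rewrite nuE//; apply/tends_toP; exact: LamP.
Qed.

Lemma tends_to_cvg_in_distribution (nu : probability R R) :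
  (forall phi, bounded_continuous phi ->
     tends_to (fun n => Ex (fun x => phi (X n x))) (mean nu phi)) ->
  cvg_in_distribution (@all_infty d) P X nu.
Proof.
move=> H; split => // phi cphi bphi; have bc : bounded_continuous phi by split.
rewrite -EFin_Ex; last exact: bc_integ.
rewrite (_ : (fun i => _) = (fun i => (Ex (fun x => phi (X i x)))%:E)).
  by apply: cvg_EFin; [exact: nearW|exact/tends_toP/H].
by apply/funext => n; rewrite EFin_Ex//; exact: (integ_bc P mX n bc).
Qed.

End limit_law.

(** * Normalized block sums *)

Section square_integrable_differences.
Context (disp : measure_display) (Omega : measurableType disp) (R : realType).
Variable P : probability Omega R.
Local Notation Ex := (mean P).
Local Notation L2 := (L2 P).
Local Notation integ := (integ P).

Lemma Lfun2_L2 (f : Omega -> R) : f \in Lfun P 2%:E -> L2 f.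
Proof.
move=> fL; split; last exact: Lfun2_integrable_sqr.
by move: fL; rewrite inE => /andP[+ _]; rewrite inE.
Qed.

Lemma Lnorm2_sqr (f : Omega -> R) : L2 f ->
  ('N[P]_2%:E[EFin \o f] ^+ 2 = (Ex (fun x => f x ^+ 2))%:E)%E.
Proof.
move=> [mf0 fi]; rewrite EFin_Ex//.
transitivity ('N[P]_2%:E[EFin \o f] `^ 2)%E; last first.
  rewrite poweR_Lnorm//; apply: eq_integral => x _ /=.
  by rewrite powR_mulrn// real_normK ?num_real.
have := Lnorm_ge0 P 2%:E (EFin \o f).
case: ('N[P]_2%:E[EFin \o f])%E => [r||]//= r0.
  by rewrite powR_mulrn.
by rewrite (negbTE (_ : (2 : R) != 0)).
Qed.

(** Dominated convergence gives a level for each tolerance, and the axiom of choice a function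
    [Kf]. *)
Lemma L2_tail_controlled (f : Omega -> R) : L2 f ->
  exists Kf : R -> R, (forall eta, 0 < eta -> 0 <= Kf eta) /\ tail_controlled P Kf f.
Proof.
move=> fL; have H (eta : R) : exists K : R, 0 <= K /\
    (0 < eta -> Ex (fun x => excess K (f x) ^+ 2) <= eta).
  have [e0|e0] := ltP 0 eta; last by exists 0.
  have [||||N HN] := @Ex_vanish _ _ _ P (fun n x => excess n%:R (f x) ^+ 2)
      (fun x => f x ^+ 2) eta _ _ _ _ e0.
  - by move=> n; apply/mfX/mf_comp; [exact: continuous_excess|exact: L2_mf fL].
  - exact: fL.2.
  - by move=> n x; rewrite ger0_norm ?sqr_ge0// excess_sqr_le.
  - move=> x; have [N HN] := natr_ge `|f x|; exists N => n /HN fn.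
    by rewrite excess_eq0 ?expr0n.
  exists N%:R; split => // _; apply: le_trans (HN N (leqnn N)).
  exact: ler_norm.
have [Kf HKf] := choice H; exists Kf; split => [eta _|eta e0]; first exact: (HKf eta).1.
exact: (HKf eta).2.
Qed.

Variables (d : nat) (T : 'rV[int]_d -> Omega -> Omega).
Variable F : 'I_d -> int -> set_system Omega.
Hypothesis HF : multiple_filtration T F.

(** On a set of [F q (- 1)], which is also in [F q 0], both versions have the same integral as [f],
    so their difference integrates to 0. [sub_sigma_orth] extends this from sets to functions, after
    passing to a measurable version of the test function. *)
Lemma mdq_cond_exp q (f g0 g1 : Omega -> R) : L2 f ->
  is_cond_exp P (F q 0) f g0 -> is_cond_exp P (F q (- 1)) f g1 ->
  {ae P, forall x, f x = g0 x - g1 x} -> mdq P F q f.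
Proof.
move=> fL c0 c1 fE; have mf0 := L2_mf fL.
have F10 : F q (- 1) `<=` F q 0 by move=> A /(multiple_filtrationS HF); rewrite addNr.
have mcond i h : is_cond_exp P (F q i) f h -> F q i `<=` F q 0 ->
    measurable_fun [set: g_sigma_algebraType (F q 0)] (h : g_sigma_algebraType (F q 0) -> R).
  move=> ch Fi _ B mB; rewrite setTI; apply: sub_sigma_algebra; apply: Fi.
  exact: (cond_exp_measurable ch).
split=> //.
  split=> //; exists (fun x => g0 x - g1 x); split => //.
  by apply: measurable_funB; [exact: (mcond 0)|exact: (mcond (- 1))].
have orth A : F q (- 1) A -> Ex (fun x => \1_A x * f x) = 0.
  move=> FA; have mA := (multiple_filtration_sub HF q (- 1)).2 _ FA.
  have i0 := cond_exp_integrable c0; have i1 := cond_exp_integrable c1.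
  transitivity (Ex (fun x => \1_A x * (g0 x - g1 x))).
    apply: Ex_ae.
    - by apply: mfM => //; exact: measurable_indic.
    - apply: mfM; first exact: measurable_indic.
      by apply: mfB; exact: (integ_mf (P := P)).
    by apply: filterS fE => x ->.
  rewrite Ex_indic//; last exact: integB.
  under eq_integral do rewrite EFinB.
  rewrite integralB//; [|by apply: integrableS i0|by apply: integrableS i1].
  rewrite (cond_exp_integral c0)//; last exact: F10.
  rewrite (cond_exp_integral c1)// subee//.
  apply: integrable_fin_num => //.
  by apply: (integrableS measurableT) => //; exact: L2_integ.
move=> G [mG [g' [mg' Gg']]] GL.
have Gf : {ae P, forall x, G x * f x = g' x * f x} by apply: filterS Gg' => x ->.
have sub := multiple_filtration_sub HF q (- 1).
have mg'f : mf (fun x => g' x * f x) by apply: mfM => //; exact: (sub_sigma_mf sub mg').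
rewrite (Ex_ae _ mg'f Gf); last exact: mfM.
apply: (sub_sigma_orth sub (L2_integ fL) orth mg').
apply: (integ_aeq mg'f _ (L2_mul GL fL)).
by apply: filterS Gf => x ->.
Qed.

End square_integrable_differences.

(** * Block sums as iterated directional sums *)

Section iterated_block_sums.
Context (disp : measure_display) (Omega : measurableType disp) (R : realType).
Variable P : probability Omega R.
Variables (d : nat) (T : 'rV[int]_d -> Omega -> Omega).
Hypothesis HT : Zd_action P T.
Variables (f : Omega -> R) (n : 'I_d -> nat).
Hypothesis n0 : forall j, (0 < n j)%N.
Implicit Types (s : seq 'I_d) (q j : 'I_d) (k : block n).

Let w1 : 'I_d -> nat -> R := fun _ _ => 1.

Lemma block_index_steps k : block_index k = \sum_j step j (k j).+1.
Proof.
apply/rowP => i; rewrite mxE summxE (bigD1 i)//= stepE eqxx big1 ?addr0// => j ji.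
by rewrite stepE eq_sym (negbTE ji).
Qed.

(** The multi-index [k] freezes the coordinates outside [s]. In the induction the sum is split
    according to the value of the next coordinate, which is then frozen in turn. *)
Lemma sum_block_bsum s k x : uniq s ->
  \sum_(k' : block n | [forall (j | j \notin s), k' j == k j]) f (T (block_index k') x) =
  (\prod_(j <- s) Num.sqrt (n j)%:R) *
    bsum T s n w1 f (T (\sum_(j | j \notin s) step j (k j).+1) x).
Proof.
elim: s k => [k _|q s IH k /= /andP[qs us]].
  rewrite big_nil mul1r /= (big_pred1 k).
    by rewrite block_index_steps.
  move=> k'; apply/forall_inP/eqP => [kk'|-> j //].
  by apply/ffunP => j; apply/eqP; exact: kk'.
have nq : (n q)%:R != 0 :> R by rewrite pnatr_eq0 -lt0n.
rewrite (partition_big (fun k' : block n => k' q) predT)//= big_cons.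
rewrite /dirsum mulrACA divff ?mul1r; last by rewrite gt_eqF// sqrtr_gt0 ltr0n n0.
rewrite mulr_sumr; apply: eq_bigr => a _; rewrite mul1r.
pose ka : block n := [ffun j => eqtype.dfwith k a j].
have kaq : ka q = a by rewrite ffunE eqtype.dfwith_in.
have kaj j : j != q -> ka j = k j by move=> jq; rewrite ffunE eqtype.dfwith_out// eq_sym.
rewrite (action_comp HT).
have -> : step q a.+1 + \sum_(j | j \notin q :: s) step j (k j).+1 =
    \sum_(j | j \notin s) step j (ka j).+1.
  rewrite [RHS](bigD1 q)//= kaq; congr (_ + _); apply: eq_big => j.
    by rewrite inE negb_or andbC.
  by rewrite inE negb_or => /andP[jq _]; rewrite kaj.
rewrite -IH//; apply: eq_bigl => k'; apply/andP/forall_inP => [[/forall_inP H /eqP k'q] j js|H].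
  case: (eqVneq j q) => [->|jq]; first by rewrite k'q kaq.
  by rewrite kaj//; apply: H; rewrite inE negb_or jq.
split; last by rewrite (eqP (H q qs)) kaq.
apply/forall_inP => j; rewrite inE negb_or => /andP[jq js].
by rewrite -kaj//; exact: H.
Qed.

Lemma normalized_sum_bsum x : normalized_sum T f n x = bsum T (enum 'I_d) n w1 f x.
Proof.
pose k : block n := [ffun j => Ordinal (n0 j)].
have c0 : \prod_(j <- enum 'I_d) Num.sqrt (n j)%:R != 0 :> R.
  by rewrite prodf_seq_neq0; apply/allP => j _; rewrite gt_eqF// sqrtr_gt0 ltr0n n0.
have -> : bsum T (enum 'I_d) n w1 f x =
    (\prod_(j <- enum 'I_d) Num.sqrt (n j)%:R)^-1 * block_sum T f n x.
  apply: (mulfI c0); rewrite mulVKf//; have := sum_block_bsum k x (enum_uniq 'I_d).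
  have -> : \sum_(j | j \notin enum 'I_d) step j (k j).+1 = 0.
    by apply: big_pred0 => j; rewrite mem_enum.
  rewrite (action0 HT) => <-.
  apply: eq_bigl => k'; apply/forall_inP => j; by rewrite mem_enum.
rewrite /normalized_sum -big_enum/=; congr (_^-1 * _).
elim: (enum 'I_d) => [|j s IH]; first by rewrite !big_nil sqrtr1.
by rewrite !big_cons sqrtrM ?ler0n// IH.
Qed.

Lemma normalized_sum_squares_bracket q x :
  normalized_sum_squares T f q n x = bracket (slice_path T f q n w1) 0 (n q) x.
Proof.
pose k : block n := [ffun j => Ordinal (n0 j)].
rewrite /normalized_sum_squares /bracket.
have sE : rem q (enum 'I_d) =i predC1 q.
  by move=> j; rewrite mem_rem_uniq ?enum_uniq// !inE mem_enum andbT.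
have -> : \prod_(j < d) (n j)%:R = (n q)%:R * \prod_(j <- rem q (enum 'I_d)) (n j)%:R :> R.
  rewrite (bigD1 q)//=; congr (_ * _); rewrite -big_filter.
  apply: perm_big; apply: uniq_perm.
  - by rewrite filter_uniq// index_enum_uniq.
  - by rewrite rem_uniq// enum_uniq.
  - by move=> j; rewrite sE mem_filter mem_index_enum andbT.
rewrite invfM -mulrA; congr (_ * _); rewrite mulr_sumr.
apply: eq_bigr => a _.
pose ka : block n := [ffun j => eqtype.dfwith k a j].
have kaq : ka q = a by rewrite ffunE eqtype.dfwith_in.
have := sum_block_bsum ka x (rem_uniq q (enum_uniq 'I_d)).
have -> : \sum_(j | j \notin rem q (enum 'I_d)) step j (ka j).+1 = step q a.+1.
  rewrite (big_pred1 q) ?kaq// => j; by rewrite sE !inE negbK.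
rewrite (eq_bigl (fun k' : block n => k' q == a)); last first.
  move=> k'; apply/forall_inP/eqP => [H|k'a j].
    by rewrite (eqP (H q _)) ?sE ?inE ?eqxx.
  by rewrite sE !inE negbK => /eqP ->; rewrite k'a kaq.
move=> ->; rewrite exprMn add0n.
have -> : (\prod_(j <- rem q (enum 'I_d)) Num.sqrt (n j)%:R) ^+ 2 =
    \prod_(j <- rem q (enum 'I_d)) (n j)%:R :> R.
  by rewrite -prodrXl; apply: eq_bigr => j _; rewrite sqr_sqrtr ?ler0n.
rewrite mulKf// prodf_seq_neq0; apply/allP => j _.
by rewrite pnatr_eq0 -lt0n n0.
Qed.

End iterated_block_sums.

(** * Convergence in law from Laplace transforms and from cosines *)

Section charts.
Context (disp : measure_display) (Omega : measurableType disp) (R : realType).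
Variable P : probability Omega R.
Local Notation Ex := (mean P).
Variables (d : nat) (X : ('I_d -> nat) -> Omega -> R) (C : R).
Hypothesis mX : forall n, mf (X n).
Hypothesis iX : forall n, integ P (X n).
Hypothesis XC : eventually_all (fun n => Ex (fun x => `|X n x|) <= C).

(** The chart is exp(-|x|), whose powers are the Laplace kernels at the integers. The maximum with
    exp(-K) keeps the logarithm continuous. *)
Lemma converges_of_laplace : (forall n x, 0 <= X n x) ->
  (forall k : nat, converges P X (fun y => expR (- (k%:R * `|y|)))) ->
  forall phi, bounded_continuous phi -> converges P X phi.
Proof.
move=> X0 XL; apply: (converges_of_charts mX (D := [set x | 0 <= x]) X0 iX XC) => K K0.
exists (fun x => expR (- `|x|)), (fun u => - ln (Num.max u (expR (- K)))); split.
- move=> x; apply: (@continuous_comp _ _ _ (fun x : R => - `|x|) expR); last exact: continuous_expR.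
  by apply: cvgN; exact: norm_continuous.
- by move=> x; rewrite expR_ge0/= expR_le1 oppr_le0.
- move=> u.
  apply: (@continuous_comp _ _ _ (fun u : R => Num.max u (expR (- K))) (fun v => - ln v)).
    apply: (@continuous_max _ _ id (fun=> expR (- K)) u); first exact: cvg_id.
    exact: cvg_cst.
  by apply: cvgN; apply: continuous_ln; rewrite lt_max expR_gt0 orbT.
- move=> x /= x0 xK; rewrite ger0_norm// in xK; rewrite ger0_norm// max_l ?ler_expR ?lerN2//.
  by rewrite expRK opprK.
- move=> k; rewrite (_ : (fun x => _) = (fun y => expR (- (k%:R * `|y|))))//.
  by apply/funext => y; rewrite -expRM_natl mulrN.
Qed.

Lemma sin_mul_cos (a b : R) :
  sin a * cos b = 2^-1 * cos (b + a - pi / 2) - 2^-1 * cos (b - a - pi / 2).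
Proof.
by rewrite !cosBpihalf sinD sinB; field.
Qed.

(** The chart is (1 + sin (r x)) / 2, whose powers are combinations of cosines with phases. *)
Lemma converges_of_cos :
  (forall c th, converges P X (fun y => cos (c * y + th))) ->
  forall phi, bounded_continuous phi -> converges P X phi.
Proof.
move=> Xc; apply: (converges_of_charts mX (D := setT) (fun _ _ => I) iX XC) => K K0.
have lin (c th : R) : continuous (fun x : R => c * x + th).
  move=> x; apply: cvgD; last exact: cvg_cst.
  by apply: cvgMr; exact: cvg_id.
(* For |x| <= K this gives |r x| <= 1 / 2 < pi / 2, where the sine is inverted by [asin]; clipping
   at sin (1 / 2) stays where [asin] is continuous. *)
pose r := (2 * K)^-1; have r0 : 0 < r by rewrite invr_gt0 mulr_gt0.
pose y x : R := 2^-1 + 2^-1 * sin (r * x).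
have cy : continuous y.
  move=> x; apply: cvgD; first exact: cvg_cst.
  apply: cvgMr; apply: (@continuous_comp _ _ _ ( *%R r) sin); last exact: continuous_sin.
  by apply: cvgMr; exact: cvg_id.
have y01 x : 0 <= y x <= 1.
  by have := sin_geN1 (r * x); have := sin_le1 (r * x); rewrite /y; lra.
have by_ : bounded_continuous y.
  by split => //; exists 1 => x; have /andP[? ?] := y01 x; rewrite ger0_norm.
have p2 := @pihalf_ge1 R.
have s0 : 0 <= sin 2^-1 :> R by apply: sin_ge0_pi; lra.
have s1 : sin 2^-1 < 1 :> R.
  rewrite -[ltRHS](@sin_pihalf R) ltr_sin ?in_itv/=//; lra.
exists y, (fun u => r^-1 * asin (clip (sin 2^-1) (2 * u - 1))); split => //.
- move=> u; apply: cvgMr.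
  apply: (@continuous_comp _ _ _ (fun u : R => clip (sin 2^-1) (2 * u - 1)) asin).
    apply: (@continuous_comp _ _ _ (fun u : R => 2 * u + -1) (clip (sin 2^-1))).
      exact: lin.
    exact: continuous_clip.
  apply: continuous_asin; have := abs_clip (2 * u - 1) s0; rewrite ler_norml; lra.
- move=> x _ xK; rewrite /y.
  have := xK; rewrite ler_norml => /andP[x1 x2].
  have u1 : - 2^-1 <= r * x by rewrite ler_pdivlMl ?mulr_gt0//; lra.
  have u2 : r * x <= 2^-1 by rewrite ler_pdivrMl ?mulr_gt0//; lra.
  have -> : 2 * (2^-1 + 2^-1 * sin (r * x)) - 1 = sin (r * x) by field.
  have h1 : sin (r * x) <= sin 2^-1 by rewrite leNgt ltr_sin ?in_itv/= -?leNgt//; lra.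
  have h2 : - sin 2^-1 <= sin (r * x) by rewrite -sinN leNgt ltr_sin ?in_itv/= -?leNgt//; lra.
  have -> : clip (sin 2^-1) (sin (r * x)) = sin (r * x).
    by case: (clip_spec (sin (r * x)) s0) => -[-> ?]; lra.
  by rewrite sinK ?in_itv/= ?mulKf ?gt_eqF//; lra.
have bcos c th : bounded_continuous (fun x : R => cos (c * x + th)).
  split; last by exists 1 => x; exact: cos_max.
  move=> x; apply: (@continuous_comp _ _ _ (fun x : R => c * x + th) cos).
    exact: lin.
  exact: continuous_cos.
have bX k : bounded_continuous (fun x => y x ^+ k).
  elim: k => [|k IH]; first by under eq_fun do rewrite expr0; exact: bc_cst.
  by under eq_fun do rewrite exprS; exact: bcM.
(* The additional cosine absorbs, by the product formula, the sine in each new factor [y]. *)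
suff H k c th : converges P X (fun x => y x ^+ k * cos (c * x + th)).
  move=> k; have := H k 0 0; congr (converges P X _).
  by apply/funext => x; rewrite mul0r addr0 cos0 mulr1.
elim: k c th => [|k IH] c th.
  by under eq_fun do rewrite expr0 mul1r; exact: Xc.
have bXc c' th' : bounded_continuous (fun x => y x ^+ k * cos (c' * x + th')) by exact: bcM.
rewrite (_ : (fun x => _) = (fun x => 2^-1 * (y x ^+ k * cos (c * x + th)) +
    (4^-1 * (y x ^+ k * cos ((c + r) * x + (th - pi / 2))) +
     (- 4^-1) * (y x ^+ k * cos ((c - r) * x + (th - pi / 2)))))); last first.
  apply/funext => x; rewrite exprS.
  have -> : (c + r) * x + (th - pi / 2) = c * x + th + r * x - pi / 2 by ring.
  have -> : (c - r) * x + (th - pi / 2) = c * x + th - r * x - pi / 2 by ring.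
  have := sin_mul_cos (r * x) (c * x + th).
  rewrite {1}/y; set s := sin _; set c0 := cos _; set c1 := cos _; set c2 := cos _ => E.
  transitivity (2^-1 * (y x ^+ k * c0) + 2^-1 * (y x ^+ k * (s * c0))); first by field.
  by rewrite E; field.
apply: convergesD => //; [exact: bcZ|by apply: bcD; exact: bcZ|exact: convergesZ|].
by apply: convergesD => //; [exact: bcZ|exact: bcZ|exact: convergesZ|exact: convergesZ].
Qed.

End charts.

Lemma eq_tends_to (R : realType) d (h h' : ('I_d -> nat) -> R) l :
  eventually_all (fun n => h n = h' n) -> tends_to h l -> tends_to h' l.
Proof.
move=> hh' hl; rewrite -[l]mul1r; apply: tends_to_near hl => eps e0.
have [K HK] := hh'; exists K => n /HK ->.
by rewrite mul1r subrr normr0 ltW.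
Qed.

(** * Limits and moments of the normalized sums *)

Section normalized_sums.
Context (disp : measure_display) (Omega : measurableType disp) (R : realType).
Variable P : probability Omega R.
Local Notation Ex := (mean P).
Local Notation L2 := (L2 P).
Local Notation integ := (integ P).
Variables (d : nat) (T : 'rV[int]_d -> Omega -> Omega).
Hypothesis HT : Zd_action P T.

Lemma bsumZ (s : seq 'I_d) n w (c : R) (g : Omega -> R) :
  bsum T s n w (fun x => c * g x) = (fun x => c * bsum T s n w g x).
Proof.
elim: s => [//|q s IH]; apply/funext => x /=; rewrite IH /dirsum mulrCA; congr (_ * _).
by rewrite mulr_sumr; apply: eq_bigr => a _; rewrite mulrCA.
Qed.

Variables (F : 'I_d -> int -> set_system Omega) (f : Omega -> R).
Hypothesis HF : multiple_filtration T F.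
Hypothesis fq : forall q, mdq P F q f.
Hypothesis fL : L2 f.
Hypothesis hd : (1 <= d)%N.
Implicit Types (n : 'I_d -> nat).

Let s2 : R := Ex (fun x => f x ^+ 2).
Let w1 : 'I_d -> nat -> R := fun _ _ => 1.
Let q0 := Ordinal hd.
Local Notation S := (normalized_sum T f).
Local Notation A := (normalized_sum_squares T f q0).

Let autT i : automorphism P (T i). Proof. exact: Zd_action_automorphism HT i. Qed.

Lemma L2_normalized_sum n : L2 (S n).
Proof. by apply: L2Z; apply: L2_sum => k; exact: (L2_automorphism (autT _)). Qed.

Lemma integ_normalized_sum_squares n : integ (A n).
Proof.
apply: integZ; apply: integ_sum => a _; apply: (L2_sum _ _ _).2 => k.
exact: (L2_automorphism (autT _)).
Qed.

Lemma normalized_sum_squares_ge0 n x : 0 <= A n x.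
Proof.
rewrite /normalized_sum_squares mulr_ge0//.
  by rewrite invr_ge0 prodr_ge0.
by apply: sumr_ge0 => a _; exact: sqr_ge0.
Qed.

(** The result for blocks is applied to c f: it reaches every frequency and moves the Laplace
    parameter from 1 / 2 to c^2 / 2. *)
Lemma normalized_sum_limits (c : R) : exists l : R,
  (forall th, tends_to (fun n => Ex (fun x => cos (c * S n x + th))) (cos th * l)) /\
  tends_to (fun n => Ex (fun x => expR (- (A n x * c ^+ 2 / 2)))) l.
Proof.
have [Kf [K0 tf]] := L2_tail_controlled (L2Z c fL).
have [l [Hcos Hlap]] := block_sum_limits HT HF (fun q => mdqZ HF c (fq q)) (L2Z c fL)
  K0 tf hd.
exists l; split => [th|].
  apply: eq_tends_to (Hcos th); exists 1%N => n n0.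
  apply: eq_Ex => x; rewrite (normalized_sum_bsum HT)//.
  by rewrite bsumZ.
apply: eq_tends_to (Hlap q0); exists 1%N => n n0.
apply: eq_Ex => x; rewrite (normalized_sum_squares_bracket HT)//.
congr (expR (- (_ / 2))); rewrite /bracket [RHS]mulrC [RHS]mulrCA; congr (_ * _).
rewrite mulr_sumr; apply: eq_bigr => a _.
by rewrite /slice_path /slice bsumZ exprMn.
Qed.

Lemma Ex_normalized_sum_sqr :
  eventually_all (fun n => Ex (fun x => S n x ^+ 2) = s2).
Proof.
have [Kf [K0 tf]] := L2_tail_controlled fL.
exists 1%N => n n0.
have [_ _ sE _] := bsum_properties HT HF (enum_uniq 'I_d) n0 (fun q => signs1 R) fq
  (erefl _) K0 fL tf.
by rewrite -[RHS]sE; apply: eq_Ex => x; rewrite (normalized_sum_bsum HT).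
Qed.

Let slice_moments : exists2 Kd : R -> R, (forall eta, 0 < eta -> 0 <= Kd eta) &
  forall n, (forall j, (0 < n j)%N) -> forall a,
  [/\ L2 (slice_path T f q0 n w1 a), Ex (fun x => slice_path T f q0 n w1 a x ^+ 2) = s2 &
      tail_controlled P Kd (slice_path T f q0 n w1 a)].
Proof.
have [Kf [K0 tf]] := L2_tail_controlled fL.
set Kd := iter (size (rem q0 (enum 'I_d))) (next_cut s2) Kf.
have Kd0 eta : 0 < eta -> 0 <= Kd eta.
  by apply: iter_next_cut_ge0 => //; apply: Ex_ge0 => x; exact: sqr_ge0.
exists Kd => // n n0 a.
have [_ sL s2E st] := bsum_properties HT HF (rem_uniq q0 (enum_uniq 'I_d)) n0
  (fun q => signs1 R) fq (erefl _) K0 fL tf.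
split; first exact: (L2_automorphism (autT _) sL).
- rewrite -[RHS]s2E.
  exact: (Ex_automorphism (autT (step q0 a.+1)) sL.2).
- exact: (tail_controlled_action HT _ sL Kd0 st).
Qed.

Lemma Ex_normalized_sum_squares : eventually_all (fun n => Ex (A n) = s2).
Proof.
have [Kd _ HKd] := slice_moments; exists 1%N => n n0.
have nq : (n q0)%:R != 0 :> R by rewrite pnatr_eq0 -lt0n n0.
rewrite (eq_Ex _ (normalized_sum_squares_bracket HT f n0 q0)) /bracket.
have i2 a : integ (fun x => slice_path T f q0 n w1 (0 + a) x ^+ 2).
  by have [[_ ?] _ _] := HKd n n0 (0 + a)%N.
rewrite ExZ; last by apply: integ_sum => a _.
rewrite Ex_sum => [|a _ //].
rewrite (eq_bigr (fun=> s2)); first by rewrite sumr_const card_ord -[s2 *+ _]mulr_natl mulKf.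
by move=> a _; have [_ + _] := HKd n n0 (0 + a)%N.
Qed.

(** The average of squares exceeds 2 K^2 by at most twice the average of the squared excesses of the
    slices, which share a modulus. *)
Lemma normalized_sum_squares_tail (eps : R) : 0 < eps -> exists2 K : R, 0 <= K &
  eventually_all (fun n => Ex (fun x => Num.max 0 (A n x - K)) <= eps).
Proof.
move=> e0; have e2 : 0 < eps / 2 by rewrite divr_gt0.
have [Kd Kd0 HKd] := slice_moments.
exists (2 * Kd (eps / 2) ^+ 2); first by rewrite mulr_ge0 ?sqr_ge0.
exists 1%N => n n0; set K := Kd _.
have K0 : 0 <= K by exact: Kd0.
have nq : 0 < (n q0)%:R :> R by rewrite ltr0n n0.
have nq0 : (n q0)%:R != 0 :> R by rewrite gt_eqF.
pose Y a := slice_path T f q0 n w1 (0 + a)%N.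
have iE a : integ (fun x => excess K (Y a x) ^+ 2).
  have [YL _ _] := HKd n n0 (0 + a)%N.
  apply: (integ_le _ _ YL.2).
    by apply/mfX/mf_comp; [exact: continuous_excess|exact: L2_mf YL].
  by move=> x; rewrite ger0_norm ?sqr_ge0// excess_sqr_le.
pose B x := (n q0)%:R^-1 * \sum_(a < n q0) 2 * excess K (Y a x) ^+ 2.
have iB : integ B.
  by apply: integZ; apply: integ_sum => a _; exact: integZ.
have AB x : Num.max 0 (A n x - 2 * K ^+ 2) <= B x.
  rewrite ge_max; apply/andP; split.
    rewrite mulr_ge0 ?invr_ge0 ?ler0n// sumr_ge0// => a _.
    by rewrite mulr_ge0 ?sqr_ge0.
  rewrite lerBlDr (normalized_sum_squares_bracket HT)// /bracket /B ler_pdivrMl//.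
  rewrite mulrDr mulVKf//.
  have -> : (n q0)%:R * (2 * K ^+ 2) = \sum_(a < n q0) 2 * K ^+ 2.
    by rewrite sumr_const card_ord -[RHS]mulr_natl.
  by rewrite -big_split/=; apply: ler_sum => a _; exact: sqr_le_excess.
have iM : integ (fun x => Num.max 0 (A n x - 2 * K ^+ 2)).
  apply: (integ_le _ _ iB); last first.
    by move=> x; rewrite ger0_norm// le_max lexx.
  apply: (mf_comp (u := fun y : R => Num.max 0 (y - 2 * K ^+ 2))).
    move=> y; apply: (@continuous_max _ _ (fun=> 0) (fun y : R => y - 2 * K ^+ 2) y).
      exact: cvg_cst.
    by apply: cvgB; [exact: cvg_id|exact: cvg_cst].
  exact: (integ_mf (integ_normalized_sum_squares n)).
apply: (le_trans (le_Ex iM iB AB)).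
rewrite ExZ; last by apply: integ_sum => a _; exact: integZ.
rewrite Ex_sum => [|a _]; last exact: integZ.
rewrite ler_pdivrMl//.
have -> : (n q0)%:R * eps = \sum_(a < n q0) eps.
  by rewrite sumr_const card_ord -[RHS]mulr_natl.
apply: ler_sum => a _; rewrite ExZ//.
by have [_ _ /(_ _ e2)] := HKd n n0 (0 + a)%N; rewrite -/K; lra.
Qed.

End normalized_sums.

Lemma tends_to_le (R : realType) d (h h' : ('I_d -> nat) -> R) l l' :
  tends_to h l -> tends_to h' l' -> eventually_all (fun n => h n <= h' n) -> l <= l'.
Proof.
move=> /tends_toP hl /tends_toP hl' [K HK].
rewrite -subr_ge0; apply: (cvgr_to_ge (cvgB hl' hl)).
by exists K => // n /HK/=; rewrite subr_ge0.
Qed.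

Lemma tends_to_uniq (R : realType) d (h : ('I_d -> nat) -> R) l l' :
  tends_to h l -> tends_to h l' -> l = l'.
Proof.
move=> hl hl'; have hh : eventually_all (fun n => h n <= h n) by exists 0%N.
by apply/le_anti; rewrite (tends_to_le hl hl' hh) (tends_to_le hl' hl hh).
Qed.

(** * The nonnegative variable carried by the limit law *)

Section positive_part.
Context (R : realType) (nu : probability R R).

(** The random variable of the theorem is required to be nonnegative at every point. Taking the
    positive part on the line achieves this, and as the averages of squares are nonnegative it does
    not change the limits of their expectations. *)
Definition pos_part (y : R) : R := Num.max 0 y.

Lemma continuous_pos_part : continuous pos_part.
Proof.
move=> y; apply: (@continuous_max _ _ (fun=> 0) id y); first exact: cvg_cst.
exact: cvg_id.
Qed.

Lemma mf_pos_part : mf pos_part.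
Proof. exact: continuous_measurable_fun continuous_pos_part. Qed.

Let pos_part_mixin := isMeasurableFun.Build _ _ _ _ _ mf_pos_part.
Definition pos_part_rv : {RV nu >-> R} := HB.pack pos_part pos_part_mixin.

Lemma bc_pos_part (phi : R -> R) : bounded_continuous phi ->
  bounded_continuous (fun y => phi (pos_part y)).
Proof.
move=> [cphi [M HM]]; split; last by exists M.
move=> y; apply: (@continuous_comp _ _ _ pos_part phi); last exact: cphi.
exact: continuous_pos_part.
Qed.

Lemma bc_truncation (m : nat) : bounded_continuous (fun y => Num.min (pos_part y) m%:R).
Proof.
split.
  move=> y; apply: (@continuous_min _ _ pos_part (fun=> m%:R) y); last exact: cvg_cst.
  exact: continuous_pos_part.
exists m%:R => y; rewrite ger0_norm ?ge_min ?lexx ?orbT//.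
by rewrite le_min ler0n andbT le_max lexx.
Qed.

Lemma expectation_pos_part (s2 : R) :
  (fun m : nat => mean nu (fun y => Num.min (pos_part y) m%:R)) @ \oo --> s2 ->
  ('E_nu[pos_part_rv] = s2%:E)%E.
Proof.
move=> Hs; rewrite expectation_def.
pose g (m : nat) (y : R) : \bar R := (Num.min (pos_part y) m%:R)%:E.
have gL : (\int[nu]_y g m y)%E @[m --> \oo] --> s2%:E.
  rewrite (_ : (fun m => _) = (fun m : nat => (mean nu (fun y => Num.min (pos_part y) m%:R))%:E)).
    by apply: cvg_EFin => //; exact: nearW.
  by apply/funext => m; rewrite EFin_Ex//; apply: bc_integ; exact: bc_truncation.
apply: (cvg_unique _ _ gL) => //.
have gl y : lim (g m y @[m --> \oo]) = (pos_part y)%:E.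
  apply: cvg_lim => //; apply: cvg_near_cst.
  have [N HN] := natr_ge (pos_part y); exists N => // m /= /HN Hm.
  by rewrite /g min_l.
rewrite (_ : (fun w => (pos_part_rv w)%:E) = (fun y => lim (g m y @[m --> \oo]))); last first.
  by apply/funext => y; rewrite gl.
apply: cvg_monotone_convergence => //.
- by move=> m; apply/measurable_EFinP; exact: bc_mf (bc_truncation m).
- by move=> m y _; rewrite lee_fin le_min ler0n andbT le_max lexx.
- move=> y _ m m' mm'; rewrite lee_fin le_min ge_min lexx/= ge_min.
  by rewrite ler_nat mm' orbT.
Qed.

Lemma Ex_distribution_pos_part (phi : R -> R) : bounded_continuous phi ->
  mean (distribution nu pos_part_rv) phi = mean nu (fun y => phi (pos_part y)).
Proof.
move=> bphi; apply: EFin_inj.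
rewrite (EFin_Ex (bc_integ _ bphi)) (EFin_Ex (bc_integ nu (bc_pos_part bphi))).
apply: (integral_distribution (X := pos_part_rv)).
  by apply/measurable_EFinP; exact: bc_mf.
exact: (bc_integ nu (bc_pos_part bphi)).
Qed.

End positive_part.

(** * The two limit laws and the mean of the second *)

Section limit_laws.
Context (disp : measure_display) (Omega : measurableType disp) (R : realType).
Variable P : probability Omega R.
Local Notation Ex := (mean P).
Local Notation L2 := (L2 P).
Local Notation integ := (integ P).
Variables (d : nat) (T : 'rV[int]_d -> Omega -> Omega).
Hypothesis HT : Zd_action P T.
Variables (F : 'I_d -> int -> set_system Omega) (f : Omega -> R).
Hypothesis HF : multiple_filtration T F.
Hypothesis fq : forall q, mdq P F q f.
Hypothesis fL : L2 f.
Hypothesis hd : (1 <= d)%N.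

Let s2 : R := Ex (fun x => f x ^+ 2).
Local Notation S := (normalized_sum T f).
Local Notation A := (normalized_sum_squares T f (Ordinal hd)).

Let S_L2 n : L2 (S n). Proof. exact: (L2_normalized_sum HT fL). Qed.
Let iA n : integ (A n). Proof. exact: (integ_normalized_sum_squares HT fL). Qed.

Lemma normalized_sum_law : exists nu : probability R R,
  forall phi, bounded_continuous phi ->
    tends_to (fun n => Ex (fun x => phi (S n x))) (mean nu phi).
Proof.
have iS n : integ (S n) by exact: L2_integ.
have mS n : mf (S n) by exact: L2_mf (S_L2 n).
have SC : eventually_all (fun n => Ex (fun x => `|S n x|) <= 1 + s2).
  have [K HK] := Ex_normalized_sum_sqr HT HF fq fL; exists K => n /HK SE.
  rewrite /s2 -SE -[X in X + _](Ex_cst P) -ExD; [|exact: integ_cst|exact: (S_L2 n).2].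
  apply: le_Ex; first exact: integ_abs.
    by apply: integD; [exact: integ_cst|exact: (S_L2 n).2].
  move=> x; rewrite -[S n x ^+ 2]real_normK ?num_real//.
  by have := sqr_ge0 (`|S n x| - 1); have := normr_ge0 (S n x); nra.
apply: (law_of_limit mS iS SC); apply: (converges_of_cos mS iS SC) => c th.
have [l [Hcos _]] := normalized_sum_limits HT HF fq fL hd c.
by exists (cos th * l); exact: Hcos.
Qed.

Lemma normalized_sum_squares_law : exists nu : probability R R,
  forall phi, bounded_continuous phi ->
    tends_to (fun n => Ex (fun x => phi (A n x))) (mean nu phi).
Proof.
have A0 n x : 0 <= A n x := normalized_sum_squares_ge0 T f hd n x.
have mA n : mf (A n) by exact: integ_mf (iA n).
have AC : eventually_all (fun n => Ex (fun x => `|A n x|) <= s2).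
  have [K HK] := Ex_normalized_sum_squares HT HF fq fL hd; exists K => n /HK AE.
  by rewrite -[leRHS]AE le_eqVlt; apply/orP; left; apply/eqP/eq_Ex => x; rewrite ger0_norm.
apply: (law_of_limit mA iA AC); apply: (converges_of_laplace mA iA AC A0) => k.
(* With c = sqrt (2 k) the Laplace parameter c^2 / 2 is k. *)
have [l [_ Hl]] := normalized_sum_limits HT HF fq fL hd (Num.sqrt (2 * k%:R)).
exists l; apply: eq_tends_to Hl; exists 0%N => n _; apply: eq_Ex => x.
rewrite sqr_sqrtr ?mulr_ge0 ?ler0n// ger0_norm//; congr (expR (- _)); by field.
Qed.

(** No mass escapes: before the limit the truncated means are at most s2, and for m >= K they are at
    least s2 - eps, since A <= min (A, m) + max (0, A - K). *)
Lemma truncated_means (nu : probability R R) :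
  (forall phi, bounded_continuous phi ->
    tends_to (fun n => Ex (fun x => phi (A n x))) (mean nu phi)) ->
  (fun m : nat => mean nu (fun y => Num.min (pos_part y) m%:R)) @ \oo --> s2.
Proof.
move=> Hnu; apply/cvgrPdist_le => eps e0.
have [K K0 HK] := normalized_sum_squares_tail HT HF fq fL hd e0.
have [N HN] := natr_ge K; exists N => // m /= /HN Km.
have Hm := Hnu _ (bc_truncation R m).
have cst_lim (c : R) : tends_to (fun _ : 'I_d -> nat => c) c.
  by move=> e' e'0; exists 0%N => n _; rewrite subrr normr0 ltW.
have AE := Ex_normalized_sum_squares HT HF fq fL hd.
have A0 n x : 0 <= A n x := normalized_sum_squares_ge0 T f hd n x.
have it n := integ_bc P (fun n => integ_mf (iA n)) n (bc_truncation R m).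
rewrite ler_norml; apply/andP; split; last first.
  rewrite lerBlDr -lerBlDl; apply: (tends_to_le (cst_lim _) Hm).
  have [K1 HK1] := eventually_all2 HK AE; exists K1 => n /HK1[tail AnE].
  have iM : integ (fun x => Num.max 0 (A n x - K)).
    apply: (integ_le (h := fun x => `|A n x|)); last exact: integ_abs.
      apply: (mf_comp (u := fun y : R => Num.max 0 (y - K))); last exact: integ_mf (iA n).
      move=> y; apply: (@continuous_max _ _ (fun=> 0) (fun y : R => y - K) y).
        exact: cvg_cst.
      by apply: cvgB; [exact: cvg_id|exact: cvg_cst].
    move=> x; rewrite ger0_norm ?le_max ?lexx// ge_max normr_ge0/=.
    by rewrite lerBlDr (le_trans (ler_norm _))// lerDl.
  rewrite lerBlDr -[leLHS]AnE; apply: (@le_trans _ _ (Ex (fun x =>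
      Num.min (pos_part (A n x)) m%:R + Num.max 0 (A n x - K)))).
    apply: le_Ex => //; first exact: integD.
    move=> x; rewrite /pos_part max_r// minElt maxElt.
    by case: ltP => h1; case: ltP => h2; lra.
  by rewrite ExD// lerD2l.
have : mean nu (fun y => Num.min (pos_part y) m%:R) <= s2; last by lra.
apply: (tends_to_le Hm (cst_lim _)).
have [K1 HK1] := AE; exists K1 => n /HK1 AnE; rewrite -[leRHS]AnE.
by apply: le_Ex => // x; rewrite /pos_part max_r// ge_min lexx.
Qed.

End limit_laws.

Local Open Scope complex_scope.

Theorem theorem1 (R : realType) (disp : measure_display)
    (Omega : measurableType disp) (P : probability Omega R)
    (d : nat) (hd : (1 <= d)%N) (T : 'rV[int]_d -> Omega -> Omega)
    (f : Omega -> R) :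
  Zd_action P T ->
  f \in Lfun P 2%:E ->
  multiple_martingale_differences P T f ->
  exists (disp' : measure_display) (Omega' : measurableType disp')
    (Q : probability Omega' R) (eta2 : {RV Q >-> R}),
    [/\ forall w, 0 <= eta2 w,
        ('E_Q[eta2] = 'N[P]_(2%:E)[EFin \o f] ^+ 2)%E,
        exists nu : probability R R,
          (forall t : R, charfun nu t =
             (\int[Q]_w expR (- (eta2 w * t ^+ 2 / 2)))%:C) /\
          cvg_in_distribution (@all_infty d) P (normalized_sum T f) nu
      & cvg_in_distribution (@all_infty d) P
          (normalized_sum_squares T f (Ordinal hd)) (distribution Q eta2)].
Proof.
move=> HT f2 [_ [F [HF fF]]]; have fL := Lfun2_L2 f2.
have fq q : mdq P F q f.
  by have [g0 [g1 [c0 c1 fE]]] := fF q; exact: (mdq_cond_exp HF fL c0 c1 fE).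
have [nu Hnu] := normalized_sum_law HT HF fq fL hd.
have [nuA HA] := normalized_sum_squares_law HT HF fq fL hd.
have A0 n x := normalized_sum_squares_ge0 T f hd n x.
have iA := integ_normalized_sum_squares HT fL hd.
have mA n := integ_mf (iA n).
have mS n := L2_mf (L2_normalized_sum HT fL n).
have HA' phi : bounded_continuous phi ->
    tends_to (fun n => mean P (fun x => phi (normalized_sum_squares T f (Ordinal hd) n x)))
      (mean nuA (fun y => phi (pos_part y))).
  move=> bphi; apply: eq_tends_to (HA _ (bc_pos_part bphi)).
  by exists 0%N => n _; apply: eq_Ex => x; rewrite /pos_part max_r.
(* The other probability space is the line with the limit law of the averages of squares. *)
exists _, R, nuA, (pos_part_rv nuA); split.
- by move=> w; rewrite /= /pos_part le_max lexx.
- rewrite Lnorm2_sqr//; apply: expectation_pos_part.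
  exact: (truncated_means HT HF fq fL HA).
- exists nu; split; last exact: tends_to_cvg_in_distribution.
  move=> t; have [l [Hcos Hlap]] := normalized_sum_limits HT HF fq fL hd t.
  have bcos th : bounded_continuous (fun y => cos (t * y + th)).
    split; last by exists 1 => y; exact: cos_max.
    move=> y; apply: (@continuous_comp _ _ _ (fun y : R => t * y + th) cos).
      by apply: cvgD; [apply: cvgMr; exact: cvg_id|exact: cvg_cst].
    exact: continuous_cos.
  have nucos th : mean nu (fun y => cos (t * y + th)) = cos th * l.
    exact: (tends_to_uniq (Hnu _ (bcos th)) (Hcos th)).
  have bexp : bounded_continuous (fun y => expR (- (pos_part y * t ^+ 2 / 2))).
    split.
      move=> y; apply: (@continuous_comp _ _ _ (fun y => - (pos_part y * t ^+ 2 / 2)) expR).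
        apply: cvgN; apply: cvgMl; apply: cvgMl; exact: continuous_pos_part.
      exact: continuous_expR.
    exists 1 => y; rewrite ger0_norm ?expR_ge0// expR_le1 oppr_le0.
    by rewrite divr_ge0// mulr_ge0 ?sqr_ge0// le_max lexx.
  have lE : mean nuA (fun y => expR (- (pos_part y * t ^+ 2 / 2))) = l.
    apply: (tends_to_uniq (HA _ bexp)); apply: eq_tends_to Hlap.
    by exists 0%N => n _; apply: eq_Ex => x; rewrite /pos_part max_r.
  rewrite /charfun; apply/eqP; rewrite eq_complex/=; apply/andP; split; apply/eqP.
    transitivity (mean nu (fun y => cos (t * y + 0))).
      by apply: eq_Ex => y; rewrite addr0.
    by rewrite nucos cos0 mul1r -lE.
  (* The phase - pi / 2 turns the cosine into the sine, and its limit carries the factor cos (- pi /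
     2) = 0. *)
  transitivity (mean nu (fun y => cos (t * y + - (pi / 2)))).
    by apply: eq_Ex => y; rewrite cosBpihalf.
  by rewrite nucos cosN cos_pihalf mul0r.
- apply: tends_to_cvg_in_distribution => // phi bphi.
  by rewrite Ex_distribution_pos_part//; exact: HA'.
Qed.
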